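(* Let $N\ge2$, $s\in(0,1)$, $q>\frac{N}{2s}$, $0<r<R$, $0\le t<R-r$, and $$\mathcal{B}_t=B_R(0)\setminus\overline{B_r(te_1)}\subset\mathbb{R}^N .$$ Let $g_0,V_0\in L^q(\mathcal{B}_t)$ with $g_0,V_0\ge 0$ and $g_0\not\equiv0$. Let $\underline{g}\in\mathcal{E}(g_0)$, $\underline{V}\in\mathcal{E}(V_0)$ be minimizing weights, i.e. $$\lambda_1(\underline{g},\underline{V})=\min\{\lambda_1(g,V): g\in\mathcal{E}(g_0),\ V\in\mathcal{E}(V_0)\},$$ and let $u$ be a positive first eigenfunction on $\mathcal{B}_t$ associated to $(\underline{g},\underline{V})$. Then: (i) if $t=0$, there exists $\beta\in\mathbb{S}^{N-1}$ such that $u$ and $\underline{g}$ are foliated Schwarz symmetric in $\mathcal{B}_t$ with respect to $\beta$, while $\underline{V}$ is foliated Schwarz symmetric in $\mathcal{B}_t$ with respect to $-\beta$; (ii) if $t>0$ and $V_0=0$, then $u$ and $\underline{g}$ are foliated Schwarz symmetric in $\mathcal{B}_t$ with respect to $-e_1$.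
   Context: $B_\rho(x)$ is the open ball of radius $\rho$ centered at $x$; $e_1=(1,0,\dots,0)$. Put $\Omega=\mathcal{B}_t$. $C_{N,s}>0$ is the normalization constant of the fractional Laplacian $(-\Delta)^s u(x)=C_{N,s}\,\mathrm{P.V.}\int_{\mathbb{R}^N}\frac{u(x)-u(y)}{|x-y|^{N+2s}}\,dy$. $[u]_s=\left(\int_{\mathbb{R}^N}\int_{\mathbb{R}^N}\frac{|u(x)-u(y)|^2}{|x-y|^{N+2s}}\,dx\,dy\right)^{1/2}$; $H_0^s(\Omega)=\{u\in L^2(\mathbb{R}^N):[u]_s<\infty,\ u=0\text{ in }\mathbb{R}^N\setminus\Omega\}$. $$\lambda_1(g,V)=\inf\left\{\frac{\frac{C_{N,s}}{2}[u]_s^2+\int_\Omega V|u|^2dx}{\int_\Omega g|u|^2dx}: u\in H_0^s(\Omega),\ \int_\Omega g|u|^2dx>0\right\}.$$ A first eigenfunction associated to $(g,V)$ is a function $u\in H_0^s(\Omega)$ at which this infimum is attained. For measurable $\phi:\Omega\to\mathbb{R}$, $\mathcal{E}(\phi)$ is the set of measurable $\psi:\Omega\to\mathbb{R}$ with $|\{\psi>\tau\}|=|\{\phi>\tau\}|$ for all $\tau\in\mathbb{R}$ ($|\cdot|$ = Lebesgue measure). Foliated Schwarz symmetry. Let $D$ be a domain radial with respect to $0$ (a ball centered at $0$ or $\mathcal{B}_0$), $f:D\to\mathbb{R}$ nonnegative measurable and $\gamma\in\mathbb{S}^{N-1}$. The foliated Schwarz symmetrization $f^*$ of $f$ with respect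 to $\gamma$ is the function on $D$ such that (a) $f^*(x)=h(\rho,\theta)$ for some $h:[0,\infty)\times[0,\pi)\to\mathbb{R}$ that is decreasing (non-increasing) in $\theta$, where $\rho=|x|$ and $\theta=\arccos\left(\frac{x\cdot\gamma}{|x|}\right)$; (b) for all $a<b$ and $\rho\ge0$, $|\{x:|x|=\rho,\ a<f(x)\le b\}|_{N-1}=|\{x:|x|=\rho,\ a<f^*(x)\le b\}|_{N-1}$, where $|\cdot|_{N-1}$ is $(N-1)$-dimensional measure. $f$ is foliated Schwarz symmetric in $D$ with respect to $\gamma$ if $f=f^*$. For $0<t<R-r$, a nonnegative measurable $f:\mathcal{B}_t\to\mathbb{R}$ is foliated Schwarz symmetric in $\mathcal{B}_t$ with respect to $-e_1$ if its extension $\tilde f$ to $B_R(0)$ by $0$ on $\overline{B_r(te_1)}$ is foliated Schwarz symmetric in $B_R(0)$ with respect to $-e_1$. Functions equal a.e. are identified. *)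

(* Defs.v *)
From HB Require Import structures.
From mathcomp Require Import all_boot all_order all_algebra.
From mathcomp Require Import all_classical all_reals all_analysis.

Set Implicit Arguments.
Unset Strict Implicit.
Unset Printing Implicit Defensive.

Import Order.TTheory GRing.Theory Num.Theory.
Import numFieldNormedType.Exports.

Local Open Scope classical_set_scope.
Local Open Scope ring_scope.

Fact measure_rV_display : measure_display.
Proof. exact: default_measure_display. Qed.

Section measurable_rV.
Context {R : realType} (n : nat).

Let coors : 'I_n -> 'rV[R]_n -> R := fun i x => x ord0 i.

Let rV_set0 : g_sigma_preimage coors set0.
Proof. exact: sigma_algebra0. Qed.

Let rV_setC A : g_sigma_preimage coors A -> g_sigma_preimage coors (~` A).
Proof. exact: sigma_algebraC. Qed.

Let rV_bigcup (F : (set 'rV[R]_n)^nat) :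
  (forall i, g_sigma_preimage coors (F i)) ->
  g_sigma_preimage coors (\bigcup_i (F i)).
Proof. exact: sigma_algebra_bigcup. Qed.

(* The sigma-algebra generated by the coordinates, i.e. the Borel sets. *)
HB.instance Definition _ := @isMeasurable.Build measure_rV_display
  'rV[R]_n (g_sigma_preimage coors) rV_set0 rV_setC rV_bigcup.

Lemma measurable_coord (i : 'I_n) :
  measurable_fun [set: 'rV[R]_n] (fun x : 'rV[R]_n => x ord0 i).
Proof.
move=> _ Y mY; rewrite setTI; apply: sub_sigma_algebra => /=.
rewrite -bigcup_seq/=; exists i => /=; first by rewrite mem_index_enum.
by exists Y => //; rewrite setTI.
Qed.

Lemma measurable_fun_coord d (T : measurableType d) (f : T -> 'rV[R]_n) :
  (forall i, measurable_fun [set: T] (fun x => f x ord0 i)) ->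
  measurable_fun [set: T] f.
Proof.
move=> mf; apply: (@measurability _ _ _ _ _ _
  (\big[setU/set0]_(i < n) preimage_set_system setT (coors i) measurable)) => //.
move=> _ [A /= + <-]; rewrite -bigcup_seq => -[i _ [Y mY <-]].
by rewrite !setTI; have := mf i measurableT Y mY; rewrite setTI.
Qed.

End measurable_rV.

Section cons_rV.
Context {R : realType} (n : nat).

Definition cons_rV (p : R * 'rV[R]_n) : 'rV[R]_n.+1 :=
  \row_i (if unlift ord0 i is Some j then p.2 ord0 j else p.1).

Definition uncons_rV (x : 'rV[R]_n.+1) : R * 'rV[R]_n :=
  (x ord0 ord0, \row_i x ord0 (lift ord0 i)).

Lemma cons_rVK : cancel cons_rV uncons_rV.
Proof.
move=> [a v]; rewrite /uncons_rV /cons_rV mxE unlift_none /=; congr pair.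
by apply/rowP => i; rewrite !mxE liftK.
Qed.

Lemma measurable_cons_rV : measurable_fun setT cons_rV.
Proof.
apply: measurable_fun_coord => i.
under eq_fun do rewrite mxE.
case: unliftP => [j _|_]; last exact: measurable_fst.
exact: (measurableT_comp (measurable_coord j) measurable_snd).
Qed.

Lemma measurable_uncons_rV : measurable_fun setT uncons_rV.
Proof.
apply: measurable_fun_pair; first exact: measurable_coord.
apply: measurable_fun_coord => i.
under eq_fun do rewrite mxE.
exact: measurable_coord.
Qed.

Variable m : {sigma_finite_measure set 'rV[R]_n -> \bar R}.

Definition cons_measure : set 'rV[R]_n.+1 -> \bar R :=
  pushforward (lebesgue_measure \x m)%E cons_rV.

Let push : {measure set 'rV[R]_n.+1 -> \bar R} :=
  measure_function_pushforward__canonical__measure_function_Measure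
    (lebesgue_measure \x m)%E measurable_cons_rV.

HB.instance Definition _ := isMeasure.Build _ _ _ cons_measure
  (measure0 push) (@measure_ge0 _ _ _ push)
  (@measure_semi_sigma_additive _ _ _ push).

Let cons_measure_sigma_finite : sigma_finite setT cons_measure.
Proof.
have /sigma_finiteP[F [TF ndF Foo]] := sigma_finiteT (@lebesgue_measure R).
have /sigma_finiteP[G [TG ndG Goo]] := sigma_finiteT m.
exists (fun k => uncons_rV @^-1` (F k `*` G k)).
  apply/seteqP; split => // x _.
  have [i _ Fi] : (\bigcup_i F i) (uncons_rV x).1 by rewrite -TF.
  have [j _ Gj] : (\bigcup_i G i) (uncons_rV x).2 by rewrite -TG.
  exists (maxn i j) => //; split.
    by move: Fi; exact/subsetPset/ndF/leq_maxl.
  by move: Gj; exact/subsetPset/ndG/leq_maxr.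
move=> k; have [mFk Fk] := Foo k; have [mGk Gk] := Goo k; split.
  rewrite -[X in measurable X]setTI.
  exact: (measurable_uncons_rV measurableT (measurableX mFk mGk)).
rewrite /cons_measure /pushforward -comp_preimage.
rewrite (_ : uncons_rV \o cons_rV = id); last exact/funext/cons_rVK.
by rewrite preimage_id product_measure1E// lte_mul_pinfty// ge0_fin_numE.
Qed.

HB.instance Definition _ := Measure_isSigmaFinite.Build _ _ _ cons_measure
  cons_measure_sigma_finite.

End cons_rV.

Section lebesgue_rV.
Context {R : realType}.

(* n-fold product of the one-dimensional Lebesgue measure; R^0 is one atom. *)
Fixpoint lebesgue_rV (n : nat) : {sigma_finite_measure set 'rV[R]_n -> \bar R} :=
  match n with
  | 0 => \d_(0 : 'rV[R]_0)
  | n'.+1 => cons_measure (lebesgue_rV n')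
  end.

End lebesgue_rV.

(* The library norm on 'rV[R]_n is the sup norm, hence [enorm]. *)
Section euclidean.
Context {R : realType} {n : nat}.
Implicit Types (x c : 'rV[R]_n) (r : R).

Definition dotv x c : R := \sum_(i < n) x ord0 i * c ord0 i.

Definition enorm x : R := Num.sqrt (dotv x x).

Definition eball c r : set 'rV[R]_n := [set x | enorm (x - c) < r].

Definition closed_eball c r : set 'rV[R]_n := [set x | enorm (x - c) <= r].

Definition e1 : 'rV[R]_n := \row_(i < n) (i == 0 :> nat)%:R.

Definition perforated_ball (Rad r t : R) : set 'rV[R]_n :=
  eball 0 Rad `\` closed_eball (t *: e1) r.

(* (n-1)-dimensional measure of a subset A of the sphere of radius rho about 0,
   normalised as in polar coordinates: n rho^(n-1) times the volume of the cone
   over the radial projection of A to the unit sphere. *)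
Definition sphere_measure (rho : R) (A : set 'rV[R]_n) : \bar R :=
  ((n%:R * rho ^+ n.-1)%:E *
   lebesgue_rV n [set y | (0 < enorm y <= 1)%R /\ A ((rho / enorm y) *: y)])%E.

Definition polar_angle (gamma x : 'rV[R]_n) : R :=
  acos (dotv x gamma / enorm x).

End euclidean.

Section eigenvalue.
Context {R : realType} {n : nat}.
Local Notation mu := (@lebesgue_rV R n).
Implicit Types (s : R) (Omega : set 'rV[R]_n) (u g V phi : 'rV[R]_n -> R).

(* The constant for which (-Delta)^s has Fourier symbol |xi|^(2s). *)
Definition fractional_constant s : R :=
  (\int[mu]_z ((1 - cos (dotv z e1)) / enorm z `^ (n%:R + 2 * s)))^-1.

Definition gagliardo_seminorm s u : \bar R :=
  ((\int[mu]_x \int[mu]_y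
     (`|u x - u y| ^+ 2 / enorm (x - y) `^ (n%:R + 2 * s))%:E) `^ 2^-1)%E.

Definition H0s s Omega : set ('rV[R]_n -> R) :=
  [set u | [/\ u \in Lfun mu 2%:E, (gagliardo_seminorm s u < +oo)%E &
             {ae mu, forall x, ~ Omega x -> u x = 0}]].

Definition weighted_mass Omega g u : \bar R :=
  (\int[mu]_(x in Omega) (g x * `|u x| ^+ 2)%:E)%E.

Definition rayleigh s Omega g V u : \bar R :=
  (((fractional_constant s / 2)%:E * gagliardo_seminorm s u ^+ 2 +
    weighted_mass Omega V u) / weighted_mass Omega g u)%E.

Definition admissible s Omega g : set ('rV[R]_n -> R) :=
  [set u | H0s s Omega u /\ (0 < weighted_mass Omega g u)%E].

Definition lambda1 s Omega g V : \bar R :=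
  ereal_inf [set rayleigh s Omega g V u | u in admissible s Omega g].

Definition first_eigenfunction s Omega g V u : Prop :=
  admissible s Omega g u /\ rayleigh s Omega g V u = lambda1 s Omega g V.

(* Functions on Omega are represented by total functions; only their values on
   Omega matter. *)
Definition in_Lq (q : R) Omega phi : Prop := phi \_ Omega \in Lfun mu q%:E.

Definition equimeasurable Omega phi : set ('rV[R]_n -> R) :=
  [set psi | measurable_fun Omega psi /\
     forall tau : R, mu (Omega `&` [set x | tau < psi x]) =
                     mu (Omega `&` [set x | tau < phi x])].

Definition minimizing_weights s Omega g0 V0 g V : Prop :=
  [/\ equimeasurable Omega g0 g, equimeasurable Omega V0 V &
      forall g' V', equimeasurable Omega g0 g' -> equimeasurable Omega V0 V' ->
        (lambda1 s Omega g V <= lambda1 s Omega g' V')%E].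

End eigenvalue.

Section foliated_schwarz.
Context {R : realType} {n : nat}.
Local Notation mu := (@lebesgue_rV R n).
Implicit Types (D : set 'rV[R]_n) (gamma : 'rV[R]_n) (f : 'rV[R]_n -> R).

(* On a sphere where f is essentially unbounded, the rearrangement can only have
   the value +oo at the pole theta = 0, so h and f^* take values in \bar R;
   equimeasurability with the finite f keeps f^* finite for theta > 0. The angle is undefined at x = 0,
   and theta = pi is not in the domain of h. *)
Definition is_foliated_symmetrization D gamma f (fstar : 'rV[R]_n -> \bar R) :
    Prop :=
  (exists h : R -> R -> \bar R,
     (forall rho theta theta' : R, 0 <= rho -> 0 <= theta <= theta' ->
        theta' < pi -> (h rho theta' <= h rho theta)%E) /\
     (forall x, D x -> x != 0 -> polar_angle gamma x < pi ->
        fstar x = h (enorm x) (polar_angle gamma x))) /\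
  (forall a b rho : R, a < b -> 0 <= rho ->
     sphere_measure rho [set x | [/\ D x, enorm x = rho & a < f x <= b]] =
     sphere_measure rho
       [set x | [/\ D x, enorm x = rho & (a%:E < fstar x <= b%:E)%E]]).

(* f = f^* in the space of functions modulo equality a.e.: since f^* is defined
   sphere by sphere, some representative f0 of f has to coincide with f0^*. *)
Definition foliated_schwarz_symmetric D gamma f : Prop :=
  exists f0 : 'rV[R]_n -> R,
    [/\ measurable_fun D f0, (forall x, D x -> 0 <= f0 x),
        f0 = f %[ae mu in D] &
        exists2 fstar, is_foliated_symmetrization D gamma f0 fstar &
          EFin \o f0 = fstar %[ae mu in D]].

(* Symmetry in B_R(0) minus the closed ball B_r(t e_1). That set is radial for
   t = 0; for t > 0 the function is first extended by 0 to B_R(0). *)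
Definition foliated_schwarz_in (Rad r t : R) gamma f :
    Prop :=
  if t == 0 then foliated_schwarz_symmetric (perforated_ball Rad r t) gamma f
  else foliated_schwarz_symmetric (eball 0 Rad) gamma
         (f \_ (perforated_ball Rad r t)).

End foliated_schwarz.

(* Main.v *)
Require Import Defs.
From mathcomp Require Import all_boot all_order all_algebra.
From mathcomp Require Import all_classical all_reals all_analysis.
From mathcomp Require Import measurable_realfun measurable_fun_approximation.
From mathcomp Require Import ring lra.

Set Implicit Arguments.
Unset Strict Implicit.
Unset Printing Implicit Defensive.

Import Order.TTheory GRing.Theory Num.Theory.
Import numFieldNormedType.Exports.

Local Open Scope classical_set_scope.
Local Open Scope ring_scope.

(** The proof compares the minimizing configuration with its two-point rearrangements. For a vector
    [a], let [refl a] be the reflection in the hyperplane orthogonal to [a]. The polarization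
    [polarize a u] puts the larger of the values of [u] at [x] and [refl a x] on the side of [a], and
    [tilt a u] is nonnegative where the two values already are in this order. Points on the same side
    are closer to each other than to the mirror images; hence polarization does not increase the
    Gagliardo energy, and it preserves the energy only if [tilt a u] has a constant sign
    ([energy_polarize]). Polarizing [g] towards [a] increases the mass of [g u^2], polarizing [V]
    towards [- a] decreases the mass of [V u^2] ([mass_polarize_ge], [mass_polarize_le]), and both
    operations produce equimeasurable weights. Since the weights are minimizing, the Rayleigh
    quotient of the polarized configuration cannot be smaller, so that all these inequalities are
    equalities ([rayleigh_rigidity]) and [u] is tilted to one side of the hyperplane.

    If [u] is tilted towards [a], it is a first eigenfunction of the original and of the polarized
    weights, for the same eigenvalue. Comparing both variational problems along the perturbations
    [u (1 + e chi)] and [u (1 - e chi)], with [chi] a truncation of the linear form [x.a], shows that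
    the weights coincide with their polarizations ([weights_eq_of_common_eigenfunction]). These
    arguments require finite masses: weights in [L^q], [q > N / (2 s)], are integrable against [u^2]
    by an iterated gain of integrability of [u] ([weighted_square_fin]).

    The side of the tilt is read off the first moment [m] of [u], as [2 m.a] is the integral of
    [tilt a u] ([tilt_of_first_moment]). In an annulus, the axis [beta] is the direction of [m]. If
    the hole is eccentric, then for [a] on the side of [- e1] the mirror image of the hole sticks out
    of the hole on the side of [a], so [u], which is zero in the hole and positive outside, cannot be
    tilted away from [a] ([tilt_le0_absurd]).

    It remains to pass from the inequalities [tilt a f >= 0] almost everywhere, for all [a] with
    [a.beta >= 0], to symmetry. Any two points [x], [y] of a sphere are exchanged by the reflection
    with [a = x - y]; since the reflected balls are the balls about the reflected centers, averages of
    [f] over balls of a fixed radius satisfy the monotonicity in [x.beta] at every point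
    ([ball_average_mirror]). Translations are continuous in mean, so averages over shrinking balls
    converge almost everywhere to [f] along a sequence of radii, and their upper limit is a
    representative of [f] which on each sphere is a nondecreasing function of [x.beta]
    ([radial_representative]). Such a function is its own foliated Schwarz symmetrization
    ([profile_foliated]). *)

(** * Euclidean geometry and reflections *)

Section euclidean_geometry.
Context {R : realType} {n : nat}.
Implicit Types (x y z a b c : 'rV[R]_n) (k r : R).

Lemma dotvC x y : dotv x y = dotv y x.
Proof. by apply: eq_bigr => i _; rewrite mulrC. Qed.

Lemma dotvDl x y z : dotv (x + y) z = dotv x z + dotv y z.
Proof. by rewrite -big_split; apply: eq_bigr => i _; rewrite mxE mulrDl. Qed.

Lemma dotvZl k x y : dotv (k *: x) y = k * dotv x y.
Proof. by rewrite mulr_sumr; apply: eq_bigr => i _; rewrite mxE mulrA. Qed.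

Lemma dotvDr x y z : dotv x (y + z) = dotv x y + dotv x z.
Proof. by rewrite !(dotvC x) dotvDl. Qed.

Lemma dotvZr k x y : dotv x (k *: y) = k * dotv x y.
Proof. by rewrite !(dotvC x) dotvZl. Qed.

Lemma dotvNl x y : dotv (- x) y = - dotv x y.
Proof. by rewrite -scaleN1r dotvZl mulN1r. Qed.

Lemma dotvNr x y : dotv x (- y) = - dotv x y.
Proof. by rewrite !(dotvC x) dotvNl. Qed.

Definition dotvE := (dotvDl, dotvDr, dotvZl, dotvZr, dotvNl, dotvNr).

Lemma dot0v x : dotv 0 x = 0.
Proof. by rewrite -(scale0r 0) dotvZl mul0r. Qed.

Lemma dotv0 x : dotv x 0 = 0.
Proof. by rewrite dotvC dot0v. Qed.

Lemma dotvv_ge0 x : 0 <= dotv x x.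
Proof. by apply: sumr_ge0 => i _; rewrite -expr2 sqr_ge0. Qed.

Lemma dotvv_eq0 x : (dotv x x == 0) = (x == 0).
Proof.
apply/idP/eqP => [|->]; last by rewrite dot0v.
rewrite psumr_eq0 => [/allP xx|i _]; last by rewrite -expr2 sqr_ge0.
apply/rowP => i; rewrite mxE; have := xx i (mem_index_enum i).
by rewrite /= mulf_eq0 orbb => /eqP.
Qed.

Lemma sqr_enorm x : enorm x ^+ 2 = dotv x x.
Proof. by rewrite sqr_sqrtr// dotvv_ge0. Qed.

Lemma enorm_ge0 x : 0 <= enorm x.
Proof. exact: sqrtr_ge0. Qed.

Lemma enorm_eq0 x : (enorm x == 0) = (x == 0).
Proof. by rewrite -dotvv_eq0 -sqr_enorm sqrf_eq0. Qed.

Lemma enorm0 : enorm (0 : 'rV[R]_n) = 0.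
Proof. by apply/eqP; rewrite enorm_eq0. Qed.

Lemma enorm_gt0 x : (0 < enorm x) = (x != 0).
Proof. by rewrite lt_neqAle enorm_ge0 andbT eq_sym enorm_eq0. Qed.

Lemma dotvv_gt0 x : (0 < dotv x x) = (x != 0).
Proof. by rewrite lt_neqAle dotvv_ge0 andbT eq_sym dotvv_eq0. Qed.

Lemma enormN x : enorm (- x) = enorm x.
Proof. by rewrite /enorm !dotvE opprK. Qed.

Lemma enormZ k x : enorm (k *: x) = `|k| * enorm x.
Proof. by rewrite /enorm !dotvE mulrA -expr2 sqrtrM ?sqr_ge0// sqrtr_sqr. Qed.

Lemma enormBC x y : enorm (x - y) = enorm (y - x).
Proof. by rewrite -enormN opprB. Qed.

Lemma cauchy_schwarz x y : `|dotv x y| <= enorm x * enorm y.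
Proof.
have [->|y0] := eqVneq y 0; first by rewrite dotv0 normr0 enorm0 mulr0.
have := dotvv_ge0 (dotv y y *: x - dotv x y *: y).
have yy : 0 < dotv y y by rewrite dotvv_gt0.
rewrite !dotvE (dotvC y x).
rewrite [X in 0 <= X](_ : _ = dotv y y * (dotv x x * dotv y y - dotv x y ^+ 2));
  last by ring.
rewrite pmulr_rge0// subr_ge0 -!sqr_enorm -exprMn -real_normK ?num_real//.
by rewrite ler_pXn2r// nnegrE ?mulr_ge0 ?enorm_ge0.
Qed.

Lemma dotv_le x y : dotv x y <= enorm x * enorm y.
Proof. exact: le_trans (ler_norm _) (cauchy_schwarz x y). Qed.

Lemma enorm_triangle x y : enorm (x + y) <= enorm x + enorm y.
Proof.
rewrite -(@ler_pXn2r _ 2)// ?nnegrE ?addr_ge0 ?enorm_ge0//.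
rewrite sqr_enorm !dotvE (dotvC y x) sqrrD -!sqr_enorm mulr2n.
have := dotv_le x y; lra.
Qed.

Lemma enorm_triangleB x y z : enorm (x - z) <= enorm (x - y) + enorm (y - z).
Proof. by rewrite -[X in enorm X](subrKA y) enorm_triangle. Qed.

Lemma coord_le_enorm x i : `|x ord0 i| <= enorm x.
Proof.
rewrite -(@ler_pXn2r _ 2)// ?nnegrE ?enorm_ge0//.
rewrite real_normK ?num_real// sqr_enorm /dotv (bigD1 i)//= -expr2.
by rewrite lerDl sumr_ge0// => j _; rewrite -expr2 sqr_ge0.
Qed.

Lemma enorm_le_sum x : enorm x <= \sum_i `|x ord0 i|.
Proof.
rewrite -(@ler_pXn2r _ 2)// ?nnegrE ?enorm_ge0// ?sumr_ge0//.
rewrite sqr_enorm expr2 mulr_sumr ler_sum// => i _.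
rewrite (le_trans (ler_norm _))// normrM ler_wpM2r//.
by rewrite (bigD1 i)//= lerDl sumr_ge0.
Qed.

Lemma enorm_le_cube x k : (forall i, `|x ord0 i| <= k) -> enorm x <= n%:R * k.
Proof.
move=> xk; rewrite (le_trans (enorm_le_sum x))//.
have : \sum_i `|x ord0 i| <= \sum_(i < n) k by apply: ler_sum => i _; exact: xk.
by rewrite sumr_const card_ord mulr_natl.
Qed.

Lemma enorm_e1 : (0 < n)%N -> enorm (e1 : 'rV[R]_n) = 1.
Proof.
move=> n_gt0; rewrite /enorm /dotv (bigD1 (Ordinal n_gt0))//= !mxE/= mulr1.
rewrite big1 ?addr0 ?sqrtr1// => i i0; rewrite !mxE (_ : (i == 0 :> nat) = false) ?mulr0//.
by apply: contraNF i0 => /eqP i0; apply/eqP/val_inj.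
Qed.

(** For [a = 0] the coefficient is [2 * (0 / 0) = 0] and [refl 0] is the
    identity, which is an isometric involution too. *)
Definition refl a x : 'rV[R]_n := x - (2 * (dotv x a / dotv a a)) *: a.

Lemma refl0v x : refl 0 x = x.
Proof. by rewrite /refl scaler0 subr0. Qed.

Lemma reflD a x y : refl a (x + y) = refl a x + refl a y.
Proof. by rewrite /refl dotvDl (mulrDl (dotv x a)) mulrDr scalerDl addrACA opprD. Qed.

Lemma reflZ a k x : refl a (k *: x) = k *: refl a x.
Proof. by rewrite /refl dotvZl scalerBr scalerA; congr (_ - _ *: _); ring. Qed.

Lemma reflN a x : refl a (- x) = - refl a x.
Proof. by rewrite -scaleN1r reflZ scaleN1r. Qed.

Lemma reflB a x y : refl a (x - y) = refl a x - refl a y.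
Proof. by rewrite reflD reflN. Qed.

Lemma refl_opp a : refl (- a) = refl a.
Proof. by apply/funext => x; rewrite /refl !dotvE opprK mulNr mulrN scaleNr scalerN opprK. Qed.

Lemma dotv_refl_normal a x : dotv (refl a x) a = - dotv x a.
Proof.
have [->|a0] := eqVneq a 0; first by rewrite !dotv0 oppr0.
rewrite /refl !dotvE -mulrA divfK; first by ring.
by rewrite dotvv_eq0.
Qed.

Lemma dotv_refl a x y : dotv (refl a x) (refl a y) = dotv x y.
Proof.
have [->|a0] := eqVneq a 0; first by rewrite !refl0v.
have aa : dotv a a != 0 by rewrite dotvv_eq0.
rewrite [X in dotv _ X]/refl dotvDr dotvNr dotvZr dotv_refl_normal /refl !dotvE.
by rewrite (dotvC a y); field.
Qed.

Lemma enorm_refl a x : enorm (refl a x) = enorm x.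
Proof. by rewrite /enorm dotv_refl. Qed.

Lemma reflK a : involutive (refl a).
Proof.
move=> x; rewrite [LHS]/refl dotv_refl_normal [in LHS]/refl mulNr mulrN scaleNr.
by rewrite opprK subrK.
Qed.

Lemma enorm_reflB a x y : enorm (refl a x - y) = enorm (x - refl a y).
Proof. by rewrite -(enorm_refl a) reflB reflK. Qed.

Lemma refl_fix a x : dotv x a = 0 -> refl a x = x.
Proof. by move=> xa; rewrite /refl xa mul0r mulr0 scale0r subr0. Qed.

(** Any two points of a sphere are mirror images of each other. *)
Lemma refl_swap x y : enorm x = enorm y -> refl (x - y) x = y.
Proof.
move=> xy; have [->|] := eqVneq x y; first by rewrite subrr refl0v.
rewrite -subr_eq0 -dotvv_eq0 /refl => d0.
suff -> : 2 * (dotv x (x - y) / dotv (x - y) (x - y)) = 1.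
  by rewrite scale1r subKr.
move: d0; rewrite !dotvE (dotvC y x) -!sqr_enorm xy => d0; field.
by apply: contraNneq d0 => d0; apply/eqP; lra.
Qed.

(** Two points on the same side of the mirror are closer to each other than one of them is to the
    image of the other; every comparison below rests on this sign. *)
Lemma enorm_reflB_diff a x y : dotv a a != 0 ->
  enorm (x - refl a y) ^+ 2 - enorm (x - y) ^+ 2 =
  4 * (dotv x a * dotv y a) / dotv a a.
Proof.
move=> a0; rewrite !sqr_enorm.
rewrite [X in X - _](_ : _ = dotv x x + dotv y y - 2 * dotv x (refl a y)); last first.
  move: (dotv_refl a y y) (dotvC (refl a y) x); move: (refl a y) => z zz zx.
  by rewrite !dotvE zz zx; ring.
by rewrite /refl !dotvE (dotvC y x); field.
Qed.

End euclidean_geometry.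

(** * Translations and measurability *)

Section measure_preserving.
Context d (T : measurableType d) (R : realType) (mu : {measure set T -> \bar R}).

Lemma ge0_integral_preserving (phi : T -> T) (f : T -> \bar R) :
  measurable_fun setT phi ->
  (forall A, measurable A -> mu (phi @^-1` A) = mu A) ->
  measurable_fun setT f -> (forall x, (0 <= f x)%E) ->
  (\int[mu]_x f (phi x) = \int[mu]_x f x)%E.
Proof.
move=> mphi muphi mf f0.
transitivity (\int[pushforward mu phi]_y f y)%E.
  by rewrite ge0_integral_pushforward// preimage_setT.
by apply: eq_measure_integral => //= A mA _; exact: muphi.
Qed.

Lemma ae_preserving (phi : T -> T) (P : T -> Prop) :
  measurable_fun setT phi ->
  (forall A, measurable A -> mu (phi @^-1` A) = mu A) ->
  {ae mu, forall x, P x} -> {ae mu, forall x, P (phi x)}.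
Proof.
move=> mphi muphi [A [mA A0 PA]]; exists (phi @^-1` A); split.
- by rewrite -[X in measurable X]setTI; exact: mphi.
- by rewrite -(muphi _ mA) in A0.
- by move=> x /= Px; exact: PA.
Qed.

End measure_preserving.

Section lebesgue_rV_translation.
Context {R : realType}.

(** Translates of intervals are intervals of the same length, and these determine the measure. *)
Lemma lebesgue_measure_translation (c : R) (A : set R) : measurable A ->
  @lebesgue_measure R ((fun x : R => x + c) @^-1` A) = lebesgue_measure A.
Proof.
have mc : measurable_fun setT (fun x : measurableTypeR R => x + c : measurableTypeR R).
  exact: measurable_funD.
move=> mA; apply/esym.
pose push : {measure set (measurableTypeR R) -> \bar R} :=
  measure_function_pushforward__canonical__measure_function_Measure
    (@lebesgue_measure R) mc.
rewrite -[RHS]/(push A); apply: lebesgue_measure_unique => //= _ [[a b]] _ <-.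
rewrite /pushforward.
rewrite (_ : _ @^-1` _ = `]a - c, b - c]%classic); last first.
  by apply/seteqP; split => x /=; rewrite !in_itv/= ltrBlDr lerBrDr.
by rewrite !lebesgue_measure_itv/= !lte_fin ltrD2r; case: ifPn => // _; rewrite -!EFinB; congr EFin; ring.
Qed.

Lemma lebesgue_rVSE n (A : set 'rV[R]_n.+1) : lebesgue_rV n.+1 A =
  (\int[lebesgue_measure]_x lebesgue_rV n [set v | A (cons_rV (x, v))])%E.
Proof.
by apply: eq_integral => x _ /=; rewrite xsectionE.
Qed.

Lemma measurable_preimage_cons n (A : set 'rV[R]_n.+1) : measurable A ->
  measurable ((@cons_rV R n) @^-1` A).
Proof.
by move=> mA; rewrite -[X in measurable X]setTI; exact: measurable_cons_rV.
Qed.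

Lemma measurable_cons_section n (A : set 'rV[R]_n.+1) (x : R) : measurable A ->
  measurable [set v | A (cons_rV (x, v))].
Proof.
move=> /measurable_preimage_cons mA.
have := measurable_xsection x mA; rewrite xsectionE; exact.
Qed.

Lemma measurable_lebesgue_rV_section n (A : set 'rV[R]_n.+1) : measurable A ->
  measurable_fun setT (fun x : R => lebesgue_rV n [set v | A (cons_rV (x, v))]).
Proof.
move=> mA.
have := measurable_fun_xsection (lebesgue_rV n) (measurable_preimage_cons mA).
by congr (measurable_fun _ _); apply/funext => x /=; rewrite xsectionE.
Qed.

Lemma cons_rVD n (x y : R) (v w : 'rV[R]_n) :
  cons_rV (x, v) + cons_rV (y, w) = cons_rV (x + y, v + w).
Proof. by apply/rowP => i; rewrite !mxE; case: unlift => [j|] /=; rewrite ?mxE. Qed.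

Lemma uncons_rVK n : cancel (@uncons_rV R n) (@cons_rV R n).
Proof.
move=> x; apply/rowP => i; rewrite mxE.
by case: unliftP => [j ->|->] /=; rewrite ?mxE.
Qed.

(** Induction on the dimension, slicing by the first coordinate. *)
Lemma lebesgue_rV_translation n (c : 'rV[R]_n) (A : set 'rV[R]_n) : measurable A ->
  lebesgue_rV n ((fun x => x + c) @^-1` A) = lebesgue_rV n A.
Proof.
elim: n c A => [|n IHn] c A mA.
  rewrite (_ : _ @^-1` A = A)//.
  by apply/seteqP; split => x; rewrite /= (thinmx0 c) addr0.
have cE x v : cons_rV (x, v) + c =
    cons_rV (x + (uncons_rV c).1, v + (uncons_rV c).2).
  by rewrite -{1}(uncons_rVK c); exact: cons_rVD.
rewrite !lebesgue_rVSE.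
set phi := fun x : R => lebesgue_rV n [set v | A (cons_rV (x, v))].
rewrite -[RHS](@ge0_integral_preserving _ _ _ _ (fun x : measurableTypeR R => x + (uncons_rV c).1 : measurableTypeR R))//=.
- apply: eq_integral => x _; rewrite /phi.
  rewrite -[RHS](IHn (uncons_rV c).2); last exact: measurable_cons_section.
  by congr (lebesgue_rV n _); apply/seteqP; split => v /=; rewrite cE.
- exact: measurable_funD.
- by move=> B mB; exact: lebesgue_measure_translation.
- exact: measurable_lebesgue_rV_section.
Qed.

End lebesgue_rV_translation.

Section measurability.
Context {R : realType} {n : nat}.
Local Notation mu := (@lebesgue_rV R n).

Lemma measurable_fun_rVD d (T : measurableType d) (f g : T -> 'rV[R]_n) :
  measurable_fun setT f -> measurable_fun setT g ->
  measurable_fun setT (fun x => f x + g x).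
Proof.
move=> mf mg; apply: measurable_fun_coord => i; under eq_fun do rewrite mxE.
by apply: measurable_funD; exact: (measurableT_comp (measurable_coord i)).
Qed.

Lemma measurable_fun_rVZ d (T : measurableType d) (k : T -> R) (g : T -> 'rV[R]_n) :
  measurable_fun setT k -> measurable_fun setT g ->
  measurable_fun setT (fun x => k x *: g x).
Proof.
move=> mf mg; apply: measurable_fun_coord => i; under eq_fun do rewrite mxE.
by apply: measurable_funM => //; exact: (measurableT_comp (measurable_coord i)).
Qed.

Lemma measurable_fun_rVN d (T : measurableType d) (g : T -> 'rV[R]_n) :
  measurable_fun setT g -> measurable_fun setT (fun x => - g x).
Proof.
move=> mg; apply: measurable_fun_coord => i; under eq_fun do rewrite mxE.
by apply: measurableT_comp => //; exact: (measurableT_comp (measurable_coord i)).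
Qed.

Lemma measurable_fun_dotv d (T : measurableType d) (f g : T -> 'rV[R]_n) :
  measurable_fun setT f -> measurable_fun setT g ->
  measurable_fun setT (fun x => dotv (f x) (g x)).
Proof.
move=> mf mg; apply: measurable_sum => i.
by apply: measurable_funM; exact: (measurableT_comp (measurable_coord i)).
Qed.

Lemma measurable_fun_enorm d (T : measurableType d) (f : T -> 'rV[R]_n) :
  measurable_fun setT f -> measurable_fun setT (fun x => enorm (f x)).
Proof.
move=> mf; apply: (@measurableT_comp _ _ _ _ _ _ (@Num.sqrt R)).
  by apply: nondecreasing_measurable => // x y xy; exact: ler_wsqrtr.
exact: measurable_fun_dotv.
Qed.

Lemma measurable_refl (a : 'rV[R]_n) : measurable_fun setT (refl a).
Proof.
apply: measurable_fun_rVD => //; apply: measurable_fun_rVN; apply: measurable_fun_rVZ => //.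
by apply: measurable_funM => //; apply: measurable_funM => //; apply: measurable_fun_dotv.
Qed.

Lemma measurable_translation (c : 'rV[R]_n) : measurable_fun setT (fun x : 'rV[R]_n => x + c).
Proof. exact: measurable_fun_rVD. Qed.

Lemma measurable_eball c r : measurable (eball c r : set 'rV[R]_n).
Proof.
rewrite (_ : eball c r = (fun x : 'rV[R]_n => enorm (x - c)) @^-1` `]-oo, r[); last first.
  by apply/seteqP; split => x /=; rewrite in_itv.
rewrite -[X in measurable X]setTI; apply: measurable_fun_enorm => //.
exact: measurable_translation.
Qed.

Lemma measurable_closed_eball c r : measurable (closed_eball c r : set 'rV[R]_n).
Proof.
rewrite (_ : closed_eball c r = (fun x : 'rV[R]_n => enorm (x - c)) @^-1` `]-oo, r]); last first.
  by apply/seteqP; split => x /=; rewrite in_itv.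
rewrite -[X in measurable X]setTI; apply: measurable_fun_enorm => //.
exact: measurable_translation.
Qed.

Lemma measurable_hyperplane (b : 'rV[R]_n) : measurable [set x : 'rV[R]_n | dotv x b = 0].
Proof.
rewrite [X in measurable X](_ : _ = (fun x => dotv x b) @^-1` [set 0])//.
by rewrite -[X in measurable X]setTI; apply: measurable_fun_dotv.
Qed.

Lemma measurable_perforated_ball Rad r t :
  measurable (perforated_ball Rad r t : set 'rV[R]_n).
Proof. by apply: measurableD; [exact: measurable_eball|exact: measurable_closed_eball]. Qed.

(** [x^-1] is [x] times a real power of the nonnegative number [x ^ 2]. *)
Lemma measurable_funV d (T : measurableType d) (f : T -> R) :
  measurable_fun setT f -> measurable_fun setT (fun x => (f x)^-1).
Proof.
move=> mf; rewrite (_ : (fun _ => _) = (fun x => f x * (f x ^+ 2) `^ (-1))).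
  apply: measurable_funM => //.
  apply: (@measurableT_comp _ _ _ _ _ _ (fun y => y `^ (-1))) => //.
  exact: measurable_funX.
apply/funext => x; rewrite powR_inv1 ?sqr_ge0//.
have [->|fx0] := eqVneq (f x) 0; first by rewrite invr0 mul0r.
by rewrite expr2 invfM mulrA divff// mul1r.
Qed.

End measurability.

(** * Invariance of Lebesgue measure under reflections *)

Section cubes.
Context {R : realType}.

Lemma lebesgue_rV_cube n (rho : R) : 0 <= rho ->
  lebesgue_rV n [set x | forall i, `|x ord0 i| < rho] = ((2 * rho) ^+ n)%:E.
Proof.
move=> rho0; elim: n => [|n IHn].
  rewrite /= diracE mem_set ?expr0//= => -[]; by [].
rewrite lebesgue_rVSE.
transitivity (\int[lebesgue_measure]_(x in [set: R])
    (((2 * rho) ^+ n)%:E * (\1_(`]-rho, rho[%classic) x)%:E))%E.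
  apply: eq_integral => x _; rewrite indicE.
  have -> : (x \in `]-rho, rho[%classic) = (`|x| < rho).
    by apply/idP/idP; rewrite inE /= in_itv/= ltr_norml.
  have [xr|xr] := boolP (`|x| < rho).
    rewrite mule1 -IHn; congr (lebesgue_rV n _); apply/seteqP; split => v /=.
      by move=> h i; have := h (lift ord0 i); rewrite mxE liftK.
    by move=> h i; rewrite mxE; case: unliftP => [j _|_]//=.
  rewrite mule0 [X in lebesgue_rV n X](_ : _ = set0) ?measure0//.
  apply/seteqP; split => v //= /(_ ord0); rewrite mxE unlift_none/=.
  exact/negP.
rewrite ge0_integralZl//; last by rewrite lee_fin exprn_ge0// mulr_ge0.
  rewrite integral_indic//= setIT lebesgue_measure_itv/= lte_fin.
  have [r0|] := ltP (- rho) rho.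
    by rewrite -EFinD -EFinM exprSr opprK mulr2n mulrDl mul1r.
  move=> r0; have -> : rho = 0 by lra.
  by rewrite mulr0 mule0 expr0n.
by apply/measurable_EFinP; exact: measurable_indic.
Qed.

End cubes.

Section reflection_invariance.
Context {R : realType} {n : nat}.
Local Notation mu := (@lebesgue_rV R n).
Implicit Types (a x y c : 'rV[R]_n) (A B : set 'rV[R]_n).

Lemma measurable_cube rho : measurable [set x : 'rV[R]_n | forall i, `|x ord0 i| < rho].
Proof.
rewrite (_ : mkset _ = \big[setI/setT]_(i < n) ((fun x : 'rV[R]_n => `|x ord0 i|) @^-1` `]-oo, rho[)); last first.
  rewrite -bigcap_seq; apply/seteqP; split => x /=.
    by move=> h i _ /=; rewrite in_itv/=.
  by move=> h i; have := h i (mem_index_enum i); rewrite /= in_itv.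
apply: bigsetI_measurable => i _; rewrite -[X in measurable X]setTI.
have mi : measurable_fun setT (fun x : 'rV[R]_n => `|x ord0 i|).
  by apply: measurableT_comp => //; exact: measurable_coord.
exact: mi.
Qed.

Lemma lebesgue_rV_eball_le c r : 0 <= r -> (mu (eball c r) <= ((2 * r) ^+ n)%:E)%E.
Proof.
move=> r0; rewrite -(lebesgue_rV_translation c (measurable_eball c r)).
rewrite -lebesgue_rV_cube// le_measure ?inE//.
- rewrite -[X in measurable X]setTI.
  by apply: measurable_translation => //; exact: measurable_eball.
- exact: measurable_cube.
- by move=> x /= h i; rewrite (le_lt_trans (coord_le_enorm _ _))// -(addrK c x).
Qed.

Lemma lebesgue_rV_eball_fin c r : (mu (eball c r) < +oo)%E.
Proof.
have [r0|r0] := leP 0 r; first by rewrite (le_lt_trans (lebesgue_rV_eball_le c r0))// ltry.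
rewrite (_ : eball c r = set0) ?measure0//; apply/seteqP; split => x //=.
by move=> /(le_lt_trans (enorm_ge0 _)) /(lt_trans r0); rewrite ltxx.
Qed.

Lemma lebesgue_rV_eball_gt0 c r : 0 < r -> (0 < mu (eball c r))%E.
Proof.
move=> r0; rewrite -(lebesgue_rV_translation c (measurable_eball c r)).
have r1 : 0 < r / n.+1%:R by rewrite divr_gt0.
apply: (@lt_le_trans _ _ ((2 * (r / n.+1%:R)) ^+ n)%:E).
  by rewrite lte_fin exprn_gt0// mulr_gt0.
rewrite -lebesgue_rV_cube ?(ltW r1)// le_measure ?inE//.
- exact: measurable_cube.
- rewrite -[X in measurable X]setTI.
  by apply: measurable_translation => //; exact: measurable_eball.
- move=> x /= h; rewrite /eball /= addrK.
  apply: (@le_lt_trans _ _ (n%:R * (r / n.+1%:R))).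
    by apply: enorm_le_cube => i; exact: ltW.
  by rewrite mulrCA -[ltRHS]mulr1 ltr_pM2l// ltr_pdivrMr// mul1r ltr_nat.
Qed.

Lemma integral_swap (f : 'rV[R]_n -> 'rV[R]_n -> \bar R) :
  measurable_fun setT (fun z : 'rV[R]_n * 'rV[R]_n => f z.1 z.2) ->
  (forall x y, (0 <= f x y)%E) ->
  (\int[mu]_x \int[mu]_y f x y = \int[mu]_y \int[mu]_x f x y)%E.
Proof.
move=> mf f0.
exact: (@fubini_tonelli _ _ _ _ _ mu mu (fun z => f z.1 z.2) mf (fun z => f0 z.1 z.2)).
Qed.

Lemma measurable_integral2 (f : 'rV[R]_n -> 'rV[R]_n -> \bar R) :
  measurable_fun setT (fun z : 'rV[R]_n * 'rV[R]_n => f z.1 z.2) ->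
  (forall x y, (0 <= f x y)%E) ->
  measurable_fun setT (fun x => \int[mu]_y f x y)%E.
Proof.
move=> mf f0.
exact: (@measurable_fun_fubini_tonelli_F _ _ _ _ _ mu (fun z => f z.1 z.2) mf (fun z => f0 z.1 z.2)).
Qed.

Lemma integral_translation c (f : 'rV[R]_n -> \bar R) :
  measurable_fun setT f -> (forall x, (0 <= f x)%E) ->
  (\int[mu]_x f (x + c)%R = \int[mu]_x f x)%E.
Proof.
move=> mf f0; apply: (ge0_integral_preserving (phi := fun x => x + c)) => //.
- exact: measurable_translation.
- by move=> A; exact: lebesgue_rV_translation.
Qed.

Lemma integral_indic_comp (f : 'rV[R]_n -> 'rV[R]_n) B :
  measurable_fun setT f -> measurable B ->
  (\int[mu]_x (\1_B (f x))%:E = mu (f @^-1` B))%E.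
Proof.
move=> mf mB; rewrite -[X in mu X]setIT -integral_indic//.
by rewrite -[X in measurable X]setTI; exact: mf.
Qed.

(** A measure-theoretic form of the uniqueness of Haar measure: integrating
    [1_A(x) 1_B(refl a y + x)] in both orders, with [A] the unit ball, which
    the reflection preserves, gives
    [mu A * mu (refl a @^-1` B) = mu A * mu B]. *)
Lemma lebesgue_rV_refl a B : measurable B -> mu (refl a @^-1` B) = mu B.
Proof.
move=> mB; pose A : set 'rV[R]_n := eball 0 1.
have mA : measurable A by exact: measurable_eball.
have A0 : (0 < mu A)%E by exact: lebesgue_rV_eball_gt0.
have Aoo : (mu A < +oo)%E by exact: lebesgue_rV_eball_fin.
have mrB : measurable (refl a @^-1` B).
  by rewrite -[X in measurable X]setTI; exact: measurable_refl.
have AE x y : \1_A (x - refl a y) = \1_A (y - refl a x) :> R.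
  rewrite !indicE; congr ((nat_of_bool _)%:R).
  by apply/idP/idP; rewrite !inE /A /eball/= !subr0 enormBC enorm_reflB.
have mA1 : measurable_fun setT (\1_A : 'rV[R]_n -> R) by exact: measurable_indic.
have mB1 : measurable_fun setT (\1_B : 'rV[R]_n -> R) by exact: measurable_indic.
have mz : measurable_fun setT (fun z : 'rV[R]_n * 'rV[R]_n => z.1 - refl a z.2).
  apply: measurable_fun_rVD => //; apply: measurable_fun_rVN.
  exact: (measurableT_comp (measurable_refl a)).
have mz' : measurable_fun setT (fun z : 'rV[R]_n * 'rV[R]_n => refl a z.2 + z.1).
  apply: measurable_fun_rVD => //.
  exact: (measurableT_comp (measurable_refl a)).
suff : (mu A * mu (refl a @^-1` B) = mu A * mu B)%E.
  have /fineK <- : mu A \is a fin_num by rewrite ge0_fin_numE.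
  move=> /(congr1 (fun z => ((fine (mu A))^-1)%:E * z)%E).
  rewrite !muleA -EFinM mulVf ?mul1e//.
  by rewrite gt_eqF// fine_gt0// A0 Aoo.
transitivity (\int[mu]_x \int[mu]_y (\1_A x * \1_B (refl a y + x))%:E)%E.
  transitivity (\int[mu]_x ((\1_A x)%:E * mu (refl a @^-1` B)))%E.
    rewrite ge0_integralZr//; first by rewrite integral_indic// setIT.
    exact/measurable_EFinP.
  apply: eq_integral => x _.
  under [RHS]eq_integral do rewrite EFinM.
  rewrite ge0_integralZl//; last first.
    apply/measurable_EFinP; apply: (measurableT_comp mB1).
    by apply: measurable_fun_rVD => //; exact: measurable_refl.
  congr (_ * _)%E; rewrite integral_indic_comp//; last first.
    by apply: measurable_fun_rVD => //; exact: measurable_refl.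
  rewrite -(lebesgue_rV_translation (refl a x) mrB).
  by congr (mu _); apply/seteqP; split => y /=; rewrite reflD reflK.
rewrite integral_swap; last 2 first.
- apply/measurable_EFinP; apply: measurable_funM.
    by apply: (measurableT_comp mA1).
  exact: (measurableT_comp mB1).
- by move=> x y; rewrite lee_fin mulr_ge0.
transitivity (\int[mu]_y \int[mu]_x (\1_A (x - refl a y)%R * \1_B x)%:E)%E.
  apply: eq_integral => y _.
  rewrite -[LHS](integral_translation (- refl a y)).
  - by apply: eq_integral => x _; rewrite addrCA subrr addr0.
  - apply/measurable_EFinP; apply: measurable_funM => //.
    by apply: (measurableT_comp mB1); exact: measurable_fun_rVD.
  - by move=> x; rewrite lee_fin mulr_ge0.
rewrite integral_swap; last 2 first.
- apply/measurable_EFinP; apply: measurable_funM.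
    apply: (measurableT_comp mA1); apply: measurable_fun_rVD => //.
    by apply: measurable_fun_rVN; exact: (measurableT_comp (measurable_refl a)).
  exact: (measurableT_comp mB1).
- by move=> x y; rewrite lee_fin mulr_ge0.
transitivity (\int[mu]_x (mu A * (\1_B x)%:E))%E; last first.
  rewrite ge0_integralZl//; first by rewrite integral_indic// setIT.
  exact/measurable_EFinP.
apply: eq_integral => x _.
under eq_integral do rewrite EFinM AE.
rewrite ge0_integralZr//; last first.
  by apply/measurable_EFinP; apply: (measurableT_comp mA1); exact: measurable_translation.
congr (_ * _)%E; rewrite integral_indic_comp//; last exact: measurable_translation.
exact: lebesgue_rV_translation.
Qed.

Lemma integral_refl a (f : 'rV[R]_n -> \bar R) :
  measurable_fun setT f -> (forall x, (0 <= f x)%E) ->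
  (\int[mu]_x f (refl a x) = \int[mu]_x f x)%E.
Proof.
move=> mf f0; apply: ge0_integral_preserving => //.
- exact: measurable_refl.
- by move=> A; exact: lebesgue_rV_refl.
Qed.

Lemma integral_double_refl a (f : 'rV[R]_n -> \bar R) :
  (forall x, (0 <= f x)%E) -> measurable_fun setT f ->
  (\int[mu]_x (f x + f (refl a x)) = \int[mu]_x f x + \int[mu]_x f x)%E.
Proof.
move=> f0 mf; rewrite ge0_integralD//.
  by congr (_ + _)%E; exact: integral_refl.
exact: (measurableT_comp mf (measurable_refl a)).
Qed.

Lemma ae_refl a (P : 'rV[R]_n -> Prop) :
  {ae mu, forall x, P x} -> {ae mu, forall x, P (refl a x)}.
Proof.
apply: ae_preserving; first exact: measurable_refl.
by move=> A; exact: lebesgue_rV_refl.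
Qed.

End reflection_invariance.

Section hyperplanes.
Context {R : realType}.

(** The reflection exchanging [a] and a multiple of the first basis vector
    sends the hyperplane orthogonal to [a] to a coordinate hyperplane. *)
Lemma lebesgue_rV_hyperplane n (a : 'rV[R]_n) : a != 0 ->
  lebesgue_rV n [set x | dotv x a = 0] = 0.
Proof.
case: n a => [|n] a a0; first by rewrite (thinmx0 a) eqxx in a0.
have ean : enorm (enorm a *: @e1 R n.+1) = enorm a.
  by rewrite enormZ ger0_norm ?enorm_ge0// enorm_e1// mulr1.
rewrite -(lebesgue_rV_refl (a - enorm a *: e1) (measurable_hyperplane a)).
rewrite [X in lebesgue_rV _ X](_ : _ = [set x : 'rV[R]_n.+1 | x ord0 ord0 = 0]); last first.
  apply/seteqP; split => x /=.
    rewrite -(dotv_refl (a - enorm a *: e1)) reflK refl_swap// dotvZr.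
    move/eqP; rewrite mulf_eq0 enorm_eq0 (negbTE a0)/=.
    by rewrite /dotv big_ord_recl !mxE/= big1 ?addr0 ?mulr1// => [/eqP//|i _]; rewrite !mxE/= mulr0.
  move=> x0; rewrite -(dotv_refl (a - enorm a *: e1)) reflK refl_swap// dotvZr.
  rewrite /dotv big_ord_recl !mxE/= x0 mul0r add0r big1 ?mulr0// => i _.
  by rewrite !mxE/= mulr0.
rewrite lebesgue_rVSE.
pose phi (x : R) := lebesgue_rV n [set v : 'rV[R]_n | cons_rV (x, v) ord0 ord0 = 0].
transitivity (\int[lebesgue_measure]_(x in [set: R]) (phi \_ [set 0%R]) x)%E.
  apply: eq_integral => x _; rewrite patchE; case: ifPn => // x0.
  rewrite [X in lebesgue_rV n X](_ : _ = set0) ?measure0//.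
  apply/seteqP; split => v //=; rewrite mxE unlift_none/= => xx.
  by move: x0 => /negP; apply; exact/mem_set.
by rewrite -integral_mkcond integral_set1.
Qed.

Lemma ae_hyperplane n (a : 'rV[R]_n) : a != 0 ->
  {ae (@lebesgue_rV R n), forall x, dotv x a != 0}.
Proof.
move=> a0; exists [set x | dotv x a = 0]; split.
- exact: measurable_hyperplane.
- exact: lebesgue_rV_hyperplane.
- by move=> x /= /negP; rewrite negbK => /eqP.
Qed.

End hyperplanes.

(** * Integrability of the singular kernel *)

Section integral_toolbox.
Context d (T : measurableType d) (R : realType) (mu : {measure set T -> \bar R}).

Lemma ge0_integral_eq0 (f : T -> \bar R) :
  measurable_fun setT f -> (forall x, (0 <= f x)%E) ->
  (\int[mu]_x f x = 0)%E -> {ae mu, forall x, f x = 0%E}.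
Proof.
move=> mf f0 If.
have /(ae_eq_integral_abs mu measurableT mf) : (\int[mu]_x `|f x| = 0)%E.
  by rewrite -[RHS]If; apply: eq_integral => x _; rewrite gee0_abs.
by apply: filterS => x /(_ I).
Qed.

Lemma ge0_le_integralT (f g : T -> \bar R) :
  measurable_fun setT f -> measurable_fun setT g -> (forall x, (0 <= f x)%E) ->
  (forall x, (f x <= g x)%E) -> (\int[mu]_x f x <= \int[mu]_x g x)%E.
Proof.
by move=> mf mg f0 fg; apply: ge0_le_integral.
Qed.

Lemma nneseries_geometric_le (C q : R) : 0 <= C -> 0 <= q < 1 ->
  (\sum_(0 <= k <oo) (C * q ^+ k)%:E <= (C / (1 - q))%:E)%E.
Proof.
move=> C0 /andP[q0 q1]; apply: lime_le.
  by apply: is_cvg_nneseries => k _ _; rewrite lee_fin mulr_ge0// exprn_ge0.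
apply: nearW => m /=; rewrite sumEFin lee_fin -mulr_sumr ler_wpM2l//.
rewrite -[leRHS]mul1r ler_pdivlMr ?subr_gt0//.
suff -> : (\sum_(0 <= i < m) q ^+ i) * (1 - q) = 1 - q ^+ m.
  by rewrite gerBl exprn_ge0.
elim: m => [|m IH]; first by rewrite big_nil mul0r expr0 subrr.
by rewrite big_nat_recr//= mulrDl IH exprS; ring.
Qed.

Lemma nneseries_ge_term (u : nat -> \bar R) k : (forall i, (0 <= u i)%E) ->
  (u k <= \sum_(0 <= i <oo) u i)%E.
Proof.
move=> u0; apply: (le_trans _ (nneseries_lim_ge k.+1 _)) => //.
by rewrite big_nat_recr//= leeDr// sume_ge0.
Qed.

End integral_toolbox.

Section singular_kernel.
Context {R : realType} {n : nat}.
Local Notation mu := (@lebesgue_rV R n).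
Implicit Types (s : R).

(** Dyadic decomposition: bounds on countably many balls give integrability when bound times
    volume decays geometrically. *)
Lemma integral_dyadic_fin (f : 'rV[R]_n -> R) (c rho : nat -> R) (C q : R) :
  measurable_fun setT f -> (forall z, 0 <= f z) ->
  (forall k, 0 <= c k) -> (forall k, 0 <= rho k) ->
  (forall z, exists k, f z <= c k * \1_(eball 0 (rho k)) z) ->
  0 <= q < 1 -> (forall k, c k * (2 * rho k) ^+ n <= C * q ^+ k) ->
  (\int[mu]_z (f z)%:E < +oo)%E.
Proof.
move=> mf f0 c0 rho0 fc q01 cC.
have C0 : 0 <= C.
  have := cC 0%N; rewrite expr0 mulr1; apply: le_trans.
  by rewrite mulr_ge0// exprn_ge0// mulr_ge0.
have mind k : measurable_fun setT (fun z : 'rV[R]_n => (c k * \1_(eball 0 (rho k)) z)%:E).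
  apply/measurable_EFinP; apply: measurable_funM => //.
  by apply: measurable_indic; exact: measurable_eball.
have ind0 k z : (0 <= (c k * \1_(eball 0 (rho k) : set 'rV[R]_n) z)%:E)%E.
  by rewrite lee_fin mulr_ge0.
apply: (@le_lt_trans _ _ (\int[mu]_z \sum_(0 <= k <oo) (c k * \1_(eball 0 (rho k)) z)%:E)%E).
  apply: ge0_le_integralT => //.
  - exact/measurable_EFinP.
  - by apply: ge0_emeasurable_sum => // k z _ _; exact: ind0.
  - move=> z; have [k fk] := fc z.
    apply: (@le_trans _ _ (c k * \1_(eball 0 (rho k)) z)%:E); first by rewrite lee_fin.
    exact: (nneseries_ge_term k (fun i => ind0 i z)).
rewrite integral_nneseries//.
apply: (@le_lt_trans _ _ (\sum_(0 <= k <oo) (C * q ^+ k)%:E)%E); last first.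
  by apply: le_lt_trans (nneseries_geometric_le C0 q01) _; rewrite ltry.
apply: lee_nneseries => [k _ _|k _]; first exact: integral_ge0.
under eq_integral do rewrite EFinM.
rewrite ge0_integralZl//; last 2 first.
- by apply/measurable_EFinP; apply: measurable_indic; exact: measurable_eball.
- by rewrite lee_fin.
rewrite integral_indic ?setIT//; last exact: measurable_eball.
apply: (@le_trans _ _ ((c k)%:E * ((2 * rho k) ^+ n)%:E)%E).
  by apply: lee_wpmul2l; [rewrite lee_fin|exact: lebesgue_rV_eball_le].
by rewrite -EFinM lee_fin.
Qed.

End singular_kernel.

Section dyadic_powers.
Context {R : realType}.

Lemma exists_pow2_bracket (x : R) : 1 <= x ->
  exists k : nat, 2 `^ k%:R <= x < 2 `^ (k%:R + 1).
Proof.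
move=> x1.
have ex : exists k : nat, x < 2 `^ (k%:R + 1).
  exists (Num.bound x); apply: (lt_le_trans (archi_boundP (le_trans ler01 x1))).
  rewrite natr1 powR_mulrn// -natrX ler_nat.
  by rewrite (leq_trans (ltnW (ltn_expl _ (ltnSn 1))))// leq_exp2l.
case: (ex_minnP ex) => -[|k] xk kmin; first by exists 0%N; rewrite powRr0 x1.
exists k.+1; rewrite xk andbT leNgt; apply/negP; rewrite -(natr1 k) => /kmin.
by rewrite ltnn.
Qed.

Lemma pow2D (x y : R) : 2 `^ (x + y) = 2 `^ x * 2 `^ y.
Proof. by rewrite powRD// pnatr_eq0 implybT. Qed.

Lemma pow2X (x : R) k : (2 `^ x) ^+ k = 2 `^ (x * k%:R).
Proof. by rewrite powRrM powR_mulrn// powR_ge0. Qed.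

Lemma pow2_lt1 (x : R) : x < 0 -> 0 <= (2 : R) `^ x < 1.
Proof.
move=> x0; rewrite powR_ge0/= /powR pnatr_eq0/= -[ltRHS]expR0.
by rewrite ltr_expR pmulr_llt0// ln_gt0// ltr1n.
Qed.

Lemma powR_inv (x p : R) : 0 <= x -> (x `^ p)^-1 = x^-1 `^ p.
Proof. by move=> x0; rewrite -[in RHS]powR_inv1// -powRN -powRrM mulN1r. Qed.

End dyadic_powers.

Section singular_kernel_bounds.
Context {R : realType} {n : nat}.
Local Notation mu := (@lebesgue_rV R n).
Implicit Types (s : R).

Lemma measurable_kernel d (T : measurableType d) (f : T -> 'rV[R]_n) p :
  measurable_fun setT f -> measurable_fun setT (fun x => (enorm (f x) `^ p)^-1).
Proof.
move=> mf; apply: measurable_funV.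
apply: (@measurableT_comp _ _ _ _ _ _ (@powR R ^~ p)) => //.
exact: measurable_fun_enorm.
Qed.

Lemma singular_kernel_near0 s : 0 < s < 1 ->
  (\int[mu]_z (\1_(eball 0 1) z * (enorm z ^+ 2 / enorm z `^ (n%:R + 2 * s)))%:E < +oo)%E.
Proof.
move=> /andP[s0 s1]; set p := n%:R + 2 * s.
have p0 : 0 <= p by rewrite addr_ge0// mulr_ge0// ltW.
(* On the shell where [|z|] is between [2^-(k+1)] and [2^-k] the integrand is at most
   [2^(-2k + (k+1)p)]; the ball of radius [2^(1-k)] contains this shell. *)
apply: (@integral_dyadic_fin _ _ _ (fun k => 2 `^ (- k%:R * 2 + (k%:R + 1) * p))
  (fun k => 2 `^ (1 - k%:R)) (2 `^ (p + 2 * n%:R)) (2 `^ (2 * s - 2))) => //.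
- apply: measurable_funM.
    by apply: measurable_indic; exact: measurable_eball.
  apply: measurable_funM; first by apply: measurable_funX; apply: measurable_fun_enorm.
  exact: measurable_kernel.
- by move=> z; rewrite !mulr_ge0 ?invr_ge0 ?powR_ge0 ?exprn_ge0 ?enorm_ge0//.
- move=> z; have [->|z0] := eqVneq z 0.
    by exists 0%N; rewrite enorm0 expr0n mul0r mulr0 mulr_ge0// powR_ge0.
  have z0' : 0 < enorm z by rewrite enorm_gt0.
  have [z1|z1] := boolP (z \in eball 0 1); last first.
    by exists 0%N; rewrite indicE (negbTE z1) mul0r mulr_ge0// powR_ge0.
  have zlt1 : enorm z < 1 by move: z1; rewrite inE /eball/= subr0.
  have [k /andP[k1 k2]] : exists k : nat, 2 `^ k%:R <= (enorm z)^-1 < 2 `^ (k%:R + 1).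
    by apply: exists_pow2_bracket; rewrite invf_ge1// ltW.
  have zk : enorm z <= 2 `^ (- k%:R) by rewrite powRN -[leLHS]invrK lef_pV2// posrE ?invr_gt0 ?powR_gt0.
  exists k; rewrite !indicE z1 mul1r mem_set ?mulr1; last first.
    rewrite /eball/= subr0 (le_lt_trans zk)// addrC pow2D powRr1// ltr_pMr ?powR_gt0//.
    by rewrite ltr1n.
  rewrite pow2D ler_pM ?sqr_ge0 ?invr_ge0 ?powR_ge0//.
  + by rewrite -pow2X ler_pXn2r// nnegrE ?powR_ge0 ?enorm_ge0.
  + rewrite powRrM powR_inv ?enorm_ge0//.
    by apply: ge0_ler_powR; rewrite ?nnegrE ?invr_ge0 ?powR_ge0 ?(ltW k2)// ltW.
- by apply: pow2_lt1; lra.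
- move=> k; rewrite -[X in (X * _) ^+ n](@powRr1 R)// -pow2D !pow2X -!pow2D.
  suff -> : - k%:R * 2 + (k%:R + 1) * p + (1 + (1 - k%:R)) * n%:R =
    p + 2 * n%:R + (2 * s - 2) * k%:R by [].
  by rewrite /p; ring.
Qed.

Lemma singular_kernel_far s : 0 < s ->
  (\int[mu]_z (\1_(~` eball 0 1) z * (enorm z `^ (n%:R + 2 * s))^-1)%:E < +oo)%E.
Proof.
move=> s0; set p := n%:R + 2 * s.
have p0 : 0 <= p by rewrite addr_ge0// mulr_ge0// ltW.
(* Now the shells are those with [|z|] between [2^k] and [2^(k+1)]. *)
apply: (@integral_dyadic_fin _ _ _ (fun k => 2 `^ (- k%:R * p))
  (fun k => 2 `^ (k%:R + 1)) (2 `^ (2 * n%:R)) (2 `^ (- 2 * s))) => //.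
- apply: measurable_funM; last exact: measurable_kernel.
  by apply: measurable_indic; apply: measurableC; exact: measurable_eball.
- by move=> z; rewrite !mulr_ge0 ?invr_ge0 ?powR_ge0 ?exprn_ge0 ?enorm_ge0//.
- move=> z; have [z1|z1] := boolP (z \in ~` eball 0 1); last first.
    by exists 0%N; rewrite indicE (negbTE z1) mul0r mulr_ge0// powR_ge0.
  have zge1 : 1 <= enorm z.
    by move: z1; rewrite inE /eball/= subr0 => /negP; rewrite -leNgt.
  have [k /andP[k1 k2]] := exists_pow2_bracket zge1.
  exists k; rewrite !indicE z1 mul1r mem_set ?mulr1; last by rewrite /eball/= subr0.
  rewrite mulNr powRN powRrM lef_pV2 ?posrE ?powR_gt0 ?(lt_le_trans ltr01)//.
  by apply: ge0_ler_powR; rewrite ?nnegrE ?powR_ge0 ?enorm_ge0.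
  by rewrite ler1n.
- by apply: pow2_lt1; lra.
- move=> k; rewrite -[X in (X * _) ^+ n](@powRr1 R)// -pow2D !pow2X -!pow2D.
  suff -> : - k%:R * p + (1 + (k%:R + 1)) * n%:R = 2 * n%:R + - 2 * s * k%:R by [].
  by rewrite /p; ring.
Qed.

Lemma singular_kernel_fin s : 0 < s < 1 ->
  (\int[mu]_z (Num.min 1 (enorm z ^+ 2) / enorm z `^ (n%:R + 2 * s))%:E < +oo)%E.
Proof.
move=> s01; have /andP[s0 s1] := s01; set p := n%:R + 2 * s.
have mB : measurable (eball 0 1 : set 'rV[R]_n) by exact: measurable_eball.
pose f1 (z : 'rV[R]_n) := \1_(eball 0 1) z * (enorm z ^+ 2 / enorm z `^ p).
pose f2 (z : 'rV[R]_n) := \1_(~` eball 0 1) z * (enorm z `^ p)^-1.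
have mk : measurable_fun setT (fun z : 'rV[R]_n => (enorm z `^ p)^-1).
  exact: measurable_kernel.
have m1 : measurable_fun setT f1.
  apply: measurable_funM; first exact: measurable_indic.
  by apply: measurable_funM => //; apply: measurable_funX; apply: measurable_fun_enorm.
have m2 : measurable_fun setT f2.
  by apply: measurable_funM => //; apply: measurable_indic; exact: measurableC.
have f10 z : 0 <= f1 z by rewrite !mulr_ge0 ?invr_ge0 ?powR_ge0 ?exprn_ge0 ?enorm_ge0//.
have f20 z : 0 <= f2 z by rewrite !mulr_ge0 ?invr_ge0 ?powR_ge0 ?exprn_ge0 ?enorm_ge0//.
rewrite (eq_integral (fun z => (f1 z)%:E + (f2 z)%:E)%E); last first.
  move=> z _; rewrite -EFinD /f1 /f2 !indicE; congr EFin.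
  have [zB|zB] := boolP (z \in eball 0 1).
    rewrite (_ : (z \in ~` _) = false) ?mul0r ?addr0 ?mul1r; last first.
      by apply/negbTE; rewrite notin_setE/=; apply; exact/set_mem.
    congr (_ / _); apply/min_idPr; rewrite -[leRHS](expr1n _ 2) ler_pXn2r ?nnegrE ?enorm_ge0//.
    by move: zB; rewrite inE /eball/= subr0 => /ltW.
  rewrite (_ : (z \in ~` _) = true) ?mul0r ?add0r ?mul1r; last first.
    by apply/mem_set => /mem_set; exact/negP.
  rewrite -[RHS]mul1r; congr (_ / _); apply/min_idPl; rewrite -[leLHS](expr1n _ 2) ler_pXn2r ?nnegrE ?enorm_ge0//.
  by move: zB; rewrite notin_setE /eball/= subr0 => /negP; rewrite -leNgt.
rewrite ge0_integralD//; do ?[exact/measurable_EFinP | by move=> z _; rewrite lee_fin].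
by rewrite lte_add_pinfty//; [exact: singular_kernel_near0|exact: singular_kernel_far].
Qed.

(** By the half-angle formula [1 - cos x = 2 sin(x/2)^2], and [|sin y|] is at most both [1] and
    [|y|]. *)
Lemma one_sub_cos_le (x : R) : 0 <= 1 - cos x <= 2 * Num.min 1 (x ^+ 2).
Proof.
rewrite subr_ge0 cos_le1/=; apply: le_trans (_ : 2 * Num.min 1 ((x / 2) ^+ 2) <= _); last first.
  rewrite ler_wpM2l// le_min; apply/andP; split; first by rewrite ge_min lexx.
  rewrite ge_min; apply/orP; right; rewrite exprMn ler_piMr ?sqr_ge0//.
  by rewrite exprVn invf_le1 -?natrX ?ltr0n// ler1n.
have -> : 1 - cos x = 2 * sin (x / 2) ^+ 2.
  rewrite {1}(_ : x = x / 2 *+ 2); last by rewrite mulr2n; lra.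
  by rewrite cos_mulr2n cos2sin2; ring.
rewrite ler_wpM2l// le_min; apply/andP; split.
  by rewrite -[leRHS](expr1n _ 2) -real_normK ?num_real// ler_pXn2r ?nnegrE// sin_max.
rewrite -[leLHS]real_normK ?num_real// -[leRHS]real_normK ?num_real// ler_pXn2r ?nnegrE//.
wlog x0 : x / 0 <= x.
  move=> H; have [/H//|x0] := leP 0 x.
  by have := H (- x); rewrite mulNr sinN !normrN; apply; lra.
have y0 : 0 <= x / 2 by lra.
have [->|yn0] := eqVneq (x / 2) 0; first by rewrite sin0.
have ylt : 0 < x / 2 by rewrite lt_neqAle eq_sym yn0.
have [|c _] := @MVT_segment R sin cos 0 (x / 2) y0 (fun c _ => is_derive_sin c).
  by apply: continuous_subspaceT => c; exact: continuous_sin.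
rewrite sin0 !subr0 => ->; rewrite normrM ler_piMl//; exact: cos_max.
Qed.

(** The integral that defines the constant converges and is not zero, since its integrand vanishes
    in the unit ball only on a hyperplane. *)
Lemma fractional_constant_gt0 s : (0 < n)%N -> 0 < s < 1 ->
  0 < @fractional_constant R n s.
Proof.
move=> n0 s01; rewrite invr_gt0 /Rintegral; set p := n%:R + 2 * s.
pose e := @e1 R n.
have e1e : enorm e = 1 by exact: enorm_e1.
pose f (z : 'rV[R]_n) := (1 - cos (dotv z e)) / enorm z `^ p.
have mf : measurable_fun setT f.
  apply: measurable_funM; last exact: measurable_kernel.
  apply: measurable_funB => //.
  apply: (@measurableT_comp _ _ _ _ _ _ (@cos R)); last exact: measurable_fun_dotv.
  by apply: continuous_measurable_fun; exact: continuous_cos.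
have f0 z : 0 <= f z.
  by rewrite mulr_ge0 ?invr_ge0 ?powR_ge0//; have /andP[] := one_sub_cos_le (dotv z e).
have ffin : (\int[mu]_z (f z)%:E < +oo)%E.
  apply: (@le_lt_trans _ _ (\int[mu]_z (2%:E * (Num.min 1 (enorm z ^+ 2) / enorm z `^ p)%:E))%E).
    have mm : measurable_fun setT (fun z : 'rV[R]_n => Num.min 1 (enorm z ^+ 2) / enorm z `^ p).
      apply: measurable_funM; last exact: measurable_kernel.
      by apply: measurable_minr => //; apply: measurable_funX; apply: measurable_fun_enorm.
    apply: ge0_le_integralT.
    - exact/measurable_EFinP.
    - by apply/measurable_EFinP; exact: measurable_funM.
    - by move=> z; rewrite lee_fin.
    - move=> z; rewrite -EFinM lee_fin mulrA ler_wpM2r ?invr_ge0 ?powR_ge0//.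
      have /andP[_ /le_trans] := one_sub_cos_le (dotv z e); apply.
      rewrite ler_wpM2l// le_min; apply/andP; split; first by rewrite ge_min lexx.
      rewrite ge_min; apply/orP; right.
      rewrite -real_normK ?num_real// ler_pXn2r ?nnegrE ?enorm_ge0//.
      by rewrite (le_trans (cauchy_schwarz _ _))// e1e mulr1.
  rewrite ge0_integralZl_EFin//.
  - by rewrite lte_mul_pinfty//; exact: singular_kernel_fin.
  - by move=> z _; rewrite lee_fin mulr_ge0 ?invr_ge0 ?powR_ge0// le_min ler01 sqr_ge0.
  - apply/measurable_EFinP; apply: measurable_funM; last exact: measurable_kernel.
    by apply: measurable_minr => //; apply: measurable_funX; apply: measurable_fun_enorm.
have fE0 z : (0 <= (f z)%:E)%E by rewrite lee_fin.
apply: fine_gt0; apply/andP; split=> //; rewrite lt0e.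
apply/andP; split; last by apply: integral_ge0 => z _; exact: fE0.
apply/eqP => If; have f_eq0 := ge0_integral_eq0 ((measurable_EFinP _ _).2 mf) fE0 If.
have e0 : e != 0 by rewrite -enorm_eq0 e1e oner_eq0.
have : {ae mu, forall z, ~ eball 0 1 z}.
  apply: filterS2 f_eq0 (ae_hyperplane e0) => z [fz] ze zB.
  have {}zB : enorm z < 1 by move: zB; rewrite /eball/= subr0.
  have z0 : z != 0 by apply: contraNneq ze => ->; rewrite dot0v.
  move/eqP: fz; rewrite mulf_eq0 invr_eq0 (gt_eqF (powR_gt0 _ _)) ?enorm_gt0// orbF.
  rewrite subr_eq0 => /eqP c1; have /eqP : `|cos (dotv z e)| == 1 by rewrite -c1 normr1.
  move=> /eqP; rewrite norm_cos_eq1 => /eqP.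
  have zelt : `|dotv z e| < 2.
    rewrite (le_lt_trans (cauchy_schwarz _ _))// e1e mulr1 (lt_trans zB)//.
    by rewrite ltr1n.
  have : 0 < sin `|dotv z e| by apply: sin2_gt0; rewrite normr_gt0 ze.
  have [ze0|ze0] := leP 0 (dotv z e).
    by rewrite ger0_norm// => /lt0r_neq0 /eqP.
  by rewrite ltr0_norm// sinN oppr_gt0 => /ltr0_neq0 /eqP.
move=> [A [mA A0 BA]]; have := @lebesgue_rV_eball_gt0 R n 0 1 ltr01.
rewrite (@subset_measure0 _ _ _ mu (eball 0 1) A) ?ltxx//; first exact: measurable_eball.
by move=> z zB; apply: BA => /=; exact.
Qed.

End singular_kernel_bounds.

(** * Gagliardo energy and gain of integrability *)

Section energy.
Context {R : realType} {n : nat}.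
Local Notation mu := (@lebesgue_rV R n).
Implicit Types (s p : R) (u : 'rV[R]_n -> R).

Definition energy_density s u (x y : 'rV[R]_n) : R :=
  `|u x - u y| ^+ 2 / enorm (x - y) `^ (n%:R + 2 * s).

(** The square of the Gagliardo seminorm. *)
Definition energy s u : \bar R :=
  (\int[mu]_x \int[mu]_y (energy_density s u x y)%:E)%E.

Lemma energy_density_ge0 s u x y : 0 <= energy_density s u x y.
Proof. by rewrite mulr_ge0 ?sqr_ge0 ?invr_ge0 ?powR_ge0. Qed.

Lemma measurable_energy_density s u : measurable_fun setT u ->
  measurable_fun setT (fun z : 'rV[R]_n * 'rV[R]_n => energy_density s u z.1 z.2).
Proof.
move=> mu'; apply: measurable_funM.
  apply: measurable_funX; apply: (@measurableT_comp _ _ _ _ _ _ (@Num.norm _ R)) => //.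
  by apply: measurable_funB; exact: (measurableT_comp mu').
apply: measurable_kernel; apply: measurable_fun_rVD => //.
exact: measurable_fun_rVN.
Qed.

Lemma measurable_energy_section s u x : measurable_fun setT u ->
  measurable_fun setT (fun y => energy_density s u x y).
Proof.
move=> mu'.
exact: (measurableT_comp (measurable_energy_density s mu') (@measurable_pair1 _ _ _ _ x)).
Qed.

Lemma measurable_energy_inner s u : measurable_fun setT u ->
  measurable_fun setT (fun x => \int[mu]_y (energy_density s u x y)%:E)%E.
Proof.
move=> mu'; apply: (measurable_integral2 (f := fun x y => (energy_density s u x y)%:E)).
  by apply/measurable_EFinP; exact: measurable_energy_density.
by move=> x y; rewrite lee_fin energy_density_ge0.
Qed.

Lemma energy_ge0 s u : (0 <= energy s u)%E.
Proof.
apply: integral_ge0 => x _; apply: integral_ge0 => y _.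
by rewrite lee_fin energy_density_ge0.
Qed.

Lemma gagliardo_seminorm_sqr s u : (gagliardo_seminorm s u ^+ 2 = energy s u)%E.
Proof.
rewrite /gagliardo_seminorm -/(energy s u); move: (energy_ge0 s u).
case: (energy s u) => [r| |//]; last by rewrite poweRyr// invr_eq0.
rewrite lee_fin => r0.
by rewrite poweR_EFin -EFin_expe powR12_sqrt// sqr_sqrtr.
Qed.

Lemma gagliardo_seminorm_lty s u :
  (gagliardo_seminorm s u < +oo)%E = (energy s u < +oo)%E.
Proof.
rewrite /gagliardo_seminorm -/(energy s u); move: (energy_ge0 s u).
case: (energy s u) => [r| |//] _; first by rewrite poweR_EFin !ltry.
by rewrite poweRyr// invr_eq0.
Qed.

Lemma measurable_powR_norm p u : measurable_fun setT u ->
  measurable_fun setT (fun x => `|u x| `^ p).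
Proof.
move=> mu'; apply: (@measurableT_comp _ _ _ _ _ _ (@powR R ^~ p)) => //.
exact: measurableT_comp.
Qed.

(** Markov's inequality for the [p]-th power. *)
Lemma measure_superlevel_le p u (a : R) : 0 < a -> 0 < p -> measurable_fun setT u ->
  ((a `^ p)%:E * mu [set y | (a <= `|u y|)%R] <= \int[mu]_x (`|u x| `^ p)%:E)%E.
Proof.
move=> a0 p0 mu'.
have mA : measurable [set y | a <= `|u y|].
  rewrite [X in measurable X](_ : _ = (fun y => `|u y|) @^-1` `[a, +oo[); last first.
    by apply/seteqP; split => x /=; rewrite in_itv/= andbT.
  have mn : measurable_fun setT (fun y => `|u y|) by exact: measurableT_comp.
  by rewrite -[X in measurable X]setTI; exact: mn.
rewrite -[X in mu X]setIT -integral_indic// -ge0_integralZl_EFin ?powR_ge0//.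
  apply: ge0_le_integralT.
  - apply/measurable_EFinP; apply: measurable_funM => //; exact: measurable_indic.
  - by apply/measurable_EFinP; exact: measurable_powR_norm.
  - by move=> x; rewrite -EFinM lee_fin mulr_ge0 ?powR_ge0.
  - move=> x; rewrite -EFinM lee_fin indicE.
    have [/set_mem/= ax|] := boolP (x \in _); last by rewrite mulr0 powR_ge0.
    by rewrite mulr1 ge0_ler_powR ?nnegrE// ltW.
by apply/measurable_EFinP; exact: measurable_indic.
Qed.

(** The gain in integrability: around a point where [|u x| = a], at most half
    of the cube of side [2 rho], with [(2 rho)^n] a suitable multiple of
    [a^-p], can carry values above [a / 2]; on the rest of that cube the
    difference quotient in the energy is at least [(a / 2)^2] over
    [(n rho)^(n + 2 s)], which bounds the inner integral from below. *)
Lemma energy_inner_ge s p u : (0 < n)%N -> 0 < s -> 0 < p ->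
  measurable_fun setT u -> (\int[mu]_x (`|u x| `^ p)%:E < +oo)%E ->
  exists2 c : R, 0 < c & forall x,
    ((c * `|u x| `^ (2 + 2 * s * p / n%:R))%:E <=
     \int[mu]_y (energy_density s u x y)%:E)%E.
Proof.
move=> n0 s0 p0 mu' Ip.
have nR0 : 0 < n%:R :> R by rewrite ltr0n.
set I := (\int[mu]_x (`|u x| `^ p)%:E)%E in Ip.
have I0 : (0 <= I)%E by apply: integral_ge0 => x _; rewrite lee_fin powR_ge0.
pose M := fine I; have IM : I = M%:E by rewrite fineK// ge0_fin_numE.
have M0 : 0 <= M by rewrite -lee_fin -IM.
(* [M + 1] instead of [M] keeps the cube nondegenerate when the integral is zero. *)
pose A := 2 * (M + 1) * 2 `^ p.
have A0 : 0 < A by rewrite !mulr_gt0 ?powR_gt0 ?ltr_wpDl// ltr0n.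
pose kap := A `^ n%:R^-1 / 2.
have kap0 : 0 < kap by rewrite divr_gt0 ?powR_gt0.
pose P := n%:R + 2 * s.
have P0 : 0 < P by rewrite addr_gt0 ?mulr_gt0.
pose c := 2 ^+ n / (8 * n%:R `^ P) * kap `^ (- (2 * s)).
exists c; first by rewrite !mulr_gt0 ?invr_gt0 ?mulr_gt0 ?powR_gt0 ?exprn_gt0.
move=> x; have e0 : 2 + 2 * s * p / n%:R != 0.
  by rewrite gt_eqF// addr_gt0// !mulr_gt0// invr_gt0.
have [ux0|ux0] := eqVneq (u x) 0.
  rewrite ux0 normr0 powR0// mulr0; apply: integral_ge0 => y _.
  by rewrite lee_fin energy_density_ge0.
set a := `|u x|; have a0 : 0 < a by rewrite normr_gt0.
pose rho := kap * a `^ (- (p / n%:R)).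
have rho0 : 0 < rho by rewrite mulr_gt0 ?powR_gt0.
have rhon : (2 * rho) ^+ n = A * a `^ (- p).
  rewrite /rho /kap mulrA mulrCA mulfV ?mulr1 ?pnatr_eq0// exprMn.
  rewrite -!powR_mulrn ?powR_ge0// -!powRrM mulVf ?gt_eqF// powRr1 ?ltW//.
  by rewrite mulNr divfK ?gt_eqF.
pose Q := [set y : 'rV[R]_n | forall i, `|(y - x) ord0 i| < rho].
have mQ' : measurable_fun setT (fun y : 'rV[R]_n => y - x) by exact: measurable_translation.
have mQ : measurable Q.
  rewrite -[X in measurable X]setTI.
  by have := mQ' measurableT _ (measurable_cube rho); exact.
have muQ : mu Q = (A * a `^ (- p))%:E.
  rewrite -rhon -(lebesgue_rV_cube n (ltW rho0)).
  exact: (lebesgue_rV_translation (- x) (measurable_cube rho)).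
pose W := [set y : 'rV[R]_n | a / 2 <= `|u y|].
have mW : measurable W.
  rewrite (_ : W = (fun y => `|u y|) @^-1` `[a / 2, +oo[); last first.
    by apply/seteqP; split => y /=; rewrite in_itv/= andbT.
  have mn : measurable_fun setT (fun y => `|u y|) by exact: measurableT_comp.
  by rewrite -[X in measurable X]setTI; exact: mn.
have a20 : 0 < a / 2 by rewrite divr_gt0.
have muW : (mu W <= (A * a `^ (- p) / 2)%:E)%E.
  have := measure_superlevel_le a20 p0 mu'; rewrite -/I IM -/W.
  have apos : 0 < (a / 2) `^ p by rewrite powR_gt0.
  move=> /(lee_wpmul2l (x := ((a / 2) `^ p)^-1%:E)).
  rewrite lee_fin invr_ge0 (ltW apos) => /(_ isT).
  rewrite muleA -EFinM mulVf ?gt_eqF// mul1e => /le_trans; apply.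
  have -> : ((a / 2) `^ p)^-1 = 2 `^ p * a `^ (- p).
    by rewrite powRM ?(ltW a0)// -powR_inv// invfM invrK powRN mulrC.
  rewrite -EFinM lee_fin.
  have -> : A * a `^ (- p) / 2 = 2 `^ p * a `^ (- p) * (M + 1) by rewrite /A; field.
  by rewrite ler_wpM2l ?mulr_ge0 ?powR_ge0// lerDl.
have nrho0 : 0 < n%:R * rho by exact: mulr_gt0.
pose v := (a / 2) ^+ 2 / (n%:R * rho) `^ P.
have v0 : 0 < v by apply: divr_gt0; [exact: exprn_gt0|apply: powR_gt0; exact: mulr_gt0].
apply: (@le_trans _ _ (v%:E * mu (Q `\` W))%E); last first.
  rewrite -[X in mu X]setIT -integral_indic ?setIT//; last exact: measurableD.
  rewrite -ge0_integralZl_EFin ?(ltW v0)//; last first.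
    by apply/measurable_EFinP; apply: measurable_indic; exact: measurableD.
  apply: ge0_le_integralT.
  - apply/measurable_EFinP; apply: measurable_funM => //.
    by apply: measurable_indic; exact: measurableD.
  - by apply/measurable_EFinP; exact: measurable_energy_section.
  - by move=> y; rewrite -EFinM lee_fin mulr_ge0// ltW.
  move=> y; rewrite -EFinM lee_fin indicE.
  have [/set_mem/= [Qy /negP]|] := boolP (y \in _); last by rewrite mulr0 energy_density_ge0.
  rewrite -ltNge mulr1 => uy.
  have uxy : a / 2 <= `|u x - u y|.
    have := ler_normD (u x - u y) (u y); rewrite subrK -/a; lra.
  have xy0 : x - y != 0.
    by apply: contraTneq uxy => /subr0_eq ->; rewrite subrr normr0 -ltNge.
  rewrite /energy_density ler_pM ?sqr_ge0 ?invr_ge0 ?powR_ge0//.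
    by rewrite ler_pXn2r// nnegrE ltW.
  rewrite lef_pV2 ?posrE ?powR_gt0 ?enorm_gt0//.
  apply: ge0_ler_powR; rewrite ?nnegrE ?enorm_ge0 ?(ltW P0) ?(ltW nrho0)//.
  by rewrite enormBC; apply: enorm_le_cube => i; rewrite ltW.
have muQW : ((A * a `^ (- p) / 2)%:E <= mu (Q `\` W))%E.
  have -> : A * a `^ (- p) / 2 = A * a `^ (- p) - A * a `^ (- p) / 2 by field.
  rewrite EFinB leeBlDr// -muQ (measureDI mu mQ mW) leeD2l//.
  by apply: le_trans muW; apply: le_measure; rewrite ?inE//; exact: measurableI.
apply: le_trans (lee_wpmul2l _ muQW); last by rewrite lee_fin ltW.
rewrite -EFinM lee_fin -rhon /v le_eqVlt; apply/orP; left; apply/eqP.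
have -> : a `^ (2 + 2 * s * p / n%:R) = a ^+ 2 * a `^ (2 * s * p / n%:R).
  by rewrite powRD ?(gt_eqF a0) ?implybT// powR_mulrn ?(ltW a0).
rewrite powRM ?(ltW rho0) ?(ltW nR0)//.
have -> : rho `^ P = rho ^+ n * rho `^ (2 * s).
  by rewrite /P powRD ?(gt_eqF rho0) ?implybT// powR_mulrn ?(ltW rho0).
have -> : rho `^ (2 * s) = kap `^ (2 * s) / a `^ (2 * s * p / n%:R).
  rewrite /rho powRM ?powR_ge0 ?(ltW kap0)// -powRrM -powRN.
  by congr (_ * _ `^ _); field; rewrite gt_eqF.
rewrite /c powRN !exprMn; field.
by do ?[apply/andP; split]; rewrite gt_eqF ?exprn_gt0 ?powR_gt0//.
Qed.

End energy.

Section sobolev.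
Context {R : realType} {n : nat}.
Local Notation mu := (@lebesgue_rV R n).
Implicit Types (s p q : R) (u : 'rV[R]_n -> R).

Lemma lty_of_scaled (c : R) (X : \bar R) : 0 < c -> (0 <= X)%E ->
  (c%:E * X < +oo)%E -> (X < +oo)%E.
Proof.
move=> c0; case: X => [r _ _|_|//]; first exact: ltry.
by rewrite gt0_muley ?lte_fin.
Qed.

Lemma sobolev_step s p u : (0 < n)%N -> 0 < s -> 0 < p ->
  measurable_fun setT u -> (energy s u < +oo)%E ->
  (\int[mu]_x (`|u x| `^ p)%:E < +oo)%E ->
  (\int[mu]_x (`|u x| `^ (2 + 2 * s * p / n%:R))%:E < +oo)%E.
Proof.
move=> n0 s0 p0 mu' Eu Ip.
have [c c0 cE] := energy_inner_ge n0 s0 p0 mu' Ip.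
apply: (lty_of_scaled c0).
  by apply: integral_ge0 => x _; rewrite lee_fin powR_ge0.
apply: le_lt_trans Eu; rewrite -ge0_integralZl_EFin//.
- apply: ge0_le_integralT.
  + apply/measurable_EFinP; apply: measurable_funM => //.
    exact: measurable_powR_norm.
  + exact: measurable_energy_inner.
  + by move=> x; rewrite -EFinM lee_fin mulr_ge0 ?powR_ge0// ltW.
  + by move=> x; rewrite -EFinM cE.
- by apply/measurable_EFinP; exact: measurable_powR_norm.
- exact: ltW.
Qed.

(** Iterating the gain [p |-> 2 + theta * p], [theta = 2 s / n], from [p = 2]
    converges to its fixed point, the critical Sobolev exponent
    [2 n / (n - 2 s)]. *)
Lemma sobolev_iterate s theta u k : theta = 2 * s / n%:R -> (0 < n)%N -> 0 < s -> 2 * s < n%:R ->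
  measurable_fun setT u -> (energy s u < +oo)%E ->
  (\int[mu]_x (`|u x| ^+ 2)%:E < +oo)%E ->
  (\int[mu]_x (`|u x| `^ (2 * (1 - theta ^+ k.+1) / (1 - theta)))%:E < +oo)%E.
Proof.
move=> thE n0 s0 sn mu' Eu I2.
have nR0 : 0 < n%:R :> R by rewrite ltr0n.
have th0 : 0 < theta by rewrite thE divr_gt0// mulr_gt0.
have th1 : theta < 1 by rewrite thE ltr_pdivrMr// mul1r.
elim: k => [|k IHk].
  rewrite expr1 mulfK ?subr_eq0 ?gt_eqF//.
  by under eq_integral do rewrite powR_mulrn//.
set p := 2 * _ / _ in IHk.
have p0 : 0 < p.
  apply: divr_gt0; last by rewrite subr_gt0.
  by apply: mulr_gt0 => //; rewrite subr_gt0 exprn_ilt1// ltW.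
have := sobolev_step n0 s0 p0 mu' Eu IHk.
suff -> : 2 + 2 * s * p / n%:R = 2 * (1 - theta ^+ k.+2) / (1 - theta) by [].
rewrite [in RHS]exprS mulrAC -thE /p; field.
by rewrite subr_eq0 gt_eqF.
Qed.

(** The critical exponent [2 / (1 - theta)] satisfies the strict form of the last inequality exactly
    when [q * theta > 1]; an exponent reached after finitely many steps, close enough to it,
    satisfies the inequality too. *)
Lemma sobolev_exponent (theta q : R) : 0 < theta < 1 -> 1 < q * theta ->
  exists k : nat, exists p : R,
    [/\ p = 2 * (1 - theta ^+ k.+1) / (1 - theta), 2 < p & p <= q * (p - 2)].
Proof.
move=> /andP[th0 th1] qth.
have q1 : 1 < q by rewrite (lt_trans qth)// gtr_pMr ?(lt_trans _ qth)//; nra.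
have e0 : 0 < (q * theta - 1) / (q - 1) by rewrite divr_gt0 ?subr_gt0.
have cv : @GRing.exp R theta @ \oo --> 0 by apply: cvg_expr; rewrite ger0_norm ?ltW.
have [k _ /(_ k.+1 (leqnSn k))] : \forall k \near \oo, theta ^+ k < (q * theta - 1) / (q - 1).
  by near=> k; near: k; exact: cvgr_lt cv _ e0.
rewrite /= ltr_pdivlMr ?subr_gt0// => H.
set t := theta ^+ k.+1 in H *; have t0 : 0 < t by exact: exprn_gt0.
have th' : 0 < 1 - theta by rewrite subr_gt0.
suff key p : p * (1 - theta) = 2 * (1 - t) -> 2 < p /\ p <= q * (p - 2).
  have [|p2 pq] := key (2 * (1 - t) / (1 - theta)).
    by rewrite divfK// subr_eq0 gt_eqF.
  by exists k, (2 * (1 - t) / (1 - theta)).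
move=> pE; have pq : p <= q * (p - 2).
  rewrite -(ler_pM2r th').
  have -> : q * (p - 2) * (1 - theta) = q * (p * (1 - theta) - 2 * (1 - theta)) by ring.
  by rewrite pE; lra.
split => //; have : 0 < (q - 1) * (p - 2) by nra.
by rewrite pmulr_rgt0 ?subr_gt0.
Unshelve. all: by end_near. Qed.

(** One of [g <= 1], [g <= a^(p-2)] and [a^2 <= g^(2/(p-2))] holds, and [1 + 2/(p-2) <= q] by
    assumption. *)
Lemma weight_young (a g p q : R) : 0 <= a -> 2 < p -> p <= q * (p - 2) -> 0 <= g ->
  g * a ^+ 2 <= a ^+ 2 + a `^ p + g `^ q.
Proof.
move=> a0 p2 pq g0.
have ap := powR_ge0 a p; have gq := powR_ge0 g q; have a2 := sqr_ge0 a.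
have [g1|g1] := leP g 1; first by nra.
have [an0|an0] := eqVneq a 0.
  by rewrite an0 expr0n/= mulr0 add0r addr_ge0// powR_ge0.
have apos : 0 < a by rewrite lt_neqAle eq_sym an0.
have p20 : 0 < p - 2 by rewrite subr_gt0.
have [ga|ga] := leP g (a `^ (p - 2)).
  have : g * a ^+ 2 <= a `^ p.
    rewrite (_ : a `^ p = a `^ (p - 2) * a ^+ 2) ?ler_wpM2r//.
    by rewrite -powR_mulrn// -powRD ?subrK// an0 implybT.
  lra.
have : g * a ^+ 2 <= g `^ q.
  apply: (@le_trans _ _ (g * g `^ (2 / (p - 2)))).
    rewrite ler_wpM2l// -powR_mulrn//.
    have -> : a `^ 2 = (a `^ (p - 2)) `^ (2 / (p - 2)).
      by rewrite -powRrM mulrCA divff ?mulr1 ?gt_eqF.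
    by rewrite ge0_ler_powR ?nnegrE ?powR_ge0 ?divr_ge0// ltW.
  rewrite -{1}(powRr1 g0) -powRD; last by rewrite (gt_eqF (lt_trans ltr01 g1)) implybT.
  rewrite ler_powR ?(ltW g1)//.
  by rewrite -(ler_pM2r p20) mulrDl divfK ?gt_eqF// mul1r; lra.
lra.
Qed.

(** Since [q] lies strictly above [n / (2 s)], finitely many steps of the iteration reach an
    exponent that pairs with the weight. *)
Lemma weighted_square_fin s q (g : 'rV[R]_n -> R) u :
  (0 < n)%N -> 0 < s -> 2 * s < n%:R -> n%:R / (2 * s) < q ->
  measurable_fun setT u -> (energy s u < +oo)%E ->
  (\int[mu]_x (`|u x| ^+ 2)%:E < +oo)%E ->
  measurable_fun setT g -> (\int[mu]_x (`|g x| `^ q)%:E < +oo)%E ->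
  (\int[mu]_x (`|g x| * `|u x| ^+ 2)%:E < +oo)%E.
Proof.
move=> n0 s0 sn nsq mu' Eu I2 mg Ig.
have nR0 : 0 < n%:R :> R by rewrite ltr0n.
have th0 : 0 < 2 * s / n%:R by rewrite divr_gt0// mulr_gt0.
have th1 : 2 * s / n%:R < 1 by rewrite ltr_pdivrMr// mul1r.
have th01 : 0 < 2 * s / n%:R < 1 by rewrite th0.
have qth : 1 < q * (2 * s / n%:R).
  by rewrite mulrA ltr_pdivlMr// mul1r -ltr_pdivrMr// mulr_gt0.
have [k [p [pE p2 pq]]] := sobolev_exponent th01 qth.
have := sobolev_iterate k erefl n0 s0 sn mu' Eu I2; rewrite -pE => Ip.
have mu2 : measurable_fun setT (fun x => `|u x| ^+ 2).
  by apply: measurable_funX; exact: measurableT_comp.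
have mup := measurable_powR_norm p mu'; have mgq := measurable_powR_norm q mg.
apply: (@le_lt_trans _ _
    (\int[mu]_x (((`|u x| ^+ 2)%:E + (`|u x| `^ p)%:E) + (`|g x| `^ q)%:E))%E).
  apply: ge0_le_integralT.
  - by apply/measurable_EFinP; apply: measurable_funM => //; exact: measurableT_comp.
  - by apply: emeasurable_funD; [apply: emeasurable_funD|]; exact/measurable_EFinP.
  - by move=> x; rewrite lee_fin mulr_ge0// sqr_ge0.
  - by move=> x; rewrite -!EFinD lee_fin weight_young.
rewrite ge0_integralD//; do ?[exact/measurable_EFinP
  | by move=> x _; rewrite ?adde_ge0 ?lee_fin ?powR_ge0 ?sqr_ge0
  | by apply: emeasurable_funD; exact/measurable_EFinP].
rewrite ge0_integralD//; do ?[exact/measurable_EFinP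
  | by move=> x _; rewrite ?lee_fin ?powR_ge0 ?sqr_ge0].
by apply: (lte_add_pinfty _ Ig); exact: (lte_add_pinfty I2 Ip).
Qed.

End sobolev.

(** * Function spaces and equimeasurable weights *)

Section function_spaces.
Context {R : realType} {n : nat}.
Local Notation mu := (@lebesgue_rV R n).
Implicit Types (s p q : R) (u : 'rV[R]_n -> R) (Omega : set 'rV[R]_n).

Lemma Lfun_powerP q u : 0 < q -> u \in Lfun mu q%:E <->
  measurable_fun setT u /\ (\int[mu]_x (`|u x| `^ q)%:E < +oo)%E.
Proof.
move=> q0; rewrite inE /=; split.
  move=> /andP[/set_mem/= mu' /set_mem/=]; rewrite /finite_norm => uq; split => //.
  by have := poweR_lty q uq; rewrite powR_Lnorm// gt_eqF.
move=> [mu' Iu]; apply/andP; split; apply/mem_set => //=.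
by rewrite /finite_norm unlock; exact: poweR_lty.
Qed.

Lemma H0sP s Omega u : H0s s Omega u <->
  [/\ measurable_fun setT u, (\int[mu]_x (`|u x| ^+ 2)%:E < +oo)%E,
    (energy s u < +oo)%E & {ae mu, forall x, ~ Omega x -> u x = 0}].
Proof.
have E : (\int[mu]_x (`|u x| `^ 2)%:E = \int[mu]_x (`|u x| ^+ 2)%:E)%E.
  by under eq_integral do rewrite powR_mulrn//.
have := Lfun_powerP u (ltr0Sn R 1); rewrite E => P2.
rewrite /H0s /= gagliardo_seminorm_lty; split.
  by move=> [/P2[mu' Iu] Eu u0].
by move=> [mu' Iu Eu u0]; split => //; exact/P2.
Qed.

Lemma weighted_massE Omega g u : weighted_mass Omega g u =
  (\int[mu]_x ((g \_ Omega) x * `|u x| ^+ 2)%:E)%E.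
Proof.
rewrite /weighted_mass integral_mkcond; apply: eq_integral => x _.
by rewrite !patchE; case: ifPn => // _; rewrite mul0r.
Qed.

End function_spaces.

Section equimeasurability.
Context {R : realType} {n : nat}.
Local Notation mu := (@lebesgue_rV R n).
Variables (B : set 'rV[R]_n) (mB : measurable B) (Boo : (mu B < +oo)%E).

Lemma ge0_integral_mrestr (f : 'rV[R]_n -> \bar R) :
  measurable_fun setT f -> (forall x, (0 <= f x)%E) ->
  (\int[mrestr mu mB]_x f x = \int[mu]_(x in B) f x)%E.
Proof.
move=> mf f0.
have N0 : mrestr mu mB (~` B) = 0%E by rewrite /mrestr setICl measure0.
rewrite (ge0_negligible_integral (measurableC mB) measurableT mf (fun x _ => f0 x) N0).
rewrite setTD setCK; apply: eq_measure_integral => A mA AB.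
by rewrite /mrestr/=; congr (mu _); apply/setIidPl.
Qed.

Lemma measurable_restrict_fun (f : 'rV[R]_n -> R) :
  measurable_fun B f -> measurable_fun setT (f \_ B).
Proof. by move=> mf; exact/(measurable_restrictT f mB). Qed.

(** The distribution of [f] under the restriction of the measure to [B]. *)
Definition value_law (f : 'rV[R]_n -> R) (mf : measurable_fun B f) :
    {measure set R -> \bar R} :=
  measure_function_pushforward__canonical__measure_function_Measure
    (mrestr mu mB) (measurable_restrict_fun mf).

Lemma value_lawE (f : 'rV[R]_n -> R) (mf : measurable_fun B f) Y :
  value_law mf Y = mu (B `&` f @^-1` Y).
Proof.
rewrite /= /pushforward /mrestr; congr (mu _).
apply/seteqP; split => x /=; rewrite patchE.
  by move=> [+ Bx]; rewrite mem_set.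
by move=> [Bx Yx]; rewrite mem_set.
Qed.

(** Half-lines form a generating pi-system of the Borel sets of the line. *)
Lemma equimeasurable_preimage (g0 g : 'rV[R]_n -> R) (X : set R) :
  measurable_fun B g0 -> equimeasurable B g0 g -> measurable X ->
  mu (B `&` g @^-1` X) = mu (B `&` g0 @^-1` X).
Proof.
move=> mg0 [mg gg0] mX.
rewrite -(value_lawE mg) -(value_lawE mg0).
apply: (measure_unique (@RGenOInfty.G R) (fun k => `]- k%:R, +oo[%classic)) => //.
- exact: RGenOInfty.measurableE.
- move=> _ _ [x ->] [y ->]; exists (Num.max x y).
  by apply/seteqP; split => z /=; rewrite !in_itv/= !andbT gt_max => /andP.
- by move=> k; exists (- k%:R).
- apply/seteqP; split => // x _; exists (Num.bound `|x|) => //=.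
  rewrite in_itv/= andbT ltrNl; apply: le_lt_trans (ler_norm (- x)) _.
  by rewrite normrN; exact: archi_boundP.
- move=> _ [x ->]; rewrite !value_lawE.
  by have := gg0 x; congr (mu _ = mu _); apply/seteqP; split => z /= [Bz];
    rewrite in_itv/= ?andbT => ?; split => //; rewrite in_itv/= andbT.
- move=> k; rewrite value_lawE; apply: le_lt_trans Boo; apply: le_measure; rewrite ?inE//.
  by apply: mg.
Qed.

(** Equimeasurable weights have the same integrals of any composition; this
    transports integrability, signs and vanishing from [g0] to [g]. *)
Lemma equimeasurable_integral (g0 g : 'rV[R]_n -> R) (phi : R -> \bar R) :
  measurable_fun B g0 -> equimeasurable B g0 g ->
  measurable_fun setT phi -> (forall x, (0 <= phi x)%E) ->
  (\int[mu]_(x in B) phi (g x) = \int[mu]_(x in B) phi (g0 x))%E.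
Proof.
move=> mg0 gg0 mphi phi0; have [mg _] := gg0.
have step (f : 'rV[R]_n -> R) (mf : measurable_fun B f) :
    (\int[mu]_(x in B) phi (f x) = \int[value_law mf]_y phi y)%E.
  have mf' := measurable_restrict_fun mf.
  rewrite (ge0_integral_pushforward mf')// preimage_setT.
  rewrite ge0_integral_mrestr; last 2 first.
  - exact: (measurableT_comp mphi mf').
  - by move=> x; exact: phi0.
  by apply: eq_integral => x xB; rewrite /= patchE xB.
rewrite (step g mg) (step g0 mg0).
apply: (@eq_measure_integral _ _ R setT (value_law mg0) (value_law mg)) => Y mY _.
by rewrite !value_lawE; exact: equimeasurable_preimage.
Qed.

Lemma equimeasurable_ae (g0 g : 'rV[R]_n -> R) (X : set R) :
  measurable_fun B g0 -> equimeasurable B g0 g -> measurable X ->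
  {ae mu, forall x, B x -> X (g0 x)} -> {ae mu, forall x, B x -> X (g x)}.
Proof.
move=> mg0 gg0 mX [A [mA A0 BA]].
have mXC : measurable (~` X) by exact: measurableC.
have m0 : mu (B `&` g @^-1` (~` X)) = 0.
  rewrite (equimeasurable_preimage mg0 gg0 mXC).
  apply: (subset_measure0 _ mA _ A0); first exact: mg0.
  by move=> x [Bx Xx]; apply: BA => /= /(_ Bx).
exists (B `&` g @^-1` (~` X)); split => //; first by apply: gg0.1.
by move=> x /= /not_implyP[].
Qed.

Lemma equimeasurable_Lq (q : R) (g0 g : 'rV[R]_n -> R) : 0 < q ->
  in_Lq q B g0 -> equimeasurable B g0 g ->
  (\int[mu]_x (`|(g \_ B) x| `^ q)%:E < +oo)%E.
Proof.
move=> q0 /(Lfun_powerP _ q0)[mg0 Ig0] gg0.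
have E (f : 'rV[R]_n -> R) : (\int[mu]_x (`|(f \_ B) x| `^ q)%:E =
    \int[mu]_(x in B) (`|f x| `^ q)%:E)%E.
  rewrite [RHS]integral_mkcond; apply: eq_integral => x _; rewrite !patchE.
  by case: ifPn => // _; rewrite normr0 powR0// gt_eqF.
rewrite E (equimeasurable_integral (phi := fun y => (`|y| `^ q)%:E) _ gg0) -?E//.
- exact/(measurable_restrictT g0 mB).
- apply/measurable_EFinP; apply: (@measurableT_comp _ _ _ _ _ _ (@powR R ^~ q)) => //.
Qed.

End equimeasurability.

(** * Polarization and energy *)

Section double_integral.
Context {R : realType} {n : nat}.
Local Notation mu := (@lebesgue_rV R n).
Implicit Types (f g : 'rV[R]_n -> 'rV[R]_n -> R).

Definition measurable2 f :=
  measurable_fun setT (fun z : 'rV[R]_n * 'rV[R]_n => f z.1 z.2).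

Definition integral2 f : \bar R := (\int[mu]_x \int[mu]_y (f x y)%:E)%E.

Lemma measurable2_section f x : measurable2 f -> measurable_fun setT (f x).
Proof.
by move=> mf; exact: (measurableT_comp mf (@measurable_pair1 _ _ _ _ x)).
Qed.

Lemma measurable2_inner f : measurable2 f -> (forall x y, 0 <= f x y) ->
  measurable_fun setT (fun x => \int[mu]_y (f x y)%:E)%E.
Proof.
move=> mf f0; apply: (measurable_integral2 (f := fun x y => (f x y)%:E)).
  exact/measurable_EFinP.
by move=> x y; rewrite lee_fin.
Qed.

Lemma integral2_ge0 f : (forall x y, 0 <= f x y) -> (0 <= integral2 f)%E.
Proof.
by move=> f0; apply: integral_ge0 => x _; apply: integral_ge0 => y _; rewrite lee_fin.
Qed.

Lemma integral2D f g : measurable2 f -> measurable2 g ->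
  (forall x y, 0 <= f x y) -> (forall x y, 0 <= g x y) ->
  integral2 (fun x y => f x y + g x y) = (integral2 f + integral2 g)%E.
Proof.
move=> mf mg f0 g0; rewrite /integral2.
rewrite -ge0_integralD//; first last.
- exact: measurable2_inner.
- by move=> x _; apply: integral_ge0 => y _; rewrite lee_fin.
- exact: measurable2_inner.
- by move=> x _; apply: integral_ge0 => y _; rewrite lee_fin.
apply: eq_integral => x _; rewrite -ge0_integralD//.
- by move=> y _; rewrite lee_fin.
- by apply/measurable_EFinP; exact: measurable2_section.
- by move=> y _; rewrite lee_fin.
- by apply/measurable_EFinP; exact: measurable2_section.
Qed.

Lemma integral2_refll a f : measurable2 f -> (forall x y, 0 <= f x y) ->
  integral2 (fun x y => f (refl a x) y) = integral2 f.
Proof.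
move=> mf f0; rewrite /integral2.
apply: (integral_refl a (f := fun x => (\int[mu]_y (f x y)%:E)%E)).
  exact: measurable2_inner.
by move=> x; apply: integral_ge0 => y _; rewrite lee_fin.
Qed.

Lemma integral2_reflr a f : measurable2 f -> (forall x y, 0 <= f x y) ->
  integral2 (fun x y => f x (refl a y)) = integral2 f.
Proof.
move=> mf f0; rewrite /integral2; apply: eq_integral => x _.
apply: (integral_refl a (f := fun y => (f x y)%:E)).
  by apply/measurable_EFinP; exact: measurable2_section.
by move=> y; rewrite lee_fin.
Qed.

Lemma measurable2_refll a f : measurable2 f -> measurable2 (fun x y => f (refl a x) y).
Proof.
move=> mf; apply: (measurableT_comp (f := fun z : 'rV[R]_n * 'rV[R]_n => f z.1 z.2) mf
  (g := fun z : 'rV[R]_n * 'rV[R]_n => (refl a z.1, z.2))).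
apply: measurable_fun_pair => //.
exact: (measurableT_comp (measurable_refl a)).
Qed.

Lemma measurable2_reflr a f : measurable2 f -> measurable2 (fun x y => f x (refl a y)).
Proof.
move=> mf; apply: (measurableT_comp (f := fun z : 'rV[R]_n * 'rV[R]_n => f z.1 z.2) mf
  (g := fun z : 'rV[R]_n * 'rV[R]_n => (z.1, refl a z.2))).
apply: measurable_fun_pair => //.
exact: (measurableT_comp (measurable_refl a)).
Qed.

Lemma integral2_eq0 f : measurable2 f -> (forall x y, 0 <= f x y) ->
  integral2 f = 0%E -> {ae mu, forall x, {ae mu, forall y, f x y = 0}}.
Proof.
move=> mf f0 I0.
have : {ae mu, forall x, (\int[mu]_y (f x y)%:E = 0)%E}.
  apply: ge0_integral_eq0 => //; first exact: measurable2_inner.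
  by move=> x; apply: integral_ge0 => y _; rewrite lee_fin.
apply: filterS => x fx0.
have : {ae mu, forall y, (f x y)%:E = 0%E}.
  apply: ge0_integral_eq0 => //.
    by apply/measurable_EFinP; exact: measurable2_section.
  by move=> y; rewrite lee_fin.
by apply: filterS => y [].
Qed.

End double_integral.

Section polarization.
Context {R : realType} {n : nat}.
Local Notation mu := (@lebesgue_rV R n).
Variable a : 'rV[R]_n.
Local Notation sigma := (refl a).
Implicit Types (u g : 'rV[R]_n -> R) (x y : 'rV[R]_n).

(** Nonnegative exactly where [u] is at least as large at the one of [x] and
    its mirror image that lies on the side of [a]. *)
Definition tilt u x : R := dotv x a * (u x - u (sigma x)).

(** The two-point rearrangement: the larger of the two values of [u] at mirror
    points is put on the side of [a]. *)
Definition polarize u x : R := if tilt u x < 0 then u (sigma x) else u x.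

Lemma tilt_refl u x : tilt u (sigma x) = tilt u x.
Proof. by rewrite /tilt dotv_refl_normal reflK; ring. Qed.

Lemma polarize_refl u x :
  polarize u (sigma x) = if tilt u x < 0 then u x else u (sigma x).
Proof. by rewrite /polarize tilt_refl reflK. Qed.

Lemma measurable_comp_refl u : measurable_fun setT u ->
  measurable_fun setT (fun x => u (sigma x)).
Proof. by move=> mu'; exact: (measurableT_comp mu' (measurable_refl a)). Qed.

Lemma measurable_tilt u : measurable_fun setT u -> measurable_fun setT (tilt u).
Proof.
move=> mu'; apply: measurable_funM; first exact: measurable_fun_dotv.
by apply: measurable_funB => //; exact: measurable_comp_refl.
Qed.

Lemma measurable_polarize u : measurable_fun setT u ->
  measurable_fun setT (polarize u).
Proof.
move=> mu'; apply: measurable_fun_ifT => //; last exact: measurable_comp_refl.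
by apply: measurable_fun_ltr => //; exact: measurable_tilt.
Qed.

Lemma polarize_cases u x : (polarize u x = u x /\ polarize u (sigma x) = u (sigma x)) \/
  (polarize u x = u (sigma x) /\ polarize u (sigma x) = u x).
Proof. by rewrite polarize_refl /polarize; case: ifPn => _; [right|left]. Qed.

Lemma tilt_polarize_ge0 u x : 0 <= tilt (polarize u) x.
Proof.
rewrite [tilt (polarize u) x]/tilt polarize_refl /polarize; case: ltP => // /ltW.
by rewrite /tilt -oppr_ge0 -mulrN opprB.
Qed.

(** Since both values are only exchanged between mirror points, a symmetric
    function of the pair is unchanged. *)
Lemma integral_polarize_sym u (phi : 'rV[R]_n -> R -> \bar R) :
  (forall x t, (0 <= phi x t)%E) -> (forall x t, phi (sigma x) t = phi x t) ->
  measurable_fun setT (fun x => phi x (u x)) ->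
  measurable_fun setT (fun x => phi x (polarize u x)) ->
  (\int[mu]_x phi x (polarize u x) = \int[mu]_x phi x (u x))%E.
Proof.
move=> phi0 phis m1 m2.
have dbl := @integral_double_refl R n a.
have E : (\int[mu]_x phi x (polarize u x) + \int[mu]_x phi x (polarize u x) =
          \int[mu]_x phi x (u x) + \int[mu]_x phi x (u x))%E.
  rewrite -!dbl//; apply: eq_integral => x _; rewrite !phis.
  by have [[-> ->]|[-> ->]] := polarize_cases u x; rewrite ?phis// addeC.
move: E; have : (0 <= \int[mu]_x phi x (polarize u x))%E by exact: integral_ge0.
have : (0 <= \int[mu]_x phi x (u x))%E by exact: integral_ge0.
case: (integral _ _ _) => [p| |]//; case: (integral _ _ _) => [q| |]// _ _.
by rewrite -!EFinD => -[] pq; congr EFin; lra.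
Qed.

End polarization.

Definition riesz_kernel {R : realType} {n : nat} (s : R) (x y : 'rV[R]_n) : R :=
  (enorm (x - y) `^ (n%:R + 2 * s))^-1.

Section energy_polarization.
Context {R : realType} {n : nat}.
Local Notation mu := (@lebesgue_rV R n).
Variables (a : 'rV[R]_n) (s : R) (s0 : 0 < s) (a0 : a != 0).
Local Notation sigma := (refl a).
Implicit Types (u g : 'rV[R]_n -> R) (x y : 'rV[R]_n).

Local Notation K := (riesz_kernel s).

Let densityE u x y : energy_density s u x y = `|u x - u y| ^+ 2 * K x y.
Proof. by []. Qed.

Let KC x y : K x y = K y x.
Proof. by rewrite /riesz_kernel enormBC. Qed.

Let K_refl x y : K (sigma x) (sigma y) = K x y.
Proof. by rewrite /riesz_kernel -reflB enorm_refl. Qed.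

Let K_reflC x y : K (sigma x) y = K x (sigma y).
Proof. by rewrite /riesz_kernel enorm_reflB. Qed.

Let K_lt x y z : x != y -> enorm (x - y) ^+ 2 < enorm (x - z) ^+ 2 -> K x z < K x y.
Proof.
move=> xy; rewrite ltr_pXn2r ?nnegrE ?enorm_ge0// => lt_xyz.
have xy0 : 0 < enorm (x - y) by rewrite enorm_gt0 subr_eq0.
have xz0 := lt_trans xy0 lt_xyz.
rewrite /riesz_kernel ltf_pV2 ?posrE ?powR_gt0//.
by apply: gt0_ltr_powR; rewrite ?nnegrE ?enorm_ge0// ltr_wpDl// mulr_gt0.
Qed.

Local Opaque riesz_kernel refl.

(** A pair of points on the same side is closer than the pair in which one of
    the points is reflected, so its interaction is the stronger one. *)
Lemma kernel_refl_cmp x y : x != y -> x != sigma y ->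
  [/\ 0 < dotv x a * dotv y a -> K x (sigma y) < K x y,
      dotv x a * dotv y a < 0 -> K x y < K x (sigma y) &
      dotv x a * dotv y a = 0 -> K x (sigma y) = K x y].
Proof.
move=> xy xsy; have aa : 0 < dotv a a by rewrite dotvv_gt0.
have D := enorm_reflB_diff x y (lt0r_neq0 aa).
have Dg : 0 < dotv x a * dotv y a -> enorm (x - y) ^+ 2 < enorm (x - sigma y) ^+ 2.
  by move=> h; rewrite -subr_gt0 D divr_gt0// mulr_gt0.
have Dl : dotv x a * dotv y a < 0 -> enorm (x - sigma y) ^+ 2 < enorm (x - y) ^+ 2.
  by move=> h; rewrite -subr_lt0 D pmulr_llt0 ?invr_gt0// pmulr_rlt0.
split => [h|h|h].
- by apply: K_lt => //; exact: Dg.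
- by apply: K_lt => //; exact: Dl.
- move/eqP: h; rewrite mulf_eq0 => /orP[|] /eqP h.
    by rewrite -K_reflC refl_fix.
  by rewrite refl_fix.
Qed.

(** Symmetrized over the four mirror pairs, the energy density can be compared pointwise with the
    one of the polarization. *)
Let Q u x y : R := energy_density s u x y + energy_density s u (sigma x) (sigma y)
  + (energy_density s u x (sigma y) + energy_density s u (sigma x) y).

Let QE u x y : Q u x y =
  (`|u x - u y| ^+ 2 + `|u (sigma x) - u (sigma y)| ^+ 2) * K x y +
  (`|u x - u (sigma y)| ^+ 2 + `|u (sigma x) - u y| ^+ 2) * K x (sigma y).
Proof.
by rewrite /Q !densityE K_refl K_reflC !mulrDl.
Qed.

Let sq_norm (b : R) : `|b| ^+ 2 = b ^+ 2.
Proof. by rewrite real_normK ?num_real. Qed.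

Let Q_swap u x y : tilt a u x < 0 -> 0 <= tilt a u y ->
  Q u x y - Q (polarize a u) x y =
  2 * (K x (sigma y) - K x y) * ((u x - u (sigma x)) * (u y - u (sigma y))).
Proof.
move=> ux uy; rewrite !QE !polarize_refl /polarize ux (ltNge (tilt a u y)) uy/=.
rewrite !sq_norm; move: (u x) (u (sigma x)) (u y) (u (sigma y)) (K x y) (K x (sigma y)).
by move=> *; ring.
Qed.

Let swap_sign (k v w : R) (P : Prop) :
  (v < 0 -> 0 < k) -> (0 < v -> k < 0) -> (v = 0 -> k = 0) -> v * w <= 0 ->
  (P -> v * w < 0) -> 0 <= 2 * k * w /\ (P -> 0 < 2 * k * w).
Proof.
move=> k1 k2 k3 vw vwP; rewrite -mulrA pmulr_rge0// pmulr_rgt0//.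
have [v0|v0|v0] := ltgtP v 0.
- have kp := k1 v0; rewrite pmulr_rge0// pmulr_rgt0//.
  split; first by move: vw; rewrite nmulr_rle0.
  by move=> /vwP; rewrite nmulr_rlt0.
- have kn := k2 v0; rewrite nmulr_rge0// nmulr_rgt0//.
  split; first by move: vw; rewrite pmulr_rle0.
  by move=> /vwP; rewrite pmulr_rlt0.
- by rewrite k3// mul0r; split => // /vwP; rewrite v0 mul0r.
Qed.

Let Q_swap_ge0 u x y : tilt a u x < 0 -> 0 <= tilt a u y ->
  0 <= Q u x y - Q (polarize a u) x y /\
  (0 < tilt a u y -> 0 < Q u x y - Q (polarize a u) x y).
Proof.
move=> ux uy; rewrite Q_swap//.
have xy : x != y by apply: contraTneq ux => ->; rewrite -leNgt.
have xsy : x != sigma y by apply: contraTneq ux => ->; rewrite tilt_refl -leNgt.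
have [c1 c2 c3] := kernel_refl_cmp xy xsy.
apply: (swap_sign (v := dotv x a * dotv y a)).
- by move=> /c2; rewrite subr_gt0.
- by move=> /c1; rewrite subr_lt0.
- by move=> /c3 ->; rewrite subrr.
- by rewrite mulrACA; exact: mulr_le0_ge0 (ltW ux) uy.
- by move=> uy'; rewrite mulrACA -/(tilt a u x) -/(tilt a u y) nmulr_rlt0.
Qed.

Let QC u x y : Q u x y = Q u y x.
Proof.
rewrite !QE (KC y x) (KC y (sigma x)) K_reflC.
rewrite (distrC (u y)) (distrC (u (sigma y))) (distrC (u y)) (distrC (u (sigma y))).
by congr (_ + _); rewrite addrC.
Qed.

Let Q_ge0 u x y : 0 <= Q u x y.
Proof. by rewrite !addr_ge0 ?energy_density_ge0. Qed.

Let Q_polarize_le u x y : Q (polarize a u) x y <= Q u x y.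
Proof.
rewrite -subr_ge0.
have [ux|ux] := ltP (tilt a u x) 0; have [uy|uy] := ltP (tilt a u y) 0.
- rewrite !QE !polarize_refl /polarize ux uy !sq_norm.
  rewrite le_eqVlt; apply/orP; left; apply/eqP.
  move: (u x) (u (sigma x)) (u y) (u (sigma y)) (K x y) (K x (sigma y)).
  by move=> *; ring.
- by have [] := Q_swap_ge0 ux uy.
- by rewrite (QC u) (QC (polarize a u)); have [] := Q_swap_ge0 uy ux.
- by rewrite !QE !polarize_refl /polarize !ltNge ux uy subrr.
Qed.

Let measurableQ u : measurable_fun setT u -> measurable2 (Q u).
Proof.
move=> mu'; have m : measurable2 (energy_density s u) := measurable_energy_density s mu'.
have mr := measurable2_reflr a m; have ml := measurable2_refll a m.
have mlr := measurable2_refll a mr.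
exact: (measurable_funD (measurable_funD m mlr) (measurable_funD mr ml)).
Qed.

Let integral2_Q u : measurable_fun setT u ->
  integral2 (Q u) = (energy s u + energy s u + (energy s u + energy s u))%E.
Proof.
move=> mu'; have m : measurable2 (energy_density s u) := measurable_energy_density s mu'.
have mr := measurable2_reflr a m; have ml := measurable2_refll a m.
have mlr := measurable2_refll a mr.
have e0 := energy_density_ge0 s u.
have D1 := integral2D m mlr e0 (fun x y => e0 (sigma x) (sigma y)).
have D2 := integral2D mr ml (fun x y => e0 x (sigma y)) (fun x y => e0 (sigma x) y).
have D := integral2D (measurable_funD m mlr) (measurable_funD mr ml)
  (fun x y => addr_ge0 (e0 x y) (e0 (sigma x) (sigma y)))
  (fun x y => addr_ge0 (e0 x (sigma y)) (e0 (sigma x) y)).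
have E1 := integral2_refll a mr (fun x y => e0 x (sigma y)).
have E2 := integral2_reflr a m e0; have E3 := integral2_refll a m e0.
apply: (etrans D); apply: (f_equal2 _ (etrans D1 _) (etrans D2 _)).
  exact: (f_equal2 _ (erefl _) (etrans E1 E2)).
exact: (f_equal2 _ E2 E3).
Qed.

(** Polarization changes the symmetrized density [Q] only at pairs of which exactly one point is
    exchanged with its mirror image; there the change is the product of the two jumps
    [u - u \o refl a] with a difference of kernels whose sign is fixed by the geometry. If the
    energies agree and [tilt a u] is negative at one generic point [x], the equality of [Q] at
    [(x, y)] for almost every [y] leaves no room for [tilt a u y > 0]. *)
Lemma energy_polarize u : measurable_fun setT u -> (energy s u < +oo)%E ->
  (energy s (polarize a u) <= energy s u)%E /\
  (energy s (polarize a u) = energy s u ->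
   {ae mu, forall x, 0 <= tilt a u x} \/ {ae mu, forall x, tilt a u x <= 0}).
Proof.
move=> mu' Eu; have mp := measurable_polarize a mu'.
pose T x y := Q u x y - Q (polarize a u) x y.
have T0 x y : 0 <= T x y by rewrite subr_ge0.
have mT : measurable2 T by apply: measurable_funB; exact: measurableQ.
have sumQ : (energy s u + energy s u + (energy s u + energy s u) =
    energy s (polarize a u) + energy s (polarize a u) +
    (energy s (polarize a u) + energy s (polarize a u)) + integral2 T)%E.
  apply: (etrans (esym (integral2_Q mu'))).
  apply: (etrans _ (f_equal2 adde (integral2_Q mp) (erefl (integral2 T)))).
  apply: (etrans _ (integral2D (measurableQ mp) mT (Q_ge0 (polarize a u)) T0)).
  by apply: eq_integral => x _; apply: eq_integral => y _; rewrite /T addrC subrK.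
have := integral2_ge0 T0; have := energy_ge0 s (polarize a u); have := energy_ge0 s u.
have := integral2_eq0 mT T0.
move: sumQ Eu; case: (energy s u) => [e| |]//.
case: (energy s (polarize a u)) => [e'| |]//; case: (integral2 T) => [i| |]//.
rewrite -!EFinD => -[sumQ] _ T_eq0; rewrite !lee_fin => e_ge0 e'_ge0 i0; split; first by lra.
move=> [ee']; have {}T_eq0 : {ae mu, forall x, {ae mu, forall y, T x y = 0}}.
  by apply: T_eq0; congr EFin; lra.
have [[x [ux Tx]]|nex] := pselect (exists x, tilt a u x < 0 /\ {ae mu, forall y, T x y = 0}).
  right; apply: filterS Tx => y Txy; rewrite leNgt; apply/negP => uy.
  by have [_ /(_ uy)] := Q_swap_ge0 ux (ltW uy); rewrite -/(T x y) Txy ltxx.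
left; apply: filterS T_eq0 => x Tx; rewrite leNgt; apply/negP => ux.
by apply: nex; exists x.
Qed.

End energy_polarization.

(** * Variations of the energy and rearrangement of the masses *)

Section energy_calculus.
Context {R : realType} {n : nat}.
Local Notation mu := (@lebesgue_rV R n).
Variable s : R.
Implicit Types (u v chi : 'rV[R]_n -> R).

Lemma energy_parallelogram u v : measurable_fun setT u -> measurable_fun setT v ->
  (energy s (fun x => (u x + v x)%R) + energy s (fun x => (u x - v x)%R) =
   (energy s u + energy s u) + (energy s v + energy s v))%E.
Proof.
move=> mu' mv.
have md w : measurable_fun setT w -> measurable2 (energy_density s w) :=
  @measurable_energy_density R n s w.
have e0 w := @energy_density_ge0 R n s w.
have mp := measurable_funD mu' mv; have mm := measurable_funB mu' mv.
rewrite /energy -!/(integral2 _).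
have D w := fun mw : measurable_fun setT w => integral2D (md w mw) (md w mw) (e0 w) (e0 w).
have D2 w := fun mw : measurable_fun setT w => measurable_funD (md w mw) (md w mw).
apply: (etrans (esym (integral2D (md _ mp) (md _ mm) (e0 _) (e0 _)))).
apply: (etrans _ (f_equal2 adde (D u mu') (D v mv))).
apply: (etrans _ (integral2D (D2 u mu') (D2 v mv)
  (fun x y => addr_ge0 (e0 u x y) (e0 u x y)) (fun x y => addr_ge0 (e0 v x y) (e0 v x y)))).
apply: eq_integral => x _; apply: eq_integral => y _; congr EFin.
rewrite /energy_density !real_normK ?num_real//; set K := (_ `^ _)^-1.
by rewrite /=; ring.
Qed.

Lemma energy_ae_eq u v : measurable_fun setT u -> measurable_fun setT v ->
  {ae mu, forall x, u x = v x} -> energy s u = energy s v.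
Proof.
move=> mu' mv uv; apply: ge0_ae_eq_integral => //.
- exact: measurable_energy_inner.
- exact: measurable_energy_inner.
- by move=> x _; apply: integral_ge0 => y _; rewrite lee_fin energy_density_ge0.
- by move=> x _; apply: integral_ge0 => y _; rewrite lee_fin energy_density_ge0.
have uv' := uv; apply: filterS uv => x uvx _.
apply: ge0_ae_eq_integral => //.
- by apply/measurable_EFinP; exact: measurable_energy_section.
- by apply/measurable_EFinP; exact: measurable_energy_section.
- by move=> y _; rewrite lee_fin energy_density_ge0.
- by move=> y _; rewrite lee_fin energy_density_ge0.
by apply: filterS uv' => y uvy _; rewrite /energy_density uvx uvy.
Qed.

Lemma integral2_convolution_fin (w k : 'rV[R]_n -> R) :
  measurable_fun setT w -> measurable_fun setT k ->
  (forall x, 0 <= w x) -> (forall x, 0 <= k x) ->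
  (\int[mu]_x (w x)%:E < +oo)%E -> (\int[mu]_x (k x)%:E < +oo)%E ->
  (integral2 (fun x y => (w y * k (x - y))%R) < +oo)%E.
Proof.
move=> mw mk w0 k0 Iw Ik.
have mwE : measurable_fun setT (fun x : 'rV[R]_n => (w x)%:E) by exact/measurable_EFinP.
have mkE : measurable_fun setT (fun x : 'rV[R]_n => (k x)%:E) by exact/measurable_EFinP.
have kE0 x : (0 <= (k x)%:E)%E by rewrite lee_fin.
have wE0 x : (0 <= (w x)%:E)%E by rewrite lee_fin.
have mf : measurable2 (fun x y => w y * k (x - y)).
  apply: measurable_funM; first exact: (measurableT_comp mw).
  apply: (measurableT_comp mk); apply: measurable_fun_rVD => //.
  exact: measurable_fun_rVN.
rewrite /integral2 (integral_swap (f := fun x y => (w y * k (x - y))%:E)); last 2 first.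
- exact/measurable_EFinP.
- by move=> x y; rewrite lee_fin mulr_ge0.
have Ik0 : (0 <= \int[mu]_z (k z)%:E)%E by apply: integral_ge0 => z _; exact: kE0.
have kfin : (\int[mu]_z (k z)%:E)%E \is a fin_num by rewrite ge0_fin_numE.
have inner y : (\int[mu]_x (w y * k (x - y)%R)%:E = (fine (\int[mu]_z (k z)%:E))%:E * (w y)%:E)%E.
  under eq_integral do rewrite EFinM.
  have mky : measurable_fun setT (fun x : 'rV[R]_n => (k (x - y))%:E).
    exact: (measurableT_comp mkE (measurable_translation (- y))).
  rewrite (ge0_integralZl_EFin mu measurableT (fun x _ => kE0 (x - y)) mky (w0 y)).
  by rewrite (integral_translation (- y) mkE kE0) fineK// muleC.
under eq_integral do rewrite inner.
rewrite (ge0_integralZl_EFin mu measurableT (fun x _ => wE0 x) mwE) ?fine_ge0//.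
by rewrite lte_mul_pinfty// lee_fin fine_ge0.
Qed.

(** Multiplication by a bounded Lipschitz function preserves finite energy:
    the extra term is controlled by [u ^ 2] times the integral of the singular
    kernel against [min(1, |z|^2)]. *)
Lemma energy_cutoff u chi (C : R) : 0 < s < 1 -> measurable_fun setT u ->
  measurable_fun setT chi -> (forall x, `|chi x| <= 1) ->
  (forall x y, `|chi x - chi y| ^+ 2 <= C * Num.min 1 (enorm (x - y) ^+ 2)) ->
  (energy s u < +oo)%E -> (\int[mu]_x (`|u x| ^+ 2)%:E < +oo)%E ->
  (energy s (fun x => (u x * chi x)%R) < +oo)%E.
Proof.
move=> s01 mu' mchi chi1 chiC Eu I2.
pose k (z : 'rV[R]_n) := Num.min 1 (enorm z ^+ 2) / enorm z `^ (n%:R + 2 * s).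
have k0 z : 0 <= k z.
  by rewrite mulr_ge0 ?invr_ge0 ?powR_ge0// le_min ler01 sqr_ge0.
have mk : measurable_fun setT k.
  apply: measurable_funM; last exact: measurable_kernel.
  by apply: measurable_minr => //; apply: measurable_funX; apply: measurable_fun_enorm.
pose f (x y : 'rV[R]_n) := `|u y| ^+ 2 * k (x - y).
have f0 x y : 0 <= f x y by rewrite mulr_ge0// sqr_ge0.
have mu2 : measurable_fun setT (fun y => `|u y| ^+ 2).
  by apply: measurable_funX; exact: measurableT_comp.
have mf : measurable2 f.
  apply: measurable_funM; first exact: (measurableT_comp mu2).
  apply: (measurableT_comp mk); apply: measurable_fun_rVD => //.
  exact: measurable_fun_rVN.
have If : (integral2 f < +oo)%E.
  apply: (integral2_convolution_fin mu2 mk _ k0 I2 (singular_kernel_fin s01)).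
  by move=> x; exact: sqr_ge0.
pose d := energy_density s u.
have md : measurable2 d := measurable_energy_density s mu'.
have d0 := @energy_density_ge0 R n s u.
have mm (c : R) g : measurable2 g -> measurable2 (fun x y : 'rV[R]_n => c * g x y).
  by move=> mg; apply: measurable_funM.
have Z (c : R) g : 0 <= c -> measurable2 g -> (forall x y, 0 <= g x y) ->
    (integral2 g < +oo -> integral2 (fun x y : 'rV[R]_n => c * g x y)%R < +oo)%E.
  move=> c0 mg g0 Ig; rewrite /integral2.
  under eq_integral => x _.
    under eq_integral do rewrite EFinM.
    rewrite ge0_integralZl_EFin//; last 2 first.
    - by move=> y _; rewrite lee_fin.
    - by apply/measurable_EFinP; exact: measurable2_section.
    over.
  rewrite ge0_integralZl_EFin//; last 2 first.
  - by move=> x _; apply: integral_ge0 => y _; rewrite lee_fin.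
  - exact: measurable2_inner.
  by rewrite lte_mul_pinfty.
have muchi : measurable_fun setT (fun x => u x * chi x) by exact: measurable_funM.
have C0' : 0 <= 2 * `|C| by rewrite mulr_ge0.
have bound x y : energy_density s (fun x => u x * chi x) x y <=
    2 * d x y + 2 * `|C| * f x y.
  rewrite /d /f /k /energy_density.
  set K := (_ `^ _)^-1; set m := Num.min _ _.
  have K0 : 0 <= K by rewrite invr_ge0 powR_ge0.
  have -> : 2 * (`|u x - u y| ^+ 2 * K) + 2 * `|C| * (`|u y| ^+ 2 * (m * K)) =
    (2 * `|u x - u y| ^+ 2 + 2 * (`|u y| ^+ 2 * (`|C| * m))) * K by ring.
  rewrite ler_wpM2r//.
  have -> : u x * chi x - u y * chi y = chi x * (u x - u y) + u y * (chi x - chi y) by ring.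
  have m0 : 0 <= m by rewrite le_min ler01 sqr_ge0.
  have h1 : chi x ^+ 2 <= 1.
    by rewrite -(expr1n _ 2) -[leLHS]real_normK ?num_real// ler_pXn2r ?nnegrE.
  have h2 : (chi x - chi y) ^+ 2 <= `|C| * m.
    rewrite -[leLHS]real_normK ?num_real// (le_trans (chiC x y))//.
    by rewrite ler_wpM2r// ler_norm.
  rewrite !real_normK ?num_real//.
  have h3 : (chi x * (u x - u y)) ^+ 2 <= (u x - u y) ^+ 2.
    by rewrite exprMn ler_piMl ?sqr_ge0.
  have h4 : (u y * (chi x - chi y)) ^+ 2 <= u y ^+ 2 * (`|C| * m).
    by rewrite exprMn ler_wpM2l ?sqr_ge0.
  move: h3 h4; set p := chi x * _; set w := u y * (chi x - chi y).
  by have := sqr_ge0 (p - w); rewrite sqrrB sqrrD; lra.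
have mbnd : measurable2 (fun x y => 2 * d x y + 2 * `|C| * f x y).
  exact: measurable_funD (mm 2 _ md) (mm (2 * `|C|) _ mf).
have d20 x y : 0 <= 2 * d x y by exact: mulr_ge0 (ler0n _ 2) (d0 x y).
have f20 x y : 0 <= 2 * `|C| * f x y by exact: mulr_ge0 C0' (f0 x y).
apply: (@le_lt_trans _ _ (integral2 (fun x y => 2 * d x y + 2 * `|C| * f x y))).
  apply: ge0_le_integralT.
  - exact: measurable_energy_inner.
  - apply: measurable2_inner; first exact: mbnd.
    by move=> x y; exact: addr_ge0.
  - by move=> x; apply: integral_ge0 => y _; rewrite lee_fin energy_density_ge0.
  - move=> x; apply: ge0_le_integralT.
    + by apply/measurable_EFinP; exact: measurable_energy_section.
    + apply/measurable_EFinP.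
      exact: (measurable2_section x mbnd).
    + by move=> y; rewrite lee_fin energy_density_ge0.
    + by move=> y; rewrite lee_fin.
rewrite (integral2D (mm 2 _ md) (mm (2 * `|C|) _ mf) d20 f20).
apply: lte_add_pinfty; first exact: (Z _ _ (ler0n _ 2) md d0 Eu).
exact: (Z _ _ C0' mf f0 If).
Qed.

End energy_calculus.

Section rearrangement_inequalities.
Context {R : realType} {n : nat}.
Local Notation mu := (@lebesgue_rV R n).
Variable a : 'rV[R]_n.
Implicit Types (u g G V U : 'rV[R]_n -> R) (w : 'rV[R]_n -> R).

(** For weights extended by zero, the integral of [weighted_mass] runs over the whole space. *)
Definition mass G w : \bar R := (\int[mu]_x (G x * `|w x| ^+ 2)%:E)%E.

Lemma measurable_mass G w : measurable_fun setT G -> measurable_fun setT w ->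
  measurable_fun setT (fun x => G x * `|w x| ^+ 2).
Proof.
move=> mG mw; apply: measurable_funM => //; apply: measurable_funX.
exact: measurableT_comp.
Qed.

Lemma mass_ge0 G w : (forall x, 0 <= G x) -> (0 <= mass G w)%E.
Proof. by move=> G0; apply: integral_ge0 => x _; rewrite lee_fin mulr_ge0// sqr_ge0. Qed.

(** To compare two integrals it is enough to compare the integrands summed over
    mirror pairs. *)
Lemma ge0_le_integral_mirror (f g : 'rV[R]_n -> R) :
  (forall x, 0 <= f x) -> (forall x, 0 <= g x) ->
  measurable_fun setT f -> measurable_fun setT g ->
  (forall x, f x + f (refl a x) <= g x + g (refl a x)) ->
  (\int[mu]_x (f x)%:E <= \int[mu]_x (g x)%:E)%E.
Proof.
move=> f0 g0 mf mg fg.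
have mE (h : 'rV[R]_n -> R) : measurable_fun setT h -> measurable_fun setT (fun x : 'rV[R]_n => (h x)%:E).
  by move=> mh; exact/measurable_EFinP.
have : (\int[mu]_x (f x)%:E + \int[mu]_x (f x)%:E <=
        \int[mu]_x (g x)%:E + \int[mu]_x (g x)%:E)%E.
  have fE0 x : (0 <= (f x)%:E)%E by rewrite lee_fin.
  have gE0 x : (0 <= (g x)%:E)%E by rewrite lee_fin.
  rewrite -(integral_double_refl a fE0 (mE _ mf)) -(integral_double_refl a gE0 (mE _ mg)).
  apply: ge0_le_integralT.
  - apply: emeasurable_funD; first exact: mE.
    exact: (measurableT_comp (mE _ mf) (measurable_refl a)).
  - apply: emeasurable_funD; first exact: mE.
    exact: (measurableT_comp (mE _ mg) (measurable_refl a)).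
  - by move=> x; rewrite -EFinD lee_fin addr_ge0.
  - by move=> x; rewrite -!EFinD lee_fin.
have : (0 <= \int[mu]_x (f x)%:E)%E by apply: integral_ge0 => x _; rewrite lee_fin.
have : (0 <= \int[mu]_x (g x)%:E)%E by apply: integral_ge0 => x _; rewrite lee_fin.
case: (\int[mu]_x (g x)%:E)%E => [q| |]//; last by move=> *; rewrite leey.
case: (\int[mu]_x (f x)%:E)%E => [p| |]//.
by move=> _ _; rewrite -!EFinD !lee_fin; lra.
Qed.

Let sq_norm (b : R) : `|b| ^+ 2 = b ^+ 2.
Proof. by rewrite real_normK ?num_real. Qed.

Let swap_le (A A' b b' t : R) : 0 <= b -> 0 <= b' ->
  t * (A - A') * (t * (b - b')) <= 0 -> t != 0 ->
  A * b ^+ 2 + A' * b' ^+ 2 <= A' * b ^+ 2 + A * b' ^+ 2.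
Proof.
move=> b0 b'0 H t0; have t2 : 0 < t ^+ 2 by rewrite exprn_even_gt0.
have : (A - A') * (b - b') <= 0.
  by move: H; rewrite mulrACA -expr2 pmulr_rle0.
have bb : 0 <= b + b' by lra.
move=> /(mulr_le0_ge0)/(_ bb); nra.
Qed.

(** The Hardy-Littlewood inequality for two-point rearrangements. *)
Lemma mass_polarize_ge G U : (forall x, 0 <= G x) -> (forall x, 0 <= U x) ->
  measurable_fun setT G -> measurable_fun setT U ->
  (mass G U <= mass (polarize a G) (polarize a U))%E.
Proof.
move=> G0 U0 mG mU.
have pG0 x : 0 <= polarize a G x by rewrite /polarize; case: ifP.
apply: ge0_le_integral_mirror.
- by move=> x; rewrite mulr_ge0// sqr_ge0.
- by move=> x; rewrite mulr_ge0// sqr_ge0.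
- exact: measurable_mass.
- by apply: measurable_mass; exact: measurable_polarize.
move=> x; rewrite !polarize_refl /polarize !sq_norm.
have [gx|gx] := ltP (tilt a G x) 0; have [ux|ux] := ltP (tilt a U x) 0 => //=.
- by rewrite addrC.
- rewrite [leRHS]addrC [leRHS]addrC; apply: (swap_le (t := dotv x a)) => //.
    exact: (mulr_le0_ge0 (ltW gx) ux).
  by apply: contraTneq gx => xa; rewrite /tilt xa mul0r ltxx.
- rewrite [leRHS]addrC; apply: (swap_le (t := dotv x a)) => //.
    exact: (mulr_ge0_le0 gx (ltW ux)).
  by apply: contraTneq ux => xa; rewrite /tilt xa mul0r ltxx.
Qed.

Lemma tilt_opp u x : tilt (- a) u x = - tilt a u x.
Proof. by rewrite /tilt refl_opp dotvNr mulNr. Qed.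

(** The reverse inequality when the weight is moved to the other side. *)
Lemma mass_polarize_le V U : (forall x, 0 <= V x) -> (forall x, 0 <= U x) ->
  measurable_fun setT V -> measurable_fun setT U ->
  (mass (polarize (- a) V) (polarize a U) <= mass V U)%E.
Proof.
move=> V0 U0 mV mU.
have pV0 x : 0 <= polarize (- a) V x by rewrite /polarize; case: ifP.
apply: ge0_le_integral_mirror.
- by move=> x; rewrite mulr_ge0// sqr_ge0.
- by move=> x; rewrite mulr_ge0// sqr_ge0.
- by apply: measurable_mass; exact: measurable_polarize.
- exact: measurable_mass.
move=> x; have := polarize_refl (- a) V x; rewrite refl_opp => ->.
rewrite polarize_refl /polarize !sq_norm refl_opp tilt_opp oppr_lt0.
have [vx|vx] := ltP 0 (tilt a V x); have [ux|ux] := ltP (tilt a U x) 0 => //=.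
- by rewrite addrC.
- apply: (swap_le (t := dotv x a)) => //.
    rewrite (_ : _ * (V (refl a x) - V x) = - tilt a V x); last by rewrite /tilt; ring.
    by rewrite mulNr oppr_le0; exact: mulr_ge0 (ltW vx) ux.
  by apply: contraTneq vx => xa; rewrite /tilt xa mul0r ltxx.
- rewrite [leLHS]addrC; apply: (swap_le (t := dotv x a)) => //.
    rewrite (_ : _ * (V (refl a x) - V x) = - tilt a V x); last by rewrite /tilt; ring.
    by rewrite mulNr oppr_le0; exact: mulr_le0 vx (ltW ux).
  by apply: contraTneq ux => xa; rewrite /tilt xa mul0r ltxx.
Qed.

Lemma mass_ae_eq G G' w w' :
  (forall x, 0 <= G x) -> (forall x, 0 <= G' x) ->
  measurable_fun setT G -> measurable_fun setT G' ->
  measurable_fun setT w -> measurable_fun setT w' ->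
  {ae mu, forall x, G x = G' x} -> {ae mu, forall x, w x = w' x} ->
  mass G w = mass G' w'.
Proof.
move=> G0 G'0 mG mG' mw mw' GG ww; apply: ge0_ae_eq_integral => //.
- by apply/measurable_EFinP; exact: measurable_mass.
- by apply/measurable_EFinP; exact: measurable_mass.
- by move=> x _; rewrite lee_fin mulr_ge0// sqr_ge0.
- by move=> x _; rewrite lee_fin mulr_ge0// sqr_ge0.
by apply: filterS2 GG ww => x -> ->.
Qed.

End rearrangement_inequalities.

(** * Rigidity of minimizing weights *)

Section almost_everywhere.
Context d (T : measurableType d) (R : realType) (mu : {measure set T -> \bar R}).

Lemma ae_exists (A : set T) (P : T -> Prop) : measurable A -> (0 < mu A)%E ->
  {ae mu, forall x, P x} -> exists2 x, A x & P x.
Proof.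
move=> mA A0 [Z [mZ Z0 PZ]]; apply: contrapT => nex.
move: A0; rewrite (@subset_measure0 _ _ _ mu A Z) ?ltxx// => x Ax.
by apply: PZ => /= Px; apply: nex; exists x.
Qed.

Lemma measure_ae_eq (A A' : set T) : measurable A -> measurable A' ->
  {ae mu, forall x, A x <-> A' x} -> mu A = mu A'.
Proof.
move=> mA mA' AA'; rewrite -[in LHS](setIT A) -[in RHS](setIT A') -!integral_indic//.
apply: ge0_ae_eq_integral => //.
- by apply/measurable_EFinP; exact: measurable_indic.
- by apply/measurable_EFinP; exact: measurable_indic.
apply: filterS AA' => x xAA' _; rewrite !indicE; congr ((nat_of_bool _)%:R%:E).
by apply/idP/idP => /set_mem/xAA'/mem_set.
Qed.

End almost_everywhere.

Section quadratic_expansion.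
Context {R : realType} {n : nat}.
Local Notation mu := (@lebesgue_rV R n).
Implicit Types (f chi : 'rV[R]_n -> R).

Lemma integrable_mul_bounded f chi : mu.-integrable setT (EFin \o f) ->
  measurable_fun setT chi -> (forall x, `|chi x| <= 1) ->
  mu.-integrable setT (EFin \o (fun x => f x * chi x)).
Proof.
move=> fi mchi chi1; apply: (le_integrable _ _ _ fi) => //.
- apply/measurable_EFinP; apply: measurable_funM => //.
  by have /measurable_EFinP := measurable_int mu fi.
- by move=> x _; rewrite /= lee_fin normrM ler_piMr.
Qed.

Lemma Rintegral_quadratic f chi (e : R) : mu.-integrable setT (EFin \o f) ->
  measurable_fun setT chi -> (forall x, `|chi x| <= 1) ->
  \int[mu]_x (f x * (1 + e * chi x) ^+ 2) =
  \int[mu]_x f x + 2 * e * \int[mu]_x (f x * chi x) +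
  e ^+ 2 * \int[mu]_x (f x * chi x * chi x).
Proof.
move=> fi mchi chi1.
have f1 := integrable_mul_bounded fi mchi chi1.
have f2 := integrable_mul_bounded f1 mchi chi1.
have Zi (c : R) h : mu.-integrable setT (EFin \o h) ->
    mu.-integrable setT (EFin \o (fun x => c * h x)).
  by move=> hi; have := integrableZl measurableT c hi; apply: eq_integrable.
have Di h1 h2 : mu.-integrable setT (EFin \o h1) -> mu.-integrable setT (EFin \o h2) ->
    mu.-integrable setT (EFin \o (fun x => h1 x + h2 x)).
  by move=> i1 i2; have := integrableD measurableT i1 i2; apply: eq_integrable.
rewrite -(RintegralZl _ _ f1)// -(RintegralZl _ _ f2)//.
rewrite -(RintegralD measurableT fi (Zi _ _ f1)).
rewrite -(RintegralD measurableT (Di _ _ fi (Zi _ _ f1)) (Zi _ _ f2)).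
by apply: eq_Rintegral => x _ /=; ring.
Qed.

End quadratic_expansion.

Section weights.
Context {R : realType} {n : nat}.
Local Notation mu := (@lebesgue_rV R n).
Variables (B : set 'rV[R]_n).
Hypothesis mB : measurable B.
Implicit Types (g G V w u : 'rV[R]_n -> R) (a : 'rV[R]_n).

(** Weights and eigenfunctions are replaced by representatives of this kind, for which all integrals
    run over the whole space and sign conditions hold pointwise. *)
Definition nneg_on G := [/\ measurable_fun setT G, forall x, 0 <= G x &
  forall x, ~ B x -> G x = 0].

Definition nneg_rep g : 'rV[R]_n -> R := fun x => Num.max 0 ((g \_ B) x).

Lemma nneg_rep_on g : measurable_fun B g -> nneg_on (nneg_rep g).
Proof.
move=> mg; split.
- by apply: measurable_maxr => //; exact/(measurable_restrictT g mB).
- by move=> x; rewrite /nneg_rep le_max lexx.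
- by move=> x Bx; rewrite /nneg_rep patchE memNset// maxxx.
Qed.

Lemma nneg_rep_ae g : {ae mu, forall x, B x -> 0 <= g x} ->
  {ae mu, forall x, nneg_rep g x = (g \_ B) x}.
Proof.
apply: filterS => x gx; rewrite /nneg_rep patchE; case: ifPn => xB.
  by apply/max_idPr; apply: gx; exact: set_mem.
by rewrite maxxx.
Qed.

Lemma nneg_on_restrict G : nneg_on G -> G \_ B = G.
Proof.
move=> [_ _ G0]; apply/funext => x; rewrite patchE; case: ifPn => //.
by rewrite notin_setE => xB; rewrite G0.
Qed.

Lemma weighted_mass_nneg G w : nneg_on G -> weighted_mass B G w = mass G w.
Proof. by move=> GB; rewrite weighted_massE nneg_on_restrict. Qed.

Lemma weighted_mass_rep g w : measurable_fun B g ->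
  {ae mu, forall x, B x -> 0 <= g x} -> measurable_fun setT w ->
  weighted_mass B g w = weighted_mass B (nneg_rep g) w.
Proof.
move=> mg g0 mw; rewrite (weighted_mass_nneg _ (nneg_rep_on mg)) weighted_massE.
apply: ae_eq_integral => //.
- apply/measurable_EFinP; apply: measurable_mass => //.
  exact/(measurable_restrictT g mB).
- by apply/measurable_EFinP; apply: measurable_mass => //; case: (nneg_rep_on mg).
- by apply: filterS (nneg_rep_ae g0) => x -> _.
Qed.

Lemma equimeasurable_rep g0 g : {ae mu, forall x, B x -> 0 <= g x} ->
  equimeasurable B g0 g -> equimeasurable B g0 (nneg_rep g).
Proof.
move=> gge0 [mg gg0]; have [mG _ _] := nneg_rep_on mg; split.
  exact: measurable_funTS.
move=> tau; rewrite -gg0.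
have mI h : measurable_fun B h -> measurable (B `&` [set x | tau < h x]).
  move=> mh; have := mh mB `]tau, +oo[%classic (measurable_itv _).
  by congr measurable; apply/seteqP; split => x /= [Bx];
    rewrite in_itv/= ?andbT => ?; split => //; rewrite in_itv/= andbT.
apply: measure_ae_eq; first by apply: mI; exact: measurable_funTS.
  exact: mI.
apply: filterS (nneg_rep_ae gge0) => x E.
by split=> -[Bx]; rewrite /= E patchE mem_set.
Qed.

Lemma equimeasurable_nneg g0 G : nneg_on G -> equimeasurable B g0 G <->
  (forall tau, mu (B `&` [set x | tau < G x]) = mu (B `&` [set x | tau < g0 x])).
Proof.
by move=> [mG _ _]; split=> [[]//|H]; split => //; exact: measurable_funTS.
Qed.

(** [B] coincides with its own polarization. *)
Definition polarizable a := forall x, 0 < dotv x a -> ~ B x -> ~ B (refl a x).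

Lemma nneg_on_polarize a G : polarizable a -> nneg_on G -> nneg_on (polarize a G).
Proof.
move=> pB [mG G0 GB]; split; first exact: measurable_polarize.
  by move=> x; rewrite /polarize; case: ifP.
move=> x Bx; rewrite /polarize; case: ltP => [|_]; last exact: GB.
rewrite /tilt (GB x Bx) sub0r mulrN oppr_lt0 => h; apply: GB; apply: pB => //.
rewrite ltNge; apply/negP => xa; move: h.
by rewrite ltNge mulr_le0_ge0.
Qed.

Lemma equimeasurable_polarize a g0 G : polarizable a -> nneg_on G ->
  equimeasurable B g0 G -> equimeasurable B g0 (polarize a G).
Proof.
move=> pB GB [_ gg0]; have pGB := nneg_on_polarize pB GB.
apply/equimeasurable_nneg => // tau; rewrite -gg0.
have [mG G0 GB0] := GB; have [mpG pG0 pGB0] := pGB.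
have [tau0|tau0] := ltP tau 0.
  congr (mu _); apply/seteqP; split => x [Bx _]; split => //=;
  by rewrite (lt_le_trans tau0).
have E H : nneg_on H -> mu (B `&` [set x | tau < H x]) =
    (\int[mu]_x (\1_(`]tau, +oo[%classic) (H x))%:E)%E.
  move=> [mH H0 HB].
  have mt : measurable (H @^-1` `]tau, +oo[%classic).
    by rewrite -[X in measurable X]setTI; exact: mH.
  rewrite (_ : B `&` _ = H @^-1` `]tau, +oo[%classic); last first.
    apply/seteqP; split => x /=; rewrite in_itv/= andbT; first by case.
    move=> tH; split => //; apply: contrapT => /HB Hx.
    by move: tH; rewrite Hx ltNge tau0.
  by rewrite -[X in mu X]setIT -integral_indic.
rewrite (E _ pGB) (E _ GB).
have mi : measurable_fun setT (\1_(`]tau, +oo[%classic) : R -> R).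
  exact: measurable_indic.
apply: (integral_polarize_sym (phi := fun _ t => (\1_(`]tau, +oo[%classic) t)%:E)) => //.
- by apply/measurable_EFinP; exact: (measurableT_comp mi mG).
- by apply/measurable_EFinP; exact: (measurableT_comp mi mpG).
Qed.

End weights.

Definition real_energy {R : realType} {n : nat} (s : R) (w : 'rV[R]_n -> R) : R :=
  fine (energy s w).

Definition real_mass {R : realType} {n : nat} (G w : 'rV[R]_n -> R) : R :=
  fine (mass G w).

Section energy_scaling.
Context {R : realType} {n : nat}.
Local Notation mu := (@lebesgue_rV R n).

Lemma energyZ s (e : R) (u : 'rV[R]_n -> R) : measurable_fun setT u ->
  energy s (fun x => e * u x) = ((e ^+ 2)%:E * energy s u)%E.
Proof.
move=> mu'; have e0 := @energy_density_ge0 R n s u.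
rewrite /energy -(ge0_integralZl_EFin mu measurableT _ (measurable_energy_inner s mu')); last 2 first.
- by move=> x _; apply: integral_ge0 => y _; rewrite lee_fin.
- exact: sqr_ge0.
apply: eq_integral => x _.
rewrite -(ge0_integralZl_EFin mu measurableT _ _); last 3 first.
- by move=> y _; rewrite lee_fin.
- by apply/measurable_EFinP; exact: measurable_energy_section.
- exact: sqr_ge0.
apply: eq_integral => y _; rewrite -EFinM; congr EFin.
by rewrite /energy_density !real_normK ?num_real//; set K := (_ `^ _)^-1; ring.
Qed.

Lemma Rintegral_eq0_ae (h : 'rV[R]_n -> R) : mu.-integrable setT (EFin \o h) ->
  (forall x, 0 <= h x) -> \int[mu]_x h x = 0 -> {ae mu, forall x, h x = 0}.
Proof.
move=> hi h0 Ih; have hfin := integrable_fin_num measurableT hi.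
have : {ae mu, forall x, (h x)%:E = 0%E}.
  apply: ge0_integral_eq0; first exact: (measurable_int mu hi).
    by move=> x; rewrite lee_fin.
  by rewrite -(fineK hfin) -[fine _]/(\int[mu]_x h x) Ih.
by apply: filterS => x [].
Qed.

End energy_scaling.

Section clamped_linear_forms.
Context {R : realType}.
Implicit Types (t v : R).

(** Truncation makes the linear form [dotv x a] a bounded Lipschitz multiplier of the same sign,
    admissible in a variation of the eigenfunction. *)
Definition clamp (t : R) : R := Num.max (-1) (Num.min 1 t).

Lemma clamp_norm t : `|clamp t| <= 1.
Proof.
by rewrite ler_norml /clamp le_max lexx ge_max/= ge_min lexx andbT; lra.
Qed.

Lemma clamp_lip t t' : `|clamp t - clamp t'| <= `|t - t'|.
Proof.
have F v v' : clamp v - clamp v' <= `|v - v'|.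
  have d := ler_norm (v - v'); have d0 := normr_ge0 (v - v').
  have m1 : Num.min 1 v <= 1 by rewrite ge_min lexx.
  have m2 : Num.min 1 v <= v by rewrite ge_min lexx orbT.
  have m3 : Num.min 1 v - `|v - v'| <= Num.min 1 v'.
    by rewrite le_min; apply/andP; split; lra.
  have m4 : Num.min 1 v' <= clamp v' by rewrite le_max lexx orbT.
  have m5 : -1 <= clamp v' by rewrite le_max lexx.
  by rewrite lerBlDr ge_max; apply/andP; split; lra.
by rewrite ler_norml F andbT lerNl opprB distrC F.
Qed.

Lemma clamp_sign t v : 0 <= v * t -> 0 <= v * clamp t.
Proof.
rewrite /clamp; have [t1|t1] := leP 1 t; last have [tm|tm] := leP (-1) t.
- by rewrite max_r; nra.
- by [].
- by nra.
Qed.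

Lemma clamp_neq0 t : t != 0 -> clamp t != 0.
Proof.
rewrite /clamp => t0; have [t1|t1] := leP 1 t; last have [tm|tm] := leP (-1) t => //.
  by rewrite max_r ?oner_eq0//; lra.
Qed.

Lemma measurable_clamp n (a : 'rV[R]_n) : measurable_fun setT (fun x => clamp (dotv x a)).
Proof.
apply: measurable_maxr => //; apply: measurable_minr => //.
exact: measurable_fun_dotv.
Qed.

Lemma clamp_cutoff n (a x y : 'rV[R]_n) :
  `|clamp (dotv x a) - clamp (dotv y a)| ^+ 2 <=
  (4 + enorm a ^+ 2) * Num.min 1 (enorm (x - y) ^+ 2).
Proof.
have a2 := sqr_ge0 (enorm a).
have [d1|d1] := leP 1 (enorm (x - y) ^+ 2).
  rewrite mulr1 (le_trans (_ : _ <= 2 ^+ 2))//; last by rewrite -natrX; lra.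
  rewrite ler_pXn2r ?nnegrE// (le_trans (ler_normB _ _))//.
  by have [] := (clamp_norm (dotv x a), clamp_norm (dotv y a)); lra.
apply: (@le_trans _ _ (enorm a ^+ 2 * enorm (x - y) ^+ 2)).
  rewrite -exprMn ler_pXn2r ?nnegrE ?mulr_ge0 ?enorm_ge0//.
  rewrite (le_trans (clamp_lip _ _))// -dotvNl -dotvDl mulrC.
  exact: cauchy_schwarz.
by rewrite ler_wpM2r ?sqr_ge0// lerDr.
Qed.

End clamped_linear_forms.

Section variational.
Context {R : realType} {n : nat}.
Local Notation mu := (@lebesgue_rV R n).
Variables (B : set 'rV[R]_n) (s q : R) (g0 V0 : 'rV[R]_n -> R).
Hypothesis mB : measurable B.
Hypothesis Boo : (mu B < +oo)%E.
Hypothesis n_gt0 : (0 < n)%N.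
Hypothesis s01 : 0 < s < 1.
Hypothesis sn : 2 * s < n%:R.
Hypothesis nsq : n%:R / (2 * s) < q.
Hypothesis g0q : in_Lq q B g0.
Hypothesis V0q : in_Lq q B V0.
Implicit Types (g G V w u : 'rV[R]_n -> R) (a : 'rV[R]_n).

Let s_gt0 : 0 < s. Proof. by have /andP[] := s01. Qed.

Let q_gt0 : 0 < q.
Proof. by apply: lt_trans nsq; rewrite divr_gt0 ?ltr0n// mulr_gt0. Qed.

Definition competitor (phi : 'rV[R]_n -> R) G := nneg_on B G /\ equimeasurable B phi G.

Lemma mass_lty phi G w : in_Lq q B phi -> competitor phi G -> H0s s B w ->
  (mass G w < +oo)%E.
Proof.
move=> phiq [GB phiG] /H0sP[mw I2 Ew _]; have [mG G0 _] := GB.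
have := weighted_square_fin n_gt0 s_gt0 sn nsq mw Ew I2 mG.
rewrite -{1}(nneg_on_restrict GB) => /(_ (equimeasurable_Lq mB Boo q_gt0 phiq phiG)).
by under eq_integral do rewrite ger0_norm//.
Qed.

Local Notation E := (real_energy s).
Local Notation M := real_mass.
Local Notation c := (@fractional_constant R n s / 2).

Let c_gt0 : 0 < c.
Proof. by rewrite divr_gt0// fractional_constant_gt0. Qed.

Let EE w : H0s s B w -> energy s w = (E w)%:E.
Proof.
by move=> /H0sP[_ _ Ew _]; rewrite /real_energy fineK// ge0_fin_numE// energy_ge0.
Qed.

Let ME phi G w : in_Lq q B phi -> competitor phi G -> H0s s B w ->
  mass G w = (M G w)%:E.
Proof.
move=> phiq Gc wH; rewrite /real_mass fineK// ge0_fin_numE; first exact: mass_lty phiq Gc wH.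
by apply: mass_ge0; case: Gc => -[].
Qed.

Let E_ge0 w : 0 <= E w. Proof. by rewrite fine_ge0// energy_ge0. Qed.

Let M_ge0 G w : (forall x, 0 <= G x) -> 0 <= M G w.
Proof. by move=> G0; rewrite fine_ge0// mass_ge0. Qed.

Let rayleighE G V w : competitor g0 G -> competitor V0 V -> H0s s B w ->
  M G w != 0 -> rayleigh s B G V w = ((c * E w + M V w) / M G w)%:E.
Proof.
move=> Gc Vc wH M0; rewrite /rayleigh gagliardo_seminorm_sqr.
rewrite !weighted_mass_nneg ?(EE wH) ?(ME g0q Gc wH) ?(ME V0q Vc wH); [|by case: Gc|by case: Vc].
by rewrite -EFinM -EFinD inver (negbTE M0) -EFinM.
Qed.

Let admissibleE G w : competitor g0 G -> H0s s B w ->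
  0 < M G w -> admissible s B G w.
Proof.
move=> Gc wH M0; split => //; rewrite weighted_mass_nneg ?(ME g0q Gc wH)//.
by case: Gc.
Qed.

Let first_eigenP G V u : competitor g0 G -> competitor V0 V ->
  first_eigenfunction s B G V u ->
  [/\ H0s s B u, 0 < M G u &
    lambda1 s B G V = ((c * E u + M V u) / M G u)%:E].
Proof.
move=> Gc Vc [[uH Mu] <-]; have Mu' : 0 < M G u.
  by move: Mu; rewrite weighted_mass_nneg ?(ME g0q Gc uH)//; case: Gc.
by split => //; rewrite rayleighE// gt_eqF.
Qed.

Let lambda1_le G V w (l : R) : competitor g0 G -> competitor V0 V -> H0s s B w ->
  lambda1 s B G V = l%:E -> l * M G w <= c * E w + M V w.
Proof.
move=> Gc Vc wH lE; have [[_ G0 _] _] := Gc; have [[_ V00 _] _] := Vc.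
have [M0|M0] := eqVneq (M G w) 0.
  by rewrite M0 mulr0 addr_ge0 ?M_ge0// mulr_ge0 ?E_ge0// ltW.
have Mp : 0 < M G w by rewrite lt_neqAle eq_sym M0 M_ge0.
have : (lambda1 s B G V <= rayleigh s B G V w)%E.
  by apply: ereal_inf_lbound; exists w => //; exact: admissibleE.
by rewrite lE rayleighE// lee_fin ler_pdivlMr.
Qed.

Let rigid_sum (x x' y y' z z' : R) : x' <= x -> y' <= y -> z <= z' -> z = x + y ->
  z' <= x' + y' -> x' = x /\ x' + y' = z'.
Proof. by move=> *; split; lra. Qed.

(** Along the chain
    [lambda1 <= lambda1' <= R'(u') <= R(u) = lambda1] all inequalities are
    equalities, hence so are the ones for the three terms of the quotient. *)
Lemma rayleigh_rigidity G V u G' V' u' (l : R) :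
  competitor g0 G -> competitor V0 V -> competitor g0 G' -> competitor V0 V' ->
  first_eigenfunction s B G V u -> H0s s B u' ->
  (lambda1 s B G V <= lambda1 s B G' V')%E ->
  (energy s u' <= energy s u)%E -> (mass V' u' <= mass V u)%E ->
  (mass G u <= mass G' u')%E ->
  lambda1 s B G V = l%:E ->
  [/\ energy s u' = energy s u, lambda1 s B G' V' = l%:E &
    c * E u' + M V' u' = l * M G' u'].
Proof.
move=> Gc Vc Gc' Vc' eig uH' lamle Ele Vle Gle lE.
have [uH Mu] := first_eigenP Gc Vc eig; rewrite lE => -[lE'].
have lM : l * M G u = c * E u + M V u by rewrite lE' divfK// gt_eqF.
move: Ele Vle Gle; rewrite (EE uH) (EE uH') (ME g0q Gc uH) (ME V0q Vc uH).
rewrite (ME g0q Gc' uH') (ME V0q Vc' uH') !lee_fin => Ele Vle Gle.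
have Mu' : 0 < M G' u' by exact: lt_le_trans Gle.
have [[_ V00 _] _] := Vc; have [[_ G00 _] _] := Gc.
have l_ge0 : 0 <= l.
  by rewrite lE' divr_ge0 ?M_ge0// addr_ge0 ?M_ge0// mulr_ge0 ?E_ge0// ltW.
have cE : c * E u' <= c * E u by rewrite ler_pM2l.
have lamle' : (lambda1 s B G' V' <= ((c * E u' + M V' u') / M G' u')%:E)%E.
  rewrite -rayleighE// ?gt_eqF//.
  by apply: ereal_inf_lbound; exists u' => //; exact: admissibleE.
have lle : l <= (c * E u' + M V' u') / M G' u'.
  by rewrite -lee_fin -lE; exact: le_trans lamle lamle'.
have lMle : l * M G' u' <= c * E u' + M V' u' by rewrite -ler_pdivlMr.
have lG : l * M G u <= l * M G' u' by rewrite ler_wpM2l.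
have [Eeq eq'] := rigid_sum cE Vle lG lM lMle.
split.
- by rewrite (mulfI (lt0r_neq0 c_gt0) Eeq).
- apply/eqP; rewrite eq_le; apply/andP; split; last by rewrite -lE.
  apply: (le_trans lamle'); rewrite eq' mulfK ?gt_eqF//.
- exact: eq'.
Qed.

Let mass_integrable phi G w : in_Lq q B phi -> competitor phi G -> H0s s B w ->
  mu.-integrable setT (EFin \o (fun x => G x * `|w x| ^+ 2)).
Proof.
move=> phiq Gc wH; have [[mG G0 _] _] := Gc; have [mw _ _ _] := (H0sP _ _ _).1 wH.
apply/integrableP; split; first by apply/measurable_EFinP; exact: measurable_mass.
have := mass_lty phiq Gc wH; congr (_ < _)%E; apply: eq_integral => x _ /=.
by rewrite (ger0_norm (mulr_ge0 (G0 x) (sqr_ge0 _))).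
Qed.

Variable Rad : R.
Hypothesis B_bounded : B `<=` eball 0 Rad.

(** A function of zero energy is constant, hence zero if it vanishes outside a
    bounded set. *)
Lemma energy_neq0 G u : nneg_on B G -> H0s s B u -> mass G u != 0%E ->
  energy s u != 0%E.
Proof.
move=> [mG G0 _] /H0sP[mu' _ _ u0]; apply: contraNneq => Eu.
have md : measurable2 (energy_density s u) := measurable_energy_density s mu'.
have D := integral2_eq0 md (@energy_density_ge0 R n s u) Eu.
pose far := eball ((`|Rad| + 1) *: @e1 R n) 1.
have e1e : enorm (@e1 R n) = 1 by exact: enorm_e1.
have [x farx [ux Dx]] : exists2 x, far x & (~ B x -> u x = 0) /\
    {ae mu, forall y, energy_density s u x y = 0}.
  apply: (ae_exists (measurable_eball _ _) (lebesgue_rV_eball_gt0 _ ltr01)).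
  by apply: filterS2 u0 D.
have ux0 : u x = 0.
  apply: ux => /B_bounded; rewrite /eball/= subr0 => xR.
  move: farx; rewrite /far /eball/= enormBC => farx.
  have := enorm_triangle ((`|Rad| + 1) *: @e1 R n - x) x.
  rewrite subrK enormZ e1e mulr1 ger0_norm ?addr_ge0//.
  have := ler_norm Rad; lra.
have uae : {ae mu, forall y, u y = 0}.
  apply: filterS Dx => y /eqP; rewrite mulf_eq0 invr_eq0 powR_eq0 ux0 sub0r normrN.
  case/orP => [|/andP[]]; first by rewrite sqrf_eq0 normr_eq0 => /eqP.
  by rewrite enorm_eq0 subr_eq0 => /eqP <-.
apply/eqP; rewrite /mass -[RHS](integral0 mu setT); apply: ae_eq_integral => //.
- by apply/measurable_EFinP; exact: measurable_mass.
- by apply: filterS uae => y -> _; rewrite normr0 expr0n/= mulr0.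
Qed.

Let pos_le0 (D X : R) : (forall e, 2 * e * D <= e ^+ 2 * X) -> D <= 0.
Proof.
move=> H; rewrite leNgt; apply/negP => D0.
have X0 : 0 < `|X| + 1 by rewrite ltr_wpDl.
have XY : X < `|X| + 1 by have := ler_norm X; lra.
move: (`|X| + 1) X0 XY => Y Y0 XY; have Y20 : 0 < Y ^+ 2 by rewrite exprn_gt0.
have := H (D / Y); rewrite -(ler_pM2r Y20).
have -> : 2 * (D / Y) * D * Y ^+ 2 = D ^+ 2 * (2 * Y) by field; rewrite gt_eqF.
have -> : (D / Y) ^+ 2 * X * Y ^+ 2 = D ^+ 2 * X by field; rewrite gt_eqF.
by rewrite ler_pM2l ?exprn_gt0//; lra.
Qed.

Let scale_sum (k x y z : R) : x + y = z -> k * y + k * x = k * z.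
Proof. by move=> <-; rewrite mulrDr addrC. Qed.

Let expand phi G u (chi : 'rV[R]_n -> R) (e : R) : in_Lq q B phi -> competitor phi G -> H0s s B u ->
  measurable_fun setT chi -> (forall x, `|chi x| <= 1) ->
  M G (fun x => u x + e * (u x * chi x)) = M G u +
  2 * e * \int[mu]_x (G x * `|u x| ^+ 2 * chi x) +
  e ^+ 2 * \int[mu]_x (G x * `|u x| ^+ 2 * chi x * chi x).
Proof.
move=> phiq Gc uH mchi chi1.
have := Rintegral_quadratic e (mass_integrable phiq Gc uH) mchi chi1 => <-.
apply: eq_Rintegral => x _; rewrite !real_normK ?num_real//; ring.
Qed.

(** Both functionals are minimal at [u], so testing one with [u (1 - e chi)]
    and the other with [u (1 + e chi)] the parts linear in the energy cancel by
    the parallelogram identity; what is left is linear in [e] up to [O(e^2)]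
    and forces the two pairs of weights to have the same chi-moments. *)
Lemma weights_eq_of_common_eigenfunction G V G' V' u (l : R) (chi : 'rV[R]_n -> R) (C : R) :
  competitor g0 G -> competitor V0 V -> competitor g0 G' -> competitor V0 V' ->
  H0s s B u -> {ae mu, forall x, B x -> 0 < u x} -> 0 < l ->
  lambda1 s B G V = l%:E -> lambda1 s B G' V' = l%:E ->
  c * E u + M V u = l * M G u -> c * E u + M V' u = l * M G' u ->
  measurable_fun setT chi -> (forall x, `|chi x| <= 1) ->
  (forall x y, `|chi x - chi y| ^+ 2 <= C * Num.min 1 (enorm (x - y) ^+ 2)) ->
  {ae mu, forall x, chi x != 0} ->
  (forall x, 0 <= (V x - V' x) * chi x) -> (forall x, 0 <= (G' x - G x) * chi x) ->
  {ae mu, forall x, G x = G' x} /\ {ae mu, forall x, V x = V' x}.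
Proof.
move=> Gc Vc Gc' Vc' uH u_gt0 l0 lE lE' eq eq' mchi chi1 chiC chi0 VV' GG'.
have [mu' I2 Eu u0] := (H0sP _ _ _).1 uH.
have mv : measurable_fun setT (fun x => u x * chi x) by exact: measurable_funM.
have Ev : (energy s (fun x => (u x * chi x)%R) < +oo)%E.
  exact: (energy_cutoff s01 mu' mchi chi1 chiC).
pose k := fine (energy s (fun x => u x * chi x)).
have kE : energy s (fun x => u x * chi x) = k%:E.
  by rewrite /k fineK// ge0_fin_numE// energy_ge0.
pose w (e : R) x := u x + e * (u x * chi x).
have mw e : measurable_fun setT (w e).
  by apply: measurable_funD => //; exact: measurable_funM.
have par (e : R) : (energy s (w e) + energy s (w (- e)%R) =
    ((2 * E u + 2 * (e ^+ 2 * k))%R)%:E)%E.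
  have mev : measurable_fun setT (fun x => e * (u x * chi x)) by exact: measurable_funM.
  have := energy_parallelogram s mu' mev; rewrite (energyZ s e mv) kE (EE uH) -EFinM -!EFinD.
  rewrite (_ : (fun x => u x - e * (u x * chi x)) = w (- e)); last first.
    by apply/funext => x; rewrite /w mulNr.
  by rewrite -/(w e) => ->; congr EFin; ring.
have wH e : H0s s B (w e).
  apply/H0sP; split; first exact: mw.
  - apply: (@le_lt_trans _ _ (\int[mu]_x (((1 + `|e|) ^+ 2)%:E * (`|u x| ^+ 2)%:E))%E).
      apply: ge0_le_integralT.
      + apply/measurable_EFinP; apply: measurable_funX; exact: measurableT_comp.
      + apply/measurable_EFinP; apply: measurable_funM => //; apply: measurable_funX.
        exact: measurableT_comp.
      + by move=> x; rewrite lee_fin sqr_ge0.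
      + move=> x; rewrite -EFinM lee_fin -exprMn ler_pXn2r ?nnegrE ?mulr_ge0//.
        rewrite /w (_ : _ + _ = u x * (1 + e * chi x)); last by ring.
        rewrite normrM mulrC ler_wpM2r// (le_trans (ler_normD _ _))// normr1 lerD2l.
        by rewrite normrM ler_piMr.
    have mu2 : measurable_fun setT (fun x => (`|u x| ^+ 2)%:E).
      by apply/measurable_EFinP; apply: measurable_funX; exact: measurableT_comp.
    have u20 x : [set: 'rV[R]_n] x -> (0 <= (`|u x| ^+ 2)%:E)%E by rewrite lee_fin sqr_ge0.
    rewrite (ge0_integralZl_EFin mu measurableT u20 mu2) ?sqr_ge0//.
    by rewrite lte_mul_pinfty// lee_fin sqr_ge0.
  - have := par e; have := energy_ge0 s (w e); have := energy_ge0 s (w (- e)).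
    by case: (energy s (w e)) => [z| |]//; [rewrite ltry|case: (energy s (w (- e)))].
  - by apply: filterS u0 => x ux /ux; rewrite /w => ->; rewrite mul0r mulr0 addr0.
have Esum e : E (w e) + E (w (- e)) = 2 * E u + 2 * (e ^+ 2 * k).
  by have := par e; rewrite (EE (wH e)) (EE (wH (- e))) -EFinD => -[].
pose J H := \int[mu]_x (H x * `|u x| ^+ 2 * chi x).
pose L H := \int[mu]_x (H x * `|u x| ^+ 2 * chi x * chi x).
have D0 : (J V - J V') + l * (J G' - J G) <= 0.
  apply: (pos_le0 (X := 2 * c * k + L V + L V' - l * (L G + L G'))) => e.
  have h1 := lambda1_le Gc Vc (wH (- e)) lE.
  have h2 := lambda1_le Gc' Vc' (wH e) lE'.
  have Es : c * E (w (- e)) + c * E (w e) = c * (2 * E u + 2 * (e ^+ 2 * k)).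
    exact: scale_sum (Esum e).
  move: h1 h2; rewrite /w (expand _ g0q Gc uH mchi chi1) (expand _ V0q Vc uH mchi chi1).
  rewrite (expand _ g0q Gc' uH mchi chi1) (expand _ V0q Vc' uH mchi chi1).
  rewrite -/(J G) -/(J V) -/(J G') -/(J V') -/(L G) -/(L V) -/(L G') -/(L V').
  rewrite -/(w e) -/(w (- e)).
  move: Es eq eq'; move: (E (w (- e))) (E (w e)) (E u) (M V u) (M G u) (M G' u) (M V' u).
  move: (J V) (J V') (J G) (J G') (L V) (L V') (L G) (L G') => *; nra.
have diff phi H H' : in_Lq q B phi -> competitor phi H -> competitor phi H' ->
    (forall x, 0 <= (H x - H' x) * chi x) ->
    0 <= J H - J H' /\ (J H - J H' = 0 -> {ae mu, forall x, H x = H' x}).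
  move=> phiq Hc Hc' HH.
  have i1 := integrable_mul_bounded (mass_integrable phiq Hc uH) mchi chi1.
  have i2 := integrable_mul_bounded (mass_integrable phiq Hc' uH) mchi chi1.
  pose h x := H x * `|u x| ^+ 2 * chi x - H' x * `|u x| ^+ 2 * chi x.
  have hi : mu.-integrable setT (EFin \o h).
    by have := integrableB measurableT i1 i2; apply: eq_integrable.
  have hE : J H - J H' = \int[mu]_x h x by rewrite -(RintegralB measurableT i1 i2).
  have h0 x : 0 <= h x.
    have -> : h x = (H x - H' x) * chi x * `|u x| ^+ 2 by rewrite /h; ring.
    by rewrite mulr_ge0 ?sqr_ge0.
  rewrite hE; split; first by apply: Rintegral_ge0.
  move=> /(Rintegral_eq0_ae hi h0) h_eq0.
  have [[_ _ H0] _] := Hc; have [[_ _ H0'] _] := Hc'.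
  apply: filterS3 h_eq0 u_gt0 chi0 => x hx ux cx.
  have [Bx|Bx] := pselect (B x); last by rewrite H0// H0'.
  move/eqP: hx; rewrite (_ : h x = (H x - H' x) * chi x * `|u x| ^+ 2); last by rewrite /h; ring.
  have nz : chi x * `|u x| ^+ 2 != 0.
    by rewrite mulf_neq0// expf_neq0// normr_eq0 gt_eqF// ux.
  by rewrite -mulrA mulf_eq0 (negbTE nz) orbF subr_eq0 => /eqP.
have [dV dV'] := diff _ _ _ V0q Vc Vc' VV'; have [dG dG'] := diff _ _ _ g0q Gc' Gc GG'.
have lG : 0 <= l * (J G' - J G) by rewrite mulr_ge0// ltW.
split; last by apply: dV'; lra.
have : l * (J G' - J G) = 0 by lra.
move=> /eqP; rewrite mulf_eq0 (gt_eqF l0)/= => /eqP /dG'.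
by apply: filterS => x ->.
Qed.

Let H0s_polarize a u : a != 0 -> nneg_on B u -> polarizable B a -> H0s s B u ->
  H0s s B (polarize a u).
Proof.
move=> a0 uB pB /H0sP[mu' I2 Eu u0]; have [_ _ pu0] := nneg_on_polarize pB uB.
have mp := measurable_polarize a mu'.
apply/H0sP; split; first exact: mp.
- have m2 w : measurable_fun setT w -> measurable_fun setT (fun x : 'rV[R]_n => (`|w x : R| ^+ 2)%:E).
    by move=> mw; apply/measurable_EFinP; apply: measurable_funX; exact: measurableT_comp.
  rewrite (integral_polarize_sym (phi := fun _ t => (`|t| ^+ 2)%:E))//.
  + exact: m2.
  + exact: m2.
- by have [Ele _] := energy_polarize s_gt0 a0 mu' Eu; exact: le_lt_trans Ele Eu.
- exact: aeW.
Qed.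

(** The configuration is compared with its polarization. The potential [V'] is the polarization of
    [V] to the opposite side, or [V] itself if it vanishes; the last two hypotheses are what both
    choices have in common. Equality of the energies gives the dichotomy; when [u] is its own
    polarization, it is a common first eigenfunction of the old and the new weights. *)
Lemma minimizer_tilt G V V' u a :
  competitor g0 G -> competitor V0 V -> competitor V0 V' ->
  nneg_on B u -> first_eigenfunction s B G V u -> {ae mu, forall x, B x -> 0 < u x} ->
  a != 0 -> polarizable B a ->
  (forall G' V', competitor g0 G' -> competitor V0 V' ->
    (lambda1 s B G V <= lambda1 s B G' V')%E) ->
  (mass V' (polarize a u) <= mass V u)%E ->
  (forall x, 0 <= (V x - V' x) * dotv x a) ->
  ({ae mu, forall x, 0 <= tilt a u x} \/ {ae mu, forall x, tilt a u x <= 0}) /\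
  ({ae mu, forall x, 0 <= tilt a u x} ->
    {ae mu, forall x, 0 <= tilt a G x} /\ {ae mu, forall x, V x = V' x}).
Proof.
move=> Gc Vc Vc' uB eig u_gt0 a0 pB minG VV' VVa.
have [mu' u_ge0 uB0] := uB; have [GB gG] := Gc; have [mG G_ge0 _] := GB.
have [uH Mu lE] := first_eigenP Gc Vc eig.
set l := (c * E u + M V u) / M G u in lE.
have lM : c * E u + M V u = l * M G u by rewrite /l divfK// gt_eqF.
have [_ _ Eu _] := (H0sP _ _ _).1 uH.
have [Ele Eeq] := energy_polarize s_gt0 a0 mu' Eu.
have Gc' : competitor g0 (polarize a G).
  by split; [exact: nneg_on_polarize|exact: equimeasurable_polarize].
have uH' := H0s_polarize a0 uB pB uH.
have [Ee lE' lM'] := rayleigh_rigidity Gc Vc Gc' Vc' eig uH' (minG _ _ Gc' Vc') Ele VV'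
  (mass_polarize_ge a G_ge0 u_ge0 mG mu') lE.
split; first exact: Eeq.
move=> tu; have pu : {ae mu, forall x, polarize a u x = u x}.
  by apply: filterS tu => x; rewrite leNgt /polarize => /negbTE ->.
have [mpG pG_ge0 _] := nneg_on_polarize pB GB.
have [[mV' V'_ge0 _] _] := Vc'; have [[mV V_ge0 _] _] := Vc.
have Ep : 0 < E u.
  rewrite lt_neqAle E_ge0 andbT eq_sym.
  have : energy s u != 0%E.
    apply: (energy_neq0 GB uH); rewrite (ME g0q Gc uH) eqe; exact: lt0r_neq0.
  by rewrite (EE uH).
have l_gt0 : 0 < l.
  exact: divr_gt0 (ltr_pwDl (mulr_gt0 c_gt0 Ep) (M_ge0 _ V_ge0)) Mu.
have lM2 : c * E u + M V' u = l * M (polarize a G) u.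
  have mp := measurable_polarize a mu'.
  have refl_ae (H : 'rV[R]_n -> R) : {ae mu, forall x, H x = H x} by exact: aeW.
  move: lM'; rewrite /real_energy Ee /real_mass.
  rewrite (mass_ae_eq V'_ge0 V'_ge0 mV' mV' mp mu' (refl_ae V') pu).
  by rewrite (mass_ae_eq pG_ge0 pG_ge0 mpG mpG mp mu' (refl_ae _) pu).
pose chi (x : 'rV[R]_n) := clamp (dotv x a).
have mchi : measurable_fun setT chi := measurable_clamp a.
have chiC x y := clamp_cutoff a x y.
have tG (x : 'rV[R]_n) : 0 <= (polarize a G x - G x) * dotv x a.
  rewrite /polarize; case: ltP => [/ltW|_]; last by rewrite subrr mul0r.
  by rewrite /tilt -oppr_ge0 -mulrN opprB mulrC.
have [GG VV] := weights_eq_of_common_eigenfunction Gc Vc Gc' Vc' uH u_gt0 l_gt0 lE lE' lM lM2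
  mchi (fun x => clamp_norm _) chiC (filterS (fun x => @clamp_neq0 R (dotv x a)) (ae_hyperplane a0))
  (fun x => clamp_sign (VVa x)) (fun x => clamp_sign (tG x)).
split; last exact: VV.
apply: filterS GG => x Gx; rewrite leNgt; apply/negP => tx.
by rewrite /polarize tx in Gx; move: tx; rewrite /tilt -Gx subrr mulr0 ltxx.
Qed.

End variational.

(** * Continuity of translations in mean *)

Section translation_continuity.
Context {R : realType} {n : nat}.
Local Notation mu := (@lebesgue_rV R n).
Implicit Types (A : set 'rV[R]_n) (h : 'rV[R]_n) (M e d : R).

Definition shifted_diff A h : set 'rV[R]_n :=
  (A `\` (fun x => x + h) @^-1` A) `|` ((fun x => x + h) @^-1` A `\` A).

(** Continuity at [h = 0] of the translates of [A], in measure on bounded sets. *)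
Definition shift_continuous A := measurable A /\ forall M e, 0 < e ->
  exists2 d, 0 < d & forall h, enorm h < d ->
    (mu (eball 0 M `&` shifted_diff A h) <= e%:E)%E.

Lemma measurable_shift A h : measurable A -> measurable ((fun x => x + h) @^-1` A).
Proof.
by move=> mA; rewrite -[X in measurable X]setTI; exact: measurable_translation.
Qed.

Lemma measurable_shifted_diff A h : measurable A -> measurable (shifted_diff A h).
Proof.
by move=> mA; have mAh := measurable_shift h mA; apply: measurableU; exact: measurableD.
Qed.

Lemma measurable_ball_shifted_diff A M h : measurable A ->
  measurable (eball 0 M `&` shifted_diff A h).
Proof.
by move=> mA; apply: measurableI; [exact: measurable_eball|exact: measurable_shifted_diff].
Qed.

Lemma shift_continuous0 : shift_continuous set0.
Proof.
split=> // M e e0; exists 1 => // h _; rewrite /shifted_diff preimage_set0 !set0D setU0 setI0.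
by rewrite measure0 lee_fin ltW.
Qed.

Lemma shift_continuousC A : shift_continuous A -> shift_continuous (~` A).
Proof.
move=> [mA HA]; split; first exact: measurableC.
move=> M e e0; have [d d0 Hd] := HA M e e0; exists d => // h hd.
rewrite (_ : shifted_diff (~` A) h = shifted_diff A h); first exact: Hd.
apply/seteqP; split => x /= [[]|[]].
- by move=> Ax /contrapT Ahx; right.
- by move=> Ahx /contrapT Ax; left.
- by move=> Ax Ahx; right; split => //; exact.
- by move=> Ahx Ax; left; split => //; exact.
Qed.

Lemma shift_continuousU A A' : shift_continuous A -> shift_continuous A' ->
  shift_continuous (A `|` A').
Proof.
move=> [mA HA] [mA' HA']; split; first exact: measurableU.
move=> M e e0; have e2 : 0 < e / 2 by rewrite divr_gt0.
have [d d0 Hd] := HA M _ e2; have [d' d'0 Hd'] := HA' M _ e2.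
exists (Num.min d d'); first by rewrite lt_min d0.
move=> h; rewrite lt_min => /andP[hd hd'].
apply: (@le_trans _ _ (mu (eball 0 M `&` shifted_diff A h) +
    mu (eball 0 M `&` shifted_diff A' h))%E); last first.
  by rewrite (splitr e) EFinD; apply: leeD; [exact: Hd|exact: Hd'].
apply: (le_trans _ (measureU2 _ _ _)); do ?exact: measurable_ball_shifted_diff.
apply: le_measure; rewrite ?inE.
- by apply: measurable_ball_shifted_diff; exact: measurableU.
- by apply: measurableU; exact: measurable_ball_shifted_diff.
move=> x [Mx]; rewrite /shifted_diff /= => -[[[Ax|Ax] /not_orP[nA nA']]|[[Ax|Ax] /not_orP[nA nA']]].
- by left; split => //; left.
- by right; split => //; left.
- by left; split => //; right.
- by right; split => //; right.
Qed.

Lemma measure_tail_small A (F : (set 'rV[R]_n)^nat) M e : 0 < e ->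
  (forall k, measurable (F k)) -> (forall k l, (k <= l)%N -> F k `<=` F l) ->
  measurable A -> A `<=` \bigcup_k F k ->
  exists k, (mu (eball 0 M `&` (A `\` F k)) <= e%:E)%E.
Proof.
move=> e0 mF ndF mA AF.
pose D k := eball 0 M `&` (A `\` F k).
have mD k : measurable (D k).
  by apply: measurableI; [exact: measurable_eball|exact: measurableD].
have D0 : (mu (D 0%N) < +oo)%E.
  apply: le_lt_trans (@lebesgue_rV_eball_fin R n 0 M).
  by apply: le_measure; rewrite ?inE; [exact: mD|exact: measurable_eball|move=> x []].
have cv : mu \o D @ \oo --> mu (\bigcap_k D k).
  apply: nonincreasing_cvg_mu => //; first exact: bigcapT_measurable.
  apply/nonincreasing_seqP => k; apply/subsetPset => x [Mx [Ax nF]]; split => //; split => //.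
  by apply: contra_not nF; exact: ndF.
move: cv; rewrite (_ : \bigcap_k D k = set0); last first.
  apply/seteqP; split => x // H; have [_ [Ax _]] := H 0%N I.
  by have [k _ Fk] := AF x Ax; have [_ [_ /(_ Fk)]] := H k I.
rewrite measure0 => /fine_cvgP[+ cv].
move=> [k1 _ fin]; have [k2 _ sm] : \forall k \near \oo, fine (mu (D k)) < e.
  by near=> k; near: k; exact: cvgr_lt cv _ e0.
exists (maxn k1 k2); rewrite -[X in (X <= _)%E]fineK; last by apply: fin => /=; exact: leq_maxl.
by rewrite lee_fin ltW//; apply: sm => /=; exact: leq_maxr.
Unshelve. all: by end_near. Qed.

Lemma shift_continuous_bigsetU (F : (set 'rV[R]_n)^nat) k :
  (forall i, shift_continuous (F i)) -> shift_continuous (\big[setU/set0]_(i < k) F i).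
Proof.
move=> HF; elim: k => [|k IH]; first by rewrite big_ord0; exact: shift_continuous0.
by rewrite big_ord_recr/=; exact: shift_continuousU.
Qed.

(** On a bounded set all but a small part of the union is covered by finitely many of the sets; the
    exceptional part enters twice, at [x] and at [x + h]. *)
Lemma shift_continuous_bigcup (F : (set 'rV[R]_n)^nat) :
  (forall i, shift_continuous (F i)) -> shift_continuous (\bigcup_i F i).
Proof.
move=> HF; have mF i : measurable (F i) by have [] := HF i.
have mU : measurable (\bigcup_i F i) by exact: bigcupT_measurable.
split => // M e e0; have e3 : 0 < e / 3 by rewrite divr_gt0.
pose G k := \big[setU/set0]_(i < k) F i.
have mG k : measurable (G k) by exact: bigsetU_measurable.
have ndG k l : (k <= l)%N -> G k `<=` G l.
  by move=> kl; apply: subset_bigsetU.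
have UG : \bigcup_i F i `<=` \bigcup_k G k.
  by move=> x [i _ Fi]; exists i.+1 => //; rewrite /G -bigcup_mkord; exists i => /=.
have [k Hk] := measure_tail_small (M + 1) e3 mG ndG mU UG.
have [_ HG] := shift_continuous_bigsetU k HF.
have [d d0 Hd] := HG M _ e3.
exists (Num.min d 1); first by rewrite lt_min d0 ltr01.
move=> h; rewrite lt_min => /andP[hd h1].
have mGk := measurable_ball_shifted_diff M h (mG k).
pose T := eball 0 (M + 1) `&` (\bigcup_i F i `\` G k).
have mT : measurable T by apply: measurableI; [exact: measurable_eball|exact: measurableD].
have mTh := measurable_shift h mT.
apply: (@le_trans _ _ (mu (eball 0 M `&` shifted_diff (G k) h) + mu T + mu T)%E); last first.
  have -> : e = e / 3 + e / 3 + e / 3 by field.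
  by rewrite !EFinD; apply: leeD => //; apply: leeD => //; exact: Hd.
have ET : mu ((fun x => x + h) @^-1` T) = mu T := lebesgue_rV_translation h mT.
pose S : set 'rV[R]_n :=
  (eball 0 M `&` shifted_diff (G k) h `|` T) `|` ((fun x : 'rV[R]_n => x + h) @^-1` T).
apply: (@le_trans _ _ (mu S)).
  apply: le_measure; rewrite ?inE.
  - exact: measurable_ball_shifted_diff.
  - by apply: measurableU => //; exact: measurableU.
  have Gsub x : G k x -> (\bigcup_i F i) x.
    rewrite /G -bigcup_mkord => -[i _ Fi]; by exists i.
  move=> x [Mx] [[Ux nUx]|[Ux nUx]].
  - have [Gx|nGx] := pselect (G k x).
      left; left; split => //; left; split => //= /Gsub; exact: nUx.
    left; right; split => //; move: Mx; rewrite /eball/= !subr0 => Mx.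
    by rewrite (lt_le_trans Mx)// lerDl.
  - have [Gx|nGx] := pselect (G k (x + h)).
      left; left; split => //; right; split => //= /Gsub; exact: nUx.
    right; split => //=; move: Mx; rewrite /eball/= !subr0 => Mx.
    by rewrite (le_lt_trans (enorm_triangle _ _))// ltrD.
apply: (le_trans (measureU2 mu (measurableU _ _ mGk mT) mTh)); apply: leeD; first exact: measureU2.
by move: ET => /= ->.
Qed.

(** A point that crosses the boundary under the shift by [h] lies in the slab of width [|h|] around
    it, and these slabs shrink to a null set. *)
Lemma shift_continuous_halfspace (i : 'I_n) (c : R) :
  shift_continuous [set x : 'rV[R]_n | c < x ord0 i].
Proof.
have mi := @measurable_coord R n i.
have mc : measurable [set x : 'rV[R]_n | c < x ord0 i].
  rewrite [X in measurable X](_ : _ = (fun x : 'rV[R]_n => x ord0 i) @^-1` `]c, +oo[%classic).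
    by rewrite -[X in measurable X]setTI; exact: mi.
  by apply/seteqP; split => x /=; rewrite in_itv/= andbT.
split => // M e e0.
pose F (k : nat) := [set x : 'rV[R]_n | k.+1%:R^-1 < `|x ord0 i - c|].
have mF k : measurable (F k).
  have mn : measurable_fun setT (fun x : 'rV[R]_n => `|x ord0 i - c|).
    apply: (@measurableT_comp _ _ _ _ _ _ (@Num.norm _ R)) => //.
    exact: measurable_funB.
  rewrite (_ : F k = (fun x : 'rV[R]_n => `|x ord0 i - c|) @^-1` `]k.+1%:R^-1, +oo[%classic).
    by rewrite -[X in measurable X]setTI; exact: mn.
  by apply/seteqP; split => x /=; rewrite in_itv/= andbT.
pose A := [set x : 'rV[R]_n | x ord0 i != c].
have mA : measurable A.
  rewrite (_ : A = ~` ((fun x : 'rV[R]_n => x ord0 i) @^-1` [set c])); last first.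
    by apply/seteqP; split => x /= /eqP.
  by apply: measurableC; rewrite -[X in measurable X]setTI; exact: mi.
have H0 : mu (~` A) = 0%E.
  pose b : 'rV[R]_n := delta_mx ord0 i.
  have b0 : b != 0.
    by apply/eqP => /rowP/(_ i); rewrite !mxE !eqxx => /eqP; rewrite oner_eq0.
  have bE x : dotv x b = x ord0 i.
    rewrite /dotv (bigD1 i)//= mxE !eqxx mulr1 big1 ?addr0// => j ji.
    by rewrite mxE (negbTE ji) andbF mulr0.
  have := lebesgue_rV_hyperplane b0.
  rewrite -(lebesgue_rV_translation (- c *: b) (measurable_hyperplane b)).
  congr (mu _ = _); apply/seteqP; split => x /=; rewrite bE !mxE !eqxx mulr1 => /eqP.
    by rewrite subr_eq0 => xc /negP; apply.
  by case: (eqVneq (x ord0 i) c) => [-> _|//]; rewrite subrr.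
have ndF k l : (k <= l)%N -> F k `<=` F l.
  move=> kl x; rewrite /F/=; apply: le_lt_trans.
  by rewrite lef_pV2 ?posrE// ler_nat.
have UF : A `<=` \bigcup_k F k.
  move=> x; rewrite /A/= -subr_eq0 -normr_gt0 => xc.
  exists (Num.bound `|x ord0 i - c|^-1) => //; rewrite /F/= invf_plt ?posrE//.
  apply: lt_trans (archi_boundP _) _; first by rewrite invr_ge0.
  by rewrite ltr_nat.
have [k Hk] := measure_tail_small M e0 mF ndF mA UF.
exists k.+1%:R^-1; first by rewrite invr_gt0.
move=> h hk; apply: le_trans Hk.
rewrite -[leRHS]adde0 -H0.
have mC := measurableC mA.
have mMF : measurable (eball 0 M `&` (A `\` F k)).
  by apply: measurableI; [exact: measurable_eball|exact: measurableD].
apply: (le_trans _ (measureU2 mu mMF mC)).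
apply: le_measure; rewrite ?inE; first exact: measurable_ball_shifted_diff.
  exact: measurableU.
move=> x [Mx xh]; have [xA|xA] := pselect (A x); last by right.
left; split => //; split => //; rewrite /F/= => Fx.
have hi := le_lt_trans (coord_le_enorm h i) hk.
suff H : `|x ord0 i - c| <= `|h ord0 i| by move: (lt_le_trans (lt_trans hi Fx) H); rewrite ltxx.
have [h1 h2] := (ler_norm (h ord0 i), ler_norm (- h ord0 i)); rewrite normrN in h2.
move: xh; rewrite /shifted_diff/= !mxE => -[[x1 /negP x2]|[x1 /negP x2]];
  rewrite -leNgt in x2; rewrite ler_norml; apply/andP; split; lra.
Qed.

End translation_continuity.

Section translation_continuity_of_sets.
Context {R : realType} {n : nat}.
Local Notation mu := (@lebesgue_rV R n).
Lemma shift_continuous_coord (i : 'I_n) (Y : set R) : measurable Y ->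
  shift_continuous [set x : 'rV[R]_n | Y (x ord0 i)].
Proof.
have -> : measurable Y = (@RGenOInfty.G R).-sigma.-measurable Y.
  by rewrite -RGenOInfty.measurableE.
move: Y.
apply: (@smallest_sub _ (sigma_algebra setT) (@RGenOInfty.G R) (fun Y : set R => shift_continuous [set x : 'rV[R]_n | Y (x ord0 i)])).
  split.
  - exact: shift_continuous0.
  - by move=> Y /shift_continuousC; rewrite setTD.
  - by move=> F /shift_continuous_bigcup; rewrite /bigcup.
move=> _ [c ->]; rewrite (_ : mkset _ = [set x : 'rV[R]_n | c < x ord0 i]).
  exact: shift_continuous_halfspace.
by apply/seteqP; split => x /=; rewrite in_itv/= andbT.
Qed.

(** Translation acts continuously on indicators in the [L1] norm of a ball. The sets with this
    property form a sigma-algebra, and half-spaces have it because a point where a small shift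
    crosses the boundary is close to the boundary. *)
Lemma measurable_shift_continuous (A : set 'rV[R]_n) : measurable A -> shift_continuous A.
Proof.
move: A; apply: (@smallest_sub _ (sigma_algebra setT) _ (@shift_continuous R n)).
  split; [exact: shift_continuous0|by move=> Y /shift_continuousC; rewrite setTD|].
  by move=> F; exact: shift_continuous_bigcup.
move=> A /=; rewrite -bigcup_seq => -[i _ [Y mY <-]]; rewrite setTI.
exact: shift_continuous_coord.
Qed.
End translation_continuity_of_sets.

Section modulus.
Context {R : realType} {n : nat}.
Local Notation mu := (@lebesgue_rV R n).

Variable f : 'rV[R]_n -> R.
Hypotheses (mf : measurable_fun setT f) (f01 : forall x, 0 <= f x <= 1).

Let level (m j : nat) : set 'rV[R]_n := [set x | j%:R / m.+1%:R < f x].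

Let measurable_level m j : measurable (level m j).
Proof.
rewrite (_ : level m j = f @^-1` `]j%:R / m.+1%:R, +oo[%classic).
  by rewrite -[X in measurable X]setTI; exact: mf.
by apply/seteqP; split => x /=; rewrite in_itv/= andbT.
Qed.

Let level_gap m x y : f x + m.+1%:R^-1 < f y ->
  exists2 j, (j < m.+1)%N & ~ level m j x /\ level m j y.
Proof.
move=> xy; have m0 : 0 < m.+1%:R :> R by rewrite ltr0n.
have /andP[fx0 _] := f01 x; have /andP[_ fy1] := f01 y.
have xm : 0 <= f x * m.+1%:R by rewrite mulr_ge0// ltW.
have /andP[t1 t2] := truncn_itv xm.
set j := (Num.truncn (f x * m.+1%:R)).+1 in t2.
have jy : j%:R / m.+1%:R < f y.
  apply: le_lt_trans xy; rewrite /j -natr1 mulrDl mul1r lerD2r.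
  by rewrite ler_pdivrMr.
exists j; last first.
  split => //; rewrite /level/=; apply/negP; rewrite -leNgt.
  by rewrite ler_pdivlMr// ltW.
move: (lt_le_trans jy fy1); rewrite ltr_pdivrMr// mul1r ltr_nat; exact.
Qed.

Let shift_le_levels m (h x : 'rV[R]_n) : `|f (x + h) - f x| <=
  m.+1%:R^-1 + \sum_(j < m.+1) \1_(shifted_diff (level m j) h) x.
Proof.
have i0 (A : set 'rV[R]_n) : 0 <= \1_A x :> R by rewrite indicE.
have S0 : 0 <= \sum_(j < m.+1) \1_(shifted_diff (level m j) h) x :> R by apply: sumr_ge0.
have [le1|gt1] := leP `|f (x + h) - f x| m.+1%:R^-1; first by rewrite (le_trans le1)// lerDl.
have /andP[a0 a1] := f01 x; have /andP[b0 b1] := f01 (x + h).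
suff [j jm xj] : exists2 j, (j < m.+1)%N & shifted_diff (level m j) h x.
  apply: (@le_trans _ _ 1); first by rewrite ler_norml; apply/andP; split; lra.
  apply: (@le_trans _ _ (\sum_(j < m.+1) \1_(shifted_diff (level m j) h) x)); last by rewrite lerDr.
  rewrite (bigD1 (Ordinal jm))//= indicE mem_set// lerDl.
  exact: sumr_ge0.
have [xh|xh] := leP (f x) (f (x + h)).
  rewrite ger0_norm ?subr_ge0// in gt1.
  have [|j jm [H1 H2]] := @level_gap m x (x + h); first by rewrite addrC -ltrBrDr.
  by exists j => //; right.
rewrite ler0_norm ?subr_le0 ?ltW// opprB in gt1.
have [|j jm [H1 H2]] := @level_gap m (x + h) x; first by rewrite addrC -ltrBrDr.
by exists j => //; left.
Qed.

Let uniform_scale m M e : 0 < e -> exists2 d, 0 < d & forall h j, enorm h < d -> (j < m)%N ->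
  (mu (eball 0 M `&` shifted_diff (level m.-1 j) h) <= e%:E)%E.
Proof.
move=> e0; move: (m.-1) => l; elim: m => [|m [d d0 Hd]]; first by exists 1.
have [_ /(_ M e e0)[d' d'0 Hd']] := measurable_shift_continuous (measurable_level l m).
exists (Num.min d d'); first by rewrite lt_min d0.
move=> h j; rewrite lt_min => /andP[h1 h2]; rewrite ltnS leq_eqVlt => /orP[/eqP ->|jm].
  exact: Hd'.
exact: Hd.
Qed.

(** A bounded function lies within [1 / m] of a combination of indicators of [m] superlevel sets,
    so the continuity of translations passes from sets to functions. *)
Lemma L1_shift_continuous M e : 0 < e ->
  exists2 d, 0 < d & forall h, enorm h < d ->
    (\int[mu]_x (\1_(eball 0 M) x * `|f (x + h) - f x|)%:E <= e%:E)%E.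
Proof.
move=> e0; pose W := fine (mu (eball 0 M)).
have WE : mu (eball 0 M) = W%:E by rewrite fineK// ge0_fin_numE// lebesgue_rV_eball_fin.
have W0 : 0 <= W by exact: fine_ge0.
pose m := Num.bound (W / (e / 2)).
have e2 : 0 < e / 2 by rewrite divr_gt0.
have m0 : 0 < m.+1%:R :> R by rewrite ltr0n.
have Wm : W / m.+1%:R <= e / 2.
  rewrite ler_pdivrMr// mulrC -ler_pdivrMr//; apply/ltW.
  apply: (lt_trans (archi_boundP _)); first by rewrite divr_ge0// ltW.
  by rewrite ltr_nat.
have em : 0 < e / 2 / m.+1%:R by rewrite divr_gt0.
have [d d0 Hd] := uniform_scale m.+1 M em; exists d => // h hd.
have mE := @measurable_eball R n 0 M.
have mS j := measurable_shifted_diff h (measurable_level m j).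
have mi (A : set 'rV[R]_n) : measurable A ->
    measurable_fun setT (fun x : 'rV[R]_n => (\1_A x)%:E : \bar R).
  by move=> mA; apply/measurable_EFinP; exact: measurable_indic.
have mfh : measurable_fun setT (fun x : 'rV[R]_n => f (x + h)).
  by apply: (measurableT_comp mf); exact: measurable_translation.
apply: (@le_trans _ _ (\int[mu]_x ((m.+1%:R^-1)%:E * (\1_(eball 0 M) x)%:E +
   \sum_(j < m.+1) (\1_(eball 0 M `&` shifted_diff (level m j) h) x)%:E))%E).
  apply: ge0_le_integralT.
  - apply/measurable_EFinP; apply: measurable_funM; first exact: measurable_indic.
    by apply: measurableT_comp => //; exact: measurable_funB.
  - apply: emeasurable_funD; first by apply: emeasurable_funM => //; exact: mi.
    apply: emeasurable_sum => j; apply: mi; exact: measurableI.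
  - by move=> x; rewrite lee_fin mulr_ge0// indicE.
  - move=> x; rewrite sumEFin -EFinM -EFinD lee_fin.
    rewrite [X in _ <= _ + X](_ : _ = \1_(eball 0 M) x * \sum_(j < m.+1) \1_(shifted_diff (level m j) h) x).
      rewrite (mulrC m.+1%:R^-1). rewrite -mulrDr ler_wpM2l// indicE.
    by rewrite mulr_sumr; apply: eq_bigr => j _; rewrite indicI.
have mE1 := mi _ mE.
have i0 (A : set 'rV[R]_n) x : (0 <= (\1_A x : R)%:E)%E by rewrite lee_fin indicE.
have mSE j : measurable (eball 0 M `&` shifted_diff (level m j) h) by exact: measurableI.
have m1 : 0 <= m.+1%:R^-1 :> R by rewrite invr_ge0.
rewrite (ge0_integralD mu measurableT); [|by move=> x _; rewrite mule_ge0| |by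
  move=> x _; exact: sume_ge0|by apply: emeasurable_sum => j; exact: mi]; last first.
  by apply: emeasurable_funM => //; exact: mi.
rewrite (ge0_integralZl_EFin mu measurableT (fun x _ => i0 _ x) mE1 m1).
have -> : (\int[mu]_x (\1_(eball 0 M) x)%:E = W%:E)%E by rewrite integral_indic// setIT -WE.
rewrite (ge0_integral_sum mu measurableT); last 2 first.
- by move=> j; exact: mi.
- by move=> j x _; exact: i0.
rewrite [leRHS](_ : _ = ((e / 2)%:E + \sum_(j < m.+1) (e / 2 / m.+1%:R)%:E)%E); last first.
  rewrite sumEFin sumr_const card_ord -EFinD -[in RHS](mulr_natr (e / 2 / _)) divfK ?gt_eqF//.
  by congr EFin; field.
apply: leeD; first by rewrite -EFinM lee_fin mulrC.
apply: lee_sum => j _; have := Hd h j hd (ltn_ord j).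
by rewrite -[X in mu X]setIT -(integral_indic mu measurableT (mSE j)).
Qed.

End modulus.

(** * Averages over small balls *)

Section ball_averages.
Context {R : realType} {n : nat}.
Local Notation mu := (@lebesgue_rV R n).
Implicit Types (f : 'rV[R]_n -> R) (d : R) (x y z : 'rV[R]_n).

Definition ball_integral f d x : \bar R := (\int[mu]_h (\1_(eball 0 d) h * f (x + h))%:E)%E.

Definition ball_average f d x : R := fine (ball_integral f d x) / fine (mu (eball 0 d)).

Lemma indic_eball_shift d x h : \1_(eball 0 d) h = \1_(eball x d) (x + h) :> R.
Proof.
rewrite !indicE; congr ((nat_of_bool _)%:R); apply/idP/idP => /set_mem H;
  apply/mem_set; move: H; by rewrite /eball/= subr0 addrAC subrr add0r.
Qed.

Lemma ball_integralE f d x : measurable_fun setT f -> (forall z, 0 <= f z) ->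
  ball_integral f d x = (\int[mu]_z (\1_(eball x d) z * f z)%:E)%E.
Proof.
move=> mf f0; rewrite -(integral_translation x (f := fun z => (\1_(eball x d) z * f z)%:E)).
- by apply: eq_integral => h _; rewrite (indic_eball_shift d x) [(h + x)%R]addrC.
- by apply/measurable_EFinP; apply: measurable_funM => //; apply: measurable_indic; exact: measurable_eball.
- by move=> z; rewrite lee_fin mulr_ge0// indicE.
Qed.

Lemma ball_integral_fin f d x : measurable_fun setT f -> (forall z, 0 <= f z <= 1) ->
  (0 <= ball_integral f d x <= mu (eball 0 d))%E.
Proof.
move=> mf f01; have mE := @measurable_eball R n 0 d.
have H z : 0 <= \1_(eball 0 d) z * f (x + z) :> R.
  by have /andP[f0 _] := f01 (x + z); rewrite mulr_ge0// indicE.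
rewrite integral_ge0/=; last by move=> h _; rewrite lee_fin.
rewrite -[in leRHS](setIT (eball 0 d)) -(integral_indic mu measurableT mE).
apply: ge0_le_integralT.
- apply/measurable_EFinP; apply: measurable_funM => //.
    by apply: (measurableT_comp mf); exact: measurable_fun_rVD.
- by apply/measurable_EFinP; exact: measurable_indic.
- by move=> h; rewrite lee_fin.
by move=> h; rewrite lee_fin -[leRHS]mulr1 ler_wpM2l ?indicE//; case/andP: (f01 (x + h)).
Qed.

Lemma fin_eball d : mu (eball 0 d) \is a fin_num.
Proof. by rewrite ge0_fin_numE// lebesgue_rV_eball_fin. Qed.

Lemma ball_integralK f d x : measurable_fun setT f -> (forall z, 0 <= f z <= 1) ->
  (fine (ball_integral f d x))%:E = ball_integral f d x.
Proof.
move=> mf f01; have /andP[i0 i1] := ball_integral_fin d x mf f01.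
by rewrite fineK// ge0_fin_numE// (le_lt_trans i1)// lebesgue_rV_eball_fin.
Qed.

Lemma ball_average01 f d x : measurable_fun setT f -> (forall z, 0 <= f z <= 1) ->
  0 <= ball_average f d x <= 1.
Proof.
move=> mf f01; have /andP[i0 i1] := ball_integral_fin d x mf f01.
have v0 : 0 <= fine (mu (eball 0 d)) by exact: fine_ge0.
rewrite /ball_average divr_ge0 ?fine_ge0//=; move: v0; rewrite le_eqVlt => /predU1P[<-|v0].
  by rewrite invr0 mulr0 ler01.
rewrite ler_pdivrMr// mul1r -lee_fin (ball_integralK d x mf f01).
by rewrite (fineK (fin_eball d)).
Qed.

Lemma measurable_ball_average f d : measurable_fun setT f -> (forall z, 0 <= f z) ->
  measurable_fun setT (ball_average f d).
Proof.
move=> mf f0; apply: measurable_funM => //.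
apply: (measurableT_comp (fine_measurable measurableT)).
apply: (measurable_integral2 (f := fun x h => (\1_(eball 0 d) h * f (x + h))%:E)).
  apply/measurable_EFinP; apply: measurable_funM => /=.
    apply: (measurableT_comp (f := \1_(eball 0 d) : _ -> R)) => //.
    by apply: measurable_indic; exact: measurable_eball.
  by apply: (measurableT_comp mf); exact: measurable_fun_rVD.
by move=> x h; rewrite lee_fin mulr_ge0// indicE.
Qed.

Lemma ball_integral_mirror f d x y : measurable_fun setT f -> (forall z, 0 <= f z) ->
  enorm x = enorm y -> x != y -> (forall z, 0 <= tilt (x - y) f z) ->
  (ball_integral f d y <= ball_integral f d x)%E.
Proof.
move=> mf f0 xy nxy tf; rewrite (ball_integralE d y mf f0) (ball_integralE d x mf f0).
pose a := x - y; have sx : refl a x = y by exact: refl_swap.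
have a0 : dotv a a != 0 by rewrite dotvv_eq0 subr_eq0.
have mb c : measurable_fun setT (fun z => \1_(eball c d) z * f z : R).
  by apply: measurable_funM => //; apply: measurable_indic; exact: measurable_eball.
apply: (@ge0_le_integral_mirror R n a) => //.
- by move=> z; rewrite mulr_ge0// indicE.
- by move=> z; rewrite mulr_ge0// indicE.
move=> z.
have Ey w : \1_(eball y d) (refl a w) = \1_(eball x d) w :> R.
  rewrite !indicE; congr ((nat_of_bool _)%:R); apply/idP/idP => /set_mem H;
  apply/mem_set; move: H; by rewrite /eball/= enorm_reflB -sx reflK.
have Ex : \1_(eball x d) (refl a z) = \1_(eball y d) z :> R.
  by rewrite -[in LHS]Ey reflK.
rewrite Ey Ex.
rewrite -subr_ge0 (_ : _ - _ =
  (\1_(eball x d) z - \1_(eball y d) z) * (f z - f (refl a z))); last by ring.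
have dist := enorm_reflB_diff z x a0; rewrite sx in dist.
have xa : dotv x a = dotv a a / 2.
  have nn : dotv x x = dotv y y by rewrite -!sqr_enorm xy.
  rewrite /a !(dotvDl, dotvDr, dotvNl, dotvNr) nn (dotvC y x); lra.
have {}dist : enorm (z - y) ^+ 2 - enorm (z - x) ^+ 2 = 2 * dotv z a.
  by rewrite dist xa; field.
have sub u v : enorm (z - u) ^+ 2 <= enorm (z - v) ^+ 2 ->
    \1_(eball v d) z <= \1_(eball u d) z :> R.
  rewrite ler_sqr ?nnegrE ?enorm_ge0// => uv; rewrite !indicE ler_nat.
  have [zv|_] := boolP (z \in eball v d); last by [].
  by rewrite mem_set//; exact: le_lt_trans uv (set_mem zv).
have tz := tf z; rewrite /tilt -/a in tz.
have [za|za|za] := ltgtP (dotv z a) 0; last by rewrite refl_fix// subrr mulr0.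
- apply: mulr_le0; first by rewrite subr_le0; apply: sub; lra.
  by rewrite nmulr_rge0 in tz.
- apply: mulr_ge0; first by rewrite subr_ge0; apply: sub; lra.
  by rewrite pmulr_rge0 in tz.
Qed.

(** The monotonicity in the direction of [beta] is only known almost everywhere for [f]; averaging
    over balls turns it into a pointwise property, because the ball about [x] is the mirror image
    of the ball about [y]. *)
Lemma ball_average_mirror f d x y : measurable_fun setT f -> (forall z, 0 <= f z <= 1) ->
  enorm x = enorm y -> x != y -> {ae mu, forall z, 0 <= tilt (x - y) f z} ->
  ball_average f d y <= ball_average f d x.
Proof.
move=> mf f01 xy nxy tf.
have f0 z : 0 <= f z by case/andP: (f01 z).
have fE : {ae mu, forall z, polarize (x - y) f z = f z}.
  by apply: filterS tf => z tz; rewrite /polarize ltNge tz.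
have mp := measurable_polarize (x - y) mf.
have p0 z : 0 <= polarize (x - y) f z by rewrite /polarize; case: ifP.
have IE w : ball_integral f d w = ball_integral (polarize (x - y) f) d w.
  rewrite (ball_integralE d w mf f0) (ball_integralE d w mp p0); apply: ge0_ae_eq_integral => //.
  - apply/measurable_EFinP; apply: measurable_funM => //; apply: measurable_indic; exact: measurable_eball.
  - apply/measurable_EFinP; apply: measurable_funM => //; apply: measurable_indic; exact: measurable_eball.
  - by move=> z _; rewrite lee_fin mulr_ge0// indicE.
  - by move=> z _; rewrite lee_fin mulr_ge0// indicE.
  by apply: filterS fE => z ->.
rewrite /ball_average ler_wpM2r ?invr_ge0 ?fine_ge0//.
rewrite -lee_fin !ball_integralK// !IE; apply: ball_integral_mirror => // z.
exact: tilt_polarize_ge0.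
Qed.

Lemma ball_average_error f d x : measurable_fun setT f -> (forall z, 0 <= f z <= 1) -> 0 < d ->
  ((fine (mu (eball 0 d)) * `|ball_average f d x - f x|)%:E <=
   \int[mu]_h (\1_(eball 0 d) h * `|f (x + h) - f x|)%:E)%E.
Proof.
move=> mf f01 d0; set v := fine _.
have f0 z : 0 <= f z by case/andP: (f01 z).
have vE : mu (eball 0 d) = v%:E by rewrite fineK// fin_eball.
have v0 : 0 < v by rewrite -lte_fin -vE lebesgue_rV_eball_gt0.
have mE := @measurable_eball R n 0 d.
have mfx : measurable_fun setT (fun h : 'rV[R]_n => f (x + h)).
  by apply: (measurableT_comp mf); exact: measurable_fun_rVD.
have m1 : measurable_fun setT (\1_(eball 0 d) : 'rV[R]_n -> R) by exact: measurable_indic.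
have mI : measurable_fun setT (fun h : 'rV[R]_n => (\1_(eball 0 d) h * f (x + h))%:E).
  by apply/measurable_EFinP; exact: measurable_funM.
have mD : measurable_fun setT (fun h : 'rV[R]_n => (\1_(eball 0 d) h * `|f (x + h) - f x|)%:E).
  apply/measurable_EFinP; apply: measurable_funM => //.
  by apply: measurableT_comp => //; exact: measurable_funB.
have mC : measurable_fun setT (fun h : 'rV[R]_n => (\1_(eball 0 d) h * f x)%:E).
  by apply/measurable_EFinP; exact: measurable_funM.
have i0 h : 0 <= \1_(eball 0 d) h :> R by rewrite indicE.
have I0 h : (0 <= (\1_(eball 0 d) h * f (x + h))%:E)%E by rewrite lee_fin mulr_ge0.
have D0 h : (0 <= (\1_(eball 0 d) h * `|f (x + h) - f x|)%:E)%E by rewrite lee_fin mulr_ge0.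
have C0 h : (0 <= (\1_(eball 0 d) h * f x)%:E)%E by rewrite lee_fin mulr_ge0.
have IC : (\int[mu]_h (\1_(eball 0 d) h * f x)%:E = (v * f x)%:E)%E.
  under eq_integral do rewrite mulrC EFinM.
  rewrite (ge0_integralZl_EFin mu measurableT _ _ (f0 x)); last 2 first.
  - by move=> h _; rewrite lee_fin.
  - exact/measurable_EFinP.
  by rewrite [in RHS]mulrC EFinM -vE -[in RHS](setIT (eball 0 d)) -(integral_indic mu measurableT mE).
have le1 : (ball_integral f d x <=
    \int[mu]_h (\1_(eball 0 d) h * f x)%:E +
    \int[mu]_h (\1_(eball 0 d) h * `|f (x + h) - f x|)%:E)%E.
  rewrite -ge0_integralD//; apply: ge0_le_integralT => //; first exact: emeasurable_funD.
  move=> h; rewrite -EFinD lee_fin -mulrDr ler_wpM2l//.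
  by have := ler_norm (f (x + h) - f x); lra.
have le2 : (\int[mu]_h (\1_(eball 0 d) h * f x)%:E <= ball_integral f d x +
    \int[mu]_h (\1_(eball 0 d) h * `|f (x + h) - f x|)%:E)%E.
  rewrite -ge0_integralD//; apply: ge0_le_integralT => //; first exact: emeasurable_funD.
  move=> h; rewrite -EFinD lee_fin -mulrDr ler_wpM2l//.
  by have := ler_norm (- (f (x + h) - f x)); rewrite normrN; lra.
move: le1 le2; rewrite IC -(ball_integralK d x mf f01).
case: (\int[mu]_h _)%E => [D| |]//; last by move=> *; rewrite leey.
rewrite -!EFinD !lee_fin => le1 le2.
rewrite -[X in X * _](gtr0_norm v0) -normrM mulrBr /ball_average mulrC divfK ?gt_eqF//.
by rewrite ler_norml; apply/andP; split; lra.
Qed.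

End ball_averages.

Section limsup.
Context {R : realType}.

Lemma limn_esup_mono (u v : nat -> \bar R) : (forall k, (u k <= v k)%E) ->
  (limn_esup u <= limn_esup v)%E.
Proof.
move=> uv; rewrite !limn_esup_lim; apply: lee_lim; try exact: is_cvg_esups.
apply: nearW => m; apply: ge_ereal_sup => _ [k /= mk <-].
by apply: (le_trans (uv k)); apply: ereal_sup_ubound; exists k.
Qed.

Lemma limn_esup_cst (c : \bar R) : limn_esup (fun _ => c) = c.
Proof.
by rewrite is_cvg_limn_esupE; [exact: lim_cst|exact: is_cvg_cst].
Qed.

Lemma limn_esup_geometric (u : nat -> R) (l C : R) :
  (forall k, 2 ^+ k * `|u k - l| <= C) -> limn_esup (fun k => (u k)%:E) = l%:E.
Proof.
move=> H; have cv : (fun k => (u k)%:E) @ \oo --> l%:E.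
  apply: cvg_EFin; first exact: nearW.
  have cg : (fun k => l + geometric C 2^-1 k) @ \oo --> l.
    rewrite -[X in _ --> X]addr0; apply: cvgD; first exact: cvg_cst.
    by apply: cvg_geometric; rewrite ger0_norm//; lra.
  have cg' : (fun k => l - geometric C 2^-1 k) @ \oo --> l.
    rewrite -[X in _ --> X]subr0; apply: cvgB; first exact: cvg_cst.
    by apply: cvg_geometric; rewrite ger0_norm//; lra.
  apply: (squeeze_cvgr _ cg' cg); apply: nearW => k /=.
  rewrite -ler_distl exprVn ler_pdivlMr ?exprn_gt0//.
  by rewrite mulrC.
by rewrite is_cvg_limn_esupE; [exact: cvg_lim cv|apply/cvg_ex; exists l%:E].
Qed.
End limsup.

Section representative.
Context {R : realType} {n : nat}.
Local Notation mu := (@lebesgue_rV R n).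
Variables (f : 'rV[R]_n -> R) (M : R).
Hypotheses (mf : measurable_fun setT f) (f01 : forall x, 0 <= f x <= 1).

(** By Tonelli's theorem the mean error is at most the average over small [h] of the mean distance
    between [f] and its translate by [h]. *)
Lemma ball_average_L1 e : 0 < e -> exists2 d, 0 < d &
  (\int[mu]_x (\1_(eball 0 M) x * `|ball_average f d x - f x|)%:E <= e%:E)%E.
Proof.
move=> e0; have [d d0 Hd] := L1_shift_continuous mf f01 M e0; exists d => //.
have f0 z : 0 <= f z by case/andP: (f01 z).
have mA := measurable_ball_average d mf f0.
pose v := fine (mu (eball 0 d)).
have vE : mu (eball 0 d) = v%:E by rewrite fineK// fin_eball.
have v0 : 0 < v by rewrite -lte_fin -vE lebesgue_rV_eball_gt0.
have mind c : measurable_fun setT (\1_(eball 0 c) : 'rV[R]_n -> R).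
  by apply: measurable_indic; exact: measurable_eball.
have i0 (c : R) (h : 'rV[R]_n) : 0 <= \1_(eball 0 c) h :> R by rewrite indicE.
pose K x h := (\1_(eball 0 M) x * (\1_(eball 0 d) h * `|f (x + h) - f x|))%:E : \bar R.
have K0 x h : (0 <= K x h)%E by rewrite lee_fin !mulr_ge0.
have mK : measurable_fun setT (fun z : 'rV[R]_n * 'rV[R]_n => K z.1 z.2).
  apply/measurable_EFinP; apply: measurable_funM.
    by apply: (measurableT_comp (mind M)).
  apply: measurable_funM; first by apply: (measurableT_comp (mind d)).
  apply: measurableT_comp => //; apply: measurable_funB.
    by apply: (measurableT_comp mf); exact: measurable_fun_rVD.
  exact: (measurableT_comp mf).
have mG : measurable_fun setT (fun x : 'rV[R]_n => (\1_(eball 0 M) x * `|ball_average f d x - f x|)%:E).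
  apply/measurable_EFinP; apply: measurable_funM => //.
  by apply: measurableT_comp => //; exact: measurable_funB.
have G0 x : (0 <= (\1_(eball 0 M) x * `|ball_average f d x - f x|)%:E)%E.
  by rewrite lee_fin mulr_ge0.
have mKx x : measurable_fun setT (K x).
  exact: (measurableT_comp mK (@measurable_pair1 _ _ _ _ x)).
rewrite -(@lee_pmul2l _ v%:E)// -(ge0_integralZl_EFin mu measurableT (fun x _ => G0 x) mG (ltW v0)).
apply: (@le_trans _ _ (\int[mu]_x \int[mu]_h K x h)%E).
  apply: ge0_le_integralT.
  - by apply: emeasurable_funM.
  - exact: measurable_integral2.
  - by move=> x; rewrite mule_ge0// lee_fin ltW.
  move=> x; rewrite /K.
  have mI : measurable_fun setT (fun h : 'rV[R]_n => (\1_(eball 0 d) h * `|f (x + h) - f x|)%:E).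
    apply/measurable_EFinP; apply: measurable_funM => //.
    apply: measurableT_comp => //; apply: measurable_funB => //.
    by apply: (measurableT_comp mf); exact: measurable_fun_rVD.
  under [leRHS]eq_integral do rewrite EFinM.
  rewrite (ge0_integralZl_EFin mu measurableT _ mI (i0 _ x)); last first.
    by move=> h _; rewrite lee_fin mulr_ge0.
  rewrite -EFinM mulrCA EFinM; apply: lee_wpmul2l; first by rewrite lee_fin.
  exact: ball_average_error.
rewrite integral_swap//.
apply: (@le_trans _ _ (\int[mu]_h (e * \1_(eball 0 d) h)%:E)%E).
  apply: ge0_le_integralT.
  - apply: (measurable_integral2 (f := fun h x => K x h)) => //.
    exact: (measurableT_comp mK (@measurable_swap _ _ 'rV[R]_n 'rV[R]_n)).
  - by apply/measurable_EFinP; apply: measurable_funM.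
  - by move=> h; apply: integral_ge0.
  move=> h; have hE : \1_(eball 0 d) h = (h \in eball 0 d)%:R :> R by rewrite indicE.
  move: hE; have [hd hE|hd hE] := boolP (h \in eball 0 d); last first.
    rewrite hE mulr0 /K; under eq_integral do rewrite hE mul0r mulr0.
    by rewrite integral0.
  rewrite hE mulr1 /K; under eq_integral do rewrite hE mul1r.
  by apply: Hd; move: (set_mem hd); rewrite /eball/= subr0.
under eq_integral do rewrite EFinM.
rewrite (ge0_integralZl_EFin mu measurableT _ _ (ltW e0)); last 2 first.
- by move=> h _; rewrite lee_fin.
- exact/measurable_EFinP.
have -> : (\int[mu]_h (\1_(eball 0 d) h)%:E = v%:E)%E.
  by rewrite -vE -[in RHS](setIT (eball 0 d)) -(integral_indic mu measurableT (measurable_eball 0 d)).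
by rewrite muleC.
Qed.

(** Averages over suitably small balls converge to [f] almost everywhere. Their upper limit exists at
    every point, and it inherits the pointwise monotonicity of the averages. *)
Lemma radial_representative (beta : 'rV[R]_n) :
  (forall a, a != 0 -> 0 <= dotv a beta -> {ae mu, forall z, 0 <= tilt a f z}) ->
  exists F : 'rV[R]_n -> R, [/\ measurable_fun setT F, forall x, 0 <= F x <= 1,
    {ae mu, forall x, eball 0 M x -> F x = f x} &
    forall x y, enorm x = enorm y -> dotv y beta <= dotv x beta -> F y <= F x].
Proof.
move=> Hf.
have f0 z : 0 <= f z by case/andP: (f01 z).
(* Errors [4^-k] stay summable after multiplication by [2^k]. *)
have /choice[d Hd] : forall k : nat, exists d, 0 < d /\
  (\int[mu]_x (\1_(eball 0 M) x * `|ball_average f d x - f x|)%:E <= ((4^-1) ^+ k)%:E)%E.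
  move=> k; have [|d d0 Hd] := @ball_average_L1 ((4^-1) ^+ k); first by rewrite exprn_gt0.
  by exists d.
pose u k x := ball_average f (d k) x.
have u01 k x : 0 <= u k x <= 1 by exact: ball_average01.
have mu_ k : measurable_fun setT (u k) by exact: measurable_ball_average.
have L01 x : (0 <= limn_esup (fun k => (u k x)%:E) <= 1)%E.
  rewrite -[X in (X <= _ <= _)%E](@limn_esup_cst R) -[X in (_ <= _ <= X)%E](@limn_esup_cst R).
  by apply/andP; split; apply: limn_esup_mono => k; rewrite lee_fin; case/andP: (u01 k x).
pose F x := fine (limn_esup (fun k => (u k x)%:E)).
have FE x : (F x)%:E = limn_esup (fun k => (u k x)%:E).
  have /andP[l0 l1] := L01 x; rewrite fineK// ge0_fin_numE//.
  by apply: le_lt_trans l1 _; rewrite ltry.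
have mF : measurable_fun setT F.
  apply: (measurableT_comp (fine_measurable measurableT)).
  by apply: measurable_fun_limn_esup => k; exact/measurable_EFinP.
clearbody F; exists F; split; first exact: mF.
- by move=> x; rewrite -!lee_fin FE.
- pose G k (x : 'rV[R]_n) : \bar R := (2 ^+ k * (\1_(eball 0 M) x * `|u k x - f x|))%:E.
  have G0 k x : (0 <= G k x)%E by rewrite lee_fin !mulr_ge0// indicE.
  have mg k : measurable_fun setT (fun x : 'rV[R]_n => (\1_(eball 0 M) x * `|u k x - f x|)%:E).
    apply/measurable_EFinP; apply: measurable_funM; first exact: measurable_indic (measurable_eball _ _).
    by apply: measurableT_comp => //; exact: measurable_funB.
  have mG k : measurable_fun setT (G k).
    by apply/measurable_EFinP; apply: measurable_funM => //; move/measurable_EFinP: (mg k).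
  have IG : (\int[mu]_x (\sum_(0 <= k <oo) G k x) < +oo)%E.
    rewrite integral_nneseries//.
    apply: (@le_lt_trans _ _ (1 / (1 - 2^-1))%:E); last by rewrite ltry.
    apply: (le_trans _ (@nneseries_geometric_le R 1 2^-1 _ _)) => //; last by apply/andP; split; lra.
    apply: lee_nneseries => [k _ _|k _]; first by apply: integral_ge0 => x _; exact: G0.
    rewrite /G; under eq_integral do rewrite EFinM.
    have g0 x : setT x -> (0 <= (\1_(eball 0 M) x * `|u k x - f x|)%:E)%E.
      by rewrite lee_fin mulr_ge0// indicE.
    have p0 : 0 <= 2 ^+ k :> R by rewrite exprn_ge0.
    rewrite (ge0_integralZl_EFin mu measurableT g0 (mg k) p0).
    have [_ Hk] := Hd k; rewrite mul1r.
    rewrite (_ : 2^-1 ^+ k = 2 ^+ k * 4^-1 ^+ k); last by rewrite -exprMn; congr (_ ^+ _); field.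
    by rewrite EFinM; apply: lee_wpmul2l.
  have mS : measurable_fun setT (fun x => \sum_(0 <= k <oo) G k x)%E.
    by apply: ge0_emeasurable_sum.
  have S0 x : (0 <= \sum_(0 <= k <oo) G k x)%E by apply: nneseries_ge0.
  have : mu.-integrable setT (fun x => \sum_(0 <= k <oo) G k x)%E.
    apply/integrableP; split => //.
    by under eq_integral do rewrite gee0_abs//.
  move=> /(integrable_ae measurableT); apply: filterS => x /(_ I) fS xM.
  apply: EFin_inj; rewrite FE; apply: (@limn_esup_geometric R _ _ (fine (\sum_(0 <= k <oo) G k x)%E)) => k.
  rewrite -lee_fin fineK//; have := nneseries_ge_term (u := fun k => G k x) k (fun i => G0 i x).
  by rewrite /G indicE mem_set// mul1r.
- move=> x y xy bxy.
  suff : ((F y)%:E <= (F x)%:E)%E by rewrite lee_fin.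
  rewrite (FE x) (FE y).
  apply: limn_esup_mono => k.
  rewrite lee_fin.
  have [->//|nxy] := eqVneq x y.
  apply: ball_average_mirror => //; apply: Hf; first by rewrite subr_eq0.
  by rewrite dotvDl dotvNl subr_ge0.
Qed.

End representative.

(** * Foliated Schwarz symmetrization *)

Section axis.
Context {R : realType} {n : nat}.
Local Notation mu := (@lebesgue_rV R n).
Implicit Types (beta c x : 'rV[R]_n) (rho tau : R).

Lemma rational_dense x (e : R) : 0 < e ->
  exists p : 'rV[rat]_n, enorm (x - map_mx ratr p) <= e.
Proof.
move=> e0; have d0 : 0 < e / n.+1%:R by rewrite divr_gt0.
have /choice[p Hp] i : exists p : rat, `|x ord0 i - ratr p| <= e / n.+1%:R.
  move: (e / n.+1%:R) d0 => d d0.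
  have /rat_in_itvoo[p] : x ord0 i < x ord0 i + d by rewrite ltrDl.
  rewrite in_itv/= => /andP[p1 p2]; exists p; rewrite ler_norml; apply/andP; split; lra.
exists (\row_i p i); apply: (le_trans (@enorm_le_cube _ _ _ (e / n.+1%:R) _)).
  by move=> i; rewrite !mxE.
rewrite mulrA ler_pdivrMr ?ltr0n// mulrC ler_wpM2l ?(ltW e0)// ler_nat//.
Qed.

Lemma refl_to_axis beta x : enorm beta = 1 ->
  refl (enorm x *: beta - x) x = enorm x *: beta.
Proof.
move=> b1; have E : enorm (enorm x *: beta) = enorm x.
  by rewrite enormZ ger0_norm ?enorm_ge0// b1 mulr1.
by rewrite -[X in refl _ X](refl_swap E) reflK.
Qed.

(** Rational directions suffice: the mirror image of [x] lies in the cap about the pole [beta]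
    as soon as the reflection carries a point close to [x] to the axis. *)
Lemma refl_into_cap beta x z : enorm beta = 1 -> dotv z beta < enorm x ->
  exists p : 'rV[rat]_n,
    let q := map_mx ratr p in dotv z beta <= dotv (refl (enorm q *: beta - q) x) beta.
Proof.
move=> b1 zx; have e0 : 0 < (enorm x - dotv z beta) / 2 by rewrite divr_gt0 ?subr_gt0.
have [p Hp] := rational_dense x e0; exists p => /=.
set q := map_mx _ _ in Hp *; set s := refl _.
have sq : s q = enorm q *: beta by exact: refl_to_axis.
have d1 : enorm (s x - enorm q *: beta) <= (enorm x - dotv z beta) / 2.
  by rewrite -sq -reflB enorm_refl.
have bb : dotv beta beta = 1 by rewrite -sqr_enorm b1 expr1n.
have d2 : dotv (enorm q *: beta - s x) beta <= (enorm x - dotv z beta) / 2.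
  by apply: (le_trans (dotv_le _ _)); rewrite b1 mulr1 enormBC.
have d3 : enorm x <= enorm q + (enorm x - dotv z beta) / 2.
  have := enorm_triangle (x - q) q; rewrite subrK; lra.
by move: d2; rewrite dotvDl dotvNl dotvZl bb mulr1; lra.
Qed.

Lemma exists_orthogonal_unit beta : (2 <= n)%N -> exists c, enorm c = 1 /\ dotv c beta = 0.
Proof.
move=> n2; pose i : 'I_n := Ordinal (leq_trans (isT : 0 < 2)%N n2).
pose j : 'I_n := Ordinal n2.
have dE (k : 'I_n) x : dotv (delta_mx ord0 k) x = x ord0 k.
  rewrite /dotv (bigD1 k)//= mxE !eqxx mul1r big1 ?addr0// => l lk.
  by rewrite mxE (negbTE lk) andbF mul0r.
suff [w w0 wb] : exists2 w : 'rV[R]_n, w != 0 & dotv w beta = 0.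
  have ew : enorm w != 0 by rewrite enorm_eq0.
  exists ((enorm w)^-1 *: w); split; last by rewrite dotvZl wb mulr0.
  by rewrite enormZ ger0_norm ?invr_ge0 ?enorm_ge0// mulVf.
have [bi|bi] := eqVneq (beta ord0 i) 0.
  exists (delta_mx ord0 i); last by rewrite dE.
  by apply/eqP => /rowP/(_ i); rewrite !mxE !eqxx => /eqP; rewrite oner_eq0.
exists (beta ord0 j *: delta_mx ord0 i - beta ord0 i *: delta_mx ord0 j).
  apply/eqP => /rowP/(_ j); rewrite !mxE !eqxx /= mulr0 mulr1 sub0r => /eqP.
  by rewrite oppr_eq0 (negbTE bi).
by rewrite dotvDl dotvNl !dotvZl !dE mulrC subrr.
Qed.

(** The point of the sphere of radius [rho] at height [rho * tau] over the equator, on the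
    meridian through [c]. *)
Definition meridian beta c rho tau : 'rV[R]_n :=
  (rho * tau) *: beta + (rho * Num.sqrt (1 - tau ^+ 2)) *: c.

Section meridian.
Variables (beta c : 'rV[R]_n).
Hypotheses (b1 : enorm beta = 1) (c1 : enorm c = 1) (cb : dotv c beta = 0).

Lemma dotv_meridian rho tau : dotv (meridian beta c rho tau) beta = rho * tau.
Proof.
by rewrite dotvDl !dotvZl cb mulr0 addr0 -sqr_enorm b1 expr1n mulr1.
Qed.

Lemma enorm_meridian rho tau : 0 <= rho -> -1 <= tau <= 1 ->
  enorm (meridian beta c rho tau) = rho.
Proof.
move=> r0 /andP[t1 t2].
have : enorm (meridian beta c rho tau) ^+ 2 = rho ^+ 2.
  rewrite sqr_enorm /meridian !(dotvDl, dotvDr, dotvZl, dotvZr) (dotvC beta c) cb.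
  rewrite -!sqr_enorm b1 c1 !expr1n !(mulr0, mulr1, add0r, addr0) -!expr2 !exprMn.
  rewrite sqr_sqrtr; first by ring.
  by rewrite (_ : 1 - tau ^+ 2 = (1 - tau) * (1 + tau)); [apply: mulr_ge0; lra|ring].
by move=> /eqP; rewrite eqrXn2 ?enorm_ge0// => /eqP.
Qed.

Lemma polar_cos_bounds x : -1 <= dotv x beta / enorm x <= 1.
Proof.
have [->|x0] := eqVneq x 0; first by rewrite dot0v mul0r; apply/andP; split; lra.
rewrite -ler_norml normrM normfV (ger0_norm (enorm_ge0 x)) ler_pdivrMr ?enorm_gt0// mul1r.
by have := cauchy_schwarz x beta; rewrite b1 mulr1.
Qed.

Lemma cos_polar_angle x : cos (polar_angle beta x) = dotv x beta / enorm x.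
Proof. by rewrite /polar_angle acosK// in_itv/=; exact: polar_cos_bounds. Qed.

Lemma polar_angle_eq0 x : polar_angle beta x = 0 <-> dotv x beta / enorm x = 1.
Proof.
split=> [h|h]; first by rewrite -cos_polar_angle h cos0.
by rewrite /polar_angle h acos1.
Qed.

Lemma dotv_lt_enorm x : x != 0 -> polar_angle beta x != 0 -> dotv x beta < enorm x.
Proof.
move=> x0 ax; have x0' : 0 < enorm x by rewrite enorm_gt0.
have /andP[_ +] := polar_cos_bounds x; rewrite le_eqVlt => /predU1P[/polar_angle_eq0 E|].
  by rewrite E eqxx in ax.
by rewrite ltr_pdivrMr// mul1r.
Qed.

(** Off the great sphere orthogonal to [c], no point lies on the axis spanned by [beta]. *)
Lemma polar_angle_neq0 x : dotv x c != 0 -> polar_angle beta x != 0.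
Proof.
move=> xc; apply/eqP => /polar_angle_eq0 E.
have x0 : x != 0 by apply: contraNneq xc => ->; rewrite dot0v.
have ex : enorm x != 0 by rewrite enorm_eq0.
have xb : dotv x beta = enorm x by rewrite -[LHS](divfK ex) E mul1r.
have : dotv (x - enorm x *: beta) (x - enorm x *: beta) = 0.
  rewrite !(dotvDl, dotvDr, dotvNl, dotvNr, dotvZl, dotvZr) (dotvC beta x) xb -!sqr_enorm b1; ring.
move=> /eqP; rewrite dotvv_eq0 subr_eq0 => /eqP xE.
by move: xc; rewrite xE dotvZl dotvC cb mulr0 eqxx.
Qed.

End meridian.
End axis.

Section symmetrization.
Context {R : realType} {n : nat}.
Local Notation mu := (@lebesgue_rV R n).

(** The inverse of [f |-> f / (1 + f)]. *)
Let odds (p : R) := p / (1 - p).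

Let odds_mono p q : p <= q -> q < 1 -> odds p <= odds q.
Proof.
move=> pq q1; have p1 : p < 1 by exact: le_lt_trans pq q1.
by rewrite /odds ler_pdivrMr ?subr_gt0// mulrAC ler_pdivlMr ?subr_gt0//; nra.
Qed.

Let odds_ge0 p : 0 <= p <= 1 -> 0 <= odds p.
Proof. by move=> /andP[p0 p1]; rewrite divr_ge0// subr_ge0. Qed.

Variables (beta c : 'rV[R]_n) (F : 'rV[R]_n -> R) (M : R).
Hypotheses (b1 : enorm beta = 1) (c1 : enorm c = 1) (cb : dotv c beta = 0).
Hypotheses (n2 : (2 <= n)%N) (mF : measurable_fun setT F) (F01 : forall x, 0 <= F x <= 1).
Hypothesis Fmono : forall x y, enorm x = enorm y -> dotv y beta <= dotv x beta -> F y <= F x.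
Hypothesis F1 : {ae mu, forall x, eball 0 M x -> F x < 1}.

Local Notation P := (meridian beta c).

Let lat (m : nat) : R := 1 - m.+1%:R^-1.

Let lat_bounds m : -1 <= lat m <= 1.
Proof.
have m0 : 0 < m.+1%:R :> R by rewrite ltr0n.
have m1 : m.+1%:R^-1 <= 1 :> R by rewrite invf_le1// ler1n.
have m2 : 0 <= m.+1%:R^-1 :> R by rewrite invr_ge0 ltW.
by rewrite /lat; move: (m.+1%:R^-1) m1 m2 => d m1 m2; apply/andP; split; lra.
Qed.

Let lat_lt1 m : lat m < 1.
Proof. by rewrite /lat ltrBlDr ltrDl invr_gt0. Qed.

(** The spheres on which [F] stays below [1] away from the pole [beta]; it is enough to look at a
    sequence of points of one meridian that tends to the pole. *)
Let good (rho : R) : Prop := forall m, F (P rho (lat m)) < 1.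

Let good_set : set 'rV[R]_n := [set x | good (enorm x)].

Let measurable_good : measurable good_set.
Proof.
rewrite (_ : good_set = \bigcap_m ((fun x => F (P (enorm x) (lat m))) @^-1` `]-oo, 1[%classic)).
  apply: bigcapT_measurable => m; rewrite -[X in measurable X]setTI.
  apply: (measurableT_comp mF) => //; apply: measurable_fun_rVD; apply: measurable_fun_rVZ => //;
    apply: measurable_funM => //; exact: measurable_fun_enorm.
apply/seteqP; split => x H m; first by move=> _; rewrite /= in_itv/=; exact: H.
by have := H m I; rewrite /= in_itv/=.
Qed.

Let good_lt1 x : good (enorm x) -> dotv x beta < enorm x -> F x < 1.
Proof.
move=> gx xb; have x0 : 0 < enorm x.
  rewrite lt_neqAle enorm_ge0 andbT eq_sym; apply: contraTneq xb => /eqP.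
  by rewrite enorm_eq0 => /eqP ->; rewrite dot0v enorm0 ltxx.
have t0 : 0 < 1 - dotv x beta / enorm x by rewrite subr_gt0 ltr_pdivrMr// mul1r.
pose m := Num.bound (1 - dotv x beta / enorm x)^-1.
apply: le_lt_trans (gx m); apply: Fmono.
  by rewrite enorm_meridian// ?enorm_ge0.
rewrite dotv_meridian// mulrC -ler_pdivrMr// /lat lerBrDr -lerBrDl.
rewrite invf_ple ?posrE//; apply/ltW.
apply: lt_trans (archi_boundP _) _; first by rewrite invr_ge0 ltW.
by rewrite ltr_nat.
Qed.

(** If [F] reaches [1] at a point of a sphere other than the pole, it does so on a whole cap. One of
    countably many reflections carries a given point of the sphere into this cap, and [F] equals [1]
    only on a null set. *)
Let ae_good : {ae mu, forall x, eball 0 M x -> good (enorm x)}.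
Proof.
have b0 : beta != 0 by rewrite -enorm_eq0 b1 oner_eq0.
pose axis (p : 'rV[rat]_n) := let q := map_mx ratr p : 'rV[R]_n in enorm q *: beta - q.
have H (k : nat) : {ae mu, forall x, forall p : 'rV[rat]_n, unpickle k = Some p ->
    eball 0 M x -> F (refl (axis p) x) < 1}.
  case: (unpickle k) => [p|]; last by apply: nearW => x p.
  have := ae_refl (axis p) F1; apply: filterS => x Fx _ [<-].
  by move=> xM; apply: Fx; move: xM; rewrite /eball/= !subr0 enorm_refl.
have := ae_foralln H; apply: filterS2 (ae_hyperplane b0) => x xb Hx xM m.
have x0 : 0 < enorm x.
  by rewrite enorm_gt0; apply: contraNneq xb => ->; rewrite dot0v.
have ez : enorm (P (enorm x) (lat m)) = enorm x by rewrite enorm_meridian// enorm_ge0.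
have zx : dotv (P (enorm x) (lat m)) beta < enorm x.
  by rewrite dotv_meridian// gtr_pMr.
have [p Hp] := refl_into_cap b1 zx.
apply: (@le_lt_trans _ _ (F (refl (axis p) x))).
  by apply: Fmono => //; rewrite enorm_refl ez.
by apply: (Hx (pickle p)) => //; rewrite pickleK.
Qed.

(** On the remaining spheres, which form a null set, the value [+oo] of the odds on a cap would not be
    real-valued; [f0] is set to [0] there. *)
Let f0 x := \1_good_set x * odds (F x).

Let f0_ge0 x : 0 <= f0 x.
Proof. by rewrite mulr_ge0 ?odds_ge0// indicE. Qed.

Let measurable_f0 : measurable_fun setT f0.
Proof.
apply: measurable_funM; first exact: measurable_indic.
apply: measurable_funM => //; apply: measurable_funV; exact: measurable_funB.
Qed.

Let f0_mono x y : enorm x = enorm y -> dotv y beta <= dotv x beta ->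
  dotv x beta < enorm x -> f0 y <= f0 x.
Proof.
move=> xy yx xb; rewrite /f0 !indicE.
have -> : (y \in good_set) = (x \in good_set).
  by apply/idP/idP => /set_mem; rewrite /good_set/= => H; apply/mem_set; rewrite /= ?xy// -xy.
have [/set_mem gx|_] := boolP (x \in good_set); last by rewrite !mul0r.
by rewrite !mul1r; apply: odds_mono; [exact: Fmono|exact: good_lt1].
Qed.

Let f0_eq x y : enorm x = enorm y -> dotv y beta = dotv x beta ->
  dotv x beta < enorm x -> f0 y = f0 x.
Proof.
move=> xy yx xb; apply/eqP; rewrite eq_le !f0_mono ?yx// -xy//.
Qed.

Let fstar x : \bar R := if polar_angle beta x == 0 then +oo%E else (f0 x)%:E.

Let h (rho theta : R) : \bar R :=
  if theta == 0 then +oo%E else (f0 (P rho (cos theta)))%:E.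

Let ae_off_axis : {ae mu, forall x, polar_angle beta x != 0}.
Proof.
have c0 : c != 0 by rewrite -enorm_eq0 c1 oner_eq0.
by apply: filterS (ae_hyperplane c0) => x; exact: polar_angle_neq0.
Qed.

(** A function of [|x|] and [x.beta] that increases with [x.beta] is its own rearrangement. Only at the
    pole, where it may be unbounded, does the rearrangement take the value [+oo]; the poles form a
    null set, also for the measure on each sphere. *)
Lemma profile_foliated (D : set 'rV[R]_n) (f : 'rV[R]_n -> R) : measurable D ->
  (D `<=` eball 0 M) -> (forall x, 0 <= f x) ->
  {ae mu, forall x, eball 0 M x -> F x = f x / (1 + f x)} ->
  foliated_schwarz_symmetric D beta f.
Proof.
move=> mD DM f_ge0 Ff; exists f0; split.
- exact: measurable_funTS.
- by move=> x _.
- apply: filterS2 ae_good Ff => x gx Fx xD; have xM := DM x xD.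
  have f1 : 1 + f x != 0 by rewrite gt_eqF// ltr_pwDl.
  rewrite /f0 indicE mem_set; last exact: gx.
  rewrite mul1r /odds (Fx xM) (_ : 1 - f x / (1 + f x) = (1 + f x)^-1); last by field.
  by rewrite invrK divfK.
exists fstar; last first.
  by apply: filterS ae_off_axis => x ax _; rewrite /fstar (negbTE ax).
split.
  exists h; split.
    move=> rho t t' r0 /andP[t0 tt'] tpi; rewrite /h.
    have [_|tn0] := eqVneq t 0; first by rewrite leey.
    have tp : 0 < t by rewrite lt_neqAle eq_sym tn0.
    have t'p : 0 < t' by exact: lt_le_trans tp tt'.
    rewrite gt_eqF// lee_fin.
    have cb_ (s : R) : -1 <= cos s <= 1 by rewrite cos_geN1 cos_le1.
    have i1 : t \in `[0, pi] by rewrite in_itv/= ltW//= ltW// (le_lt_trans tt').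
    have i2 : t' \in `[0, pi] by rewrite in_itv/= ltW//= ltW.
    have ct1 : cos t < 1 by rewrite -cos0 ltr_cos// in_itv/= lexx pi_ge0.
    have cc : cos t' <= cos t by rewrite leNgt ltr_cos// -leNgt.
    move: r0; rewrite le_eqVlt => /predU1P[<-|r0].
      by rewrite /meridian !mul0r !scale0r.
    apply: f0_mono; rewrite ?enorm_meridian ?(ltW r0)// !dotv_meridian//.
      by rewrite ler_pM2l.
    by rewrite gtr_pMr.
  move=> x xD x0 xpi; rewrite /fstar /h; case: eqP => [//|/eqP ax].
  have ex : 0 < enorm x by rewrite enorm_gt0.
  congr EFin; apply/esym; apply: f0_eq.
  - by rewrite enorm_meridian// ?enorm_ge0// cos_geN1 cos_le1.
  - by rewrite dotv_meridian// cos_polar_angle// mulrC divfK// gt_eqF.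
  - exact: dotv_lt_enorm.
move=> a b rho ab; rewrite le_eqVlt => /predU1P[<-|r0].
  rewrite /sphere_measure expr0n (_ : n.-1 == 0%N = false) ?mulr0 ?mul0e//.
  by rewrite -subn1 subn_eq0 leqNgt n2.
congr (_ * _)%E.
have mP : measurable_fun setT (fun y : 'rV[R]_n => (rho / enorm y) *: y).
  apply: measurable_fun_rVZ => //; apply: measurable_funM => //.
  by apply: measurable_funV; exact: measurable_fun_enorm.
have mn : measurable_fun setT (@enorm R n) by exact: measurable_fun_enorm.
have mE (A : set 'rV[R]_n) : measurable A ->
    measurable [set y : 'rV[R]_n | 0 < enorm y <= 1 /\ A ((rho / enorm y) *: y)].
  move=> mA; apply: measurableI.
    rewrite [X in measurable X](_ : _ = enorm @^-1` `]0, 1]%classic).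
      by rewrite -[X in measurable X]setTI; exact: mn.
    by apply/seteqP; split => y /=; rewrite in_itv.
  by rewrite -[X in measurable X]setTI; exact: mP.
have mA1 : measurable [set x | [/\ D x, enorm x = rho & a < f0 x <= b]].
  rewrite (_ : mkset _ = D `&` (enorm @^-1` [set rho] `&` f0 @^-1` `]a, b]%classic)).
    apply: measurableI => //; apply: measurableI; rewrite -[X in measurable X]setTI.
      exact: mn.
    exact: measurable_f0.
  by apply/seteqP; split => x /=; rewrite in_itv/= ; [case|case=> ? []].
have mA2 : measurable [set x | [/\ D x, enorm x = rho & (a%:E < fstar x <= b%:E)%E]].
  rewrite (_ : mkset _ = [set x | [/\ D x, enorm x = rho & a < f0 x <= b]] `\`
     (fun x => dotv x beta / enorm x) @^-1` [set 1]).
    apply: measurableD => //; rewrite -[X in measurable X]setTI.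
    have md : measurable_fun setT (fun x : 'rV[R]_n => dotv x beta / enorm x).
      by apply: measurable_funM; [exact: measurable_fun_dotv|exact: measurable_funV].
    exact: md.
  apply/seteqP; split => x /=; rewrite /fstar.
    case: eqP => [_ [_ _ /andP[_]]//|ax].
    by rewrite lte_fin lee_fin => H; split => // /(polar_angle_eq0 b1).
  move=> [H]; case: eqP => [/(polar_angle_eq0 b1)//|ax _].
  by rewrite lte_fin lee_fin.
apply: measure_ae_eq; [exact: mE|exact: mE|].
have c0 : c != 0 by rewrite -enorm_eq0 c1 oner_eq0.
apply: filterS (ae_hyperplane c0) => y yc /=.
have ay : polar_angle beta ((rho / enorm y) *: y) != 0.
  apply: (polar_angle_neq0 b1 cb); rewrite dotvZl mulf_neq0// mulf_neq0//; first by rewrite gt_eqF.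
  rewrite invr_eq0 enorm_eq0; apply: contraNneq yc => ->; by rewrite dot0v.
by rewrite /fstar (negbTE ay) lte_fin lee_fin.
Qed.

End symmetrization.

Section foliated_of_tilt.
Context {R : realType} {n : nat}.
Local Notation mu := (@lebesgue_rV R n).
Implicit Types (D : set 'rV[R]_n) (beta : 'rV[R]_n) (f : 'rV[R]_n -> R).

(** The weighted reflection inequalities say that [f] increases towards [beta] on spheres; the
    bounded monotone transform [f / (1 + f)] gives access to the averaging argument. *)
Lemma foliated_of_tilt D beta f (M : R) : (2 <= n)%N -> enorm beta = 1 ->
  measurable D -> D `<=` eball 0 M -> measurable_fun setT f -> (forall x, 0 <= f x) ->
  (forall a, a != 0 -> 0 <= dotv a beta -> {ae mu, forall x, 0 <= tilt a f x}) ->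
  foliated_schwarz_symmetric D beta f.
Proof.
move=> n2 b1 mD DM mf f0 Hf; pose p x := f x / (1 + f x).
have f1 x : 0 < 1 + f x by rewrite ltr_pwDl.
have p01 x : 0 <= p x <= 1.
  by rewrite /p divr_ge0 ?(ltW (f1 x))//= ler_pdivrMr// mul1r lerDr ler01.
have mp : measurable_fun setT p.
  by apply: measurable_funM => //; apply: measurable_funV; exact: measurable_funD.
have Hp a : a != 0 -> 0 <= dotv a beta -> {ae mu, forall x, 0 <= tilt a p x}.
  move=> a0 ab; apply: filterS (Hf a a0 ab) => x; rewrite /tilt => tx.
  rewrite (_ : p x - p (refl a x) = (f x - f (refl a x)) / ((1 + f x) * (1 + f (refl a x)))).
    by rewrite mulrA divr_ge0// mulr_ge0// ltW.
  by rewrite /p; field; rewrite !gt_eqF.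
have [F [mF F01 Fp Fmono]] := radial_representative M mp p01 Hp.
have [c [c1 cb]] := exists_orthogonal_unit beta n2.
apply: (@profile_foliated R n beta c F M) => //.
apply: filterS Fp => x Fx xM; rewrite Fx// ltr_pdivrMr// mul1r ltrDr; exact: ltr01.
Qed.

Lemma foliated_ae_eq D beta f f' : {ae mu, forall x, D x -> f x = f' x} ->
  foliated_schwarz_symmetric D beta f -> foliated_schwarz_symmetric D beta f'.
Proof.
move=> ff' [f0 [mf0 f00 f0f Hstar]]; exists f0; split => //.
by apply: filterS2 ff' f0f => x ff ff0 xD; rewrite ff0// ff.
Qed.

End foliated_of_tilt.

(** * The first moment *)

Section first_moment.
Context {R : realType} {n : nat}.
Local Notation mu := (@lebesgue_rV R n).
Implicit Types (a : 'rV[R]_n).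

Lemma Rintegral_refl a (f : 'rV[R]_n -> R) : measurable_fun setT f ->
  \int[mu]_x f (refl a x) = \int[mu]_x f x.
Proof.
move=> mf; have mfE : measurable_fun setT (EFin \o f) by exact/measurable_EFinP.
rewrite /Rintegral; congr fine; rewrite integralE [RHS]integralE; congr (_ - _)%E.
- rewrite -(integral_refl a (measurable_funepos mfE) (funepos_ge0 _)).
  by apply: eq_integral => x _; rewrite !funeposE.
- rewrite -(integral_refl a (measurable_funeneg mfE) (funeneg_ge0 _)).
  by apply: eq_integral => x _; rewrite !funenegE.
Qed.

Lemma integrable_refl a (f : 'rV[R]_n -> R) : mu.-integrable setT (EFin \o f) ->
  mu.-integrable setT (EFin \o (f \o refl a)).
Proof.
move=> /integrableP[mf If]; apply/integrableP; split.
  exact: (measurableT_comp mf (measurable_refl a)).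
have := integral_refl a (f := fun x => `|(f x)%:E|%E) => /= -> //.
exact: (measurableT_comp (@abse_measurable R setT) mf).
Qed.

Variables (u : 'rV[R]_n -> R) (Rad : R).
Hypotheses (mu' : measurable_fun setT u) (u0 : forall x, ~ eball 0 Rad x -> u x = 0).
Hypothesis u2 : (\int[mu]_x (`|u x| ^+ 2)%:E < +oo)%E.

Let integrable_moment a : mu.-integrable setT (EFin \o (fun x => dotv x a * u x)).
Proof.
have mphi : measurable_fun setT (fun x : 'rV[R]_n => dotv x a) by exact: measurable_fun_dotv.
apply/integrableP; split.
  by apply/measurable_EFinP; exact: measurable_funM.
pose K := enorm a * `|Rad|; have K0 : 0 <= K by rewrite mulr_ge0// enorm_ge0.
have mi : measurable_fun setT (\1_(eball 0 Rad) : 'rV[R]_n -> R).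
  exact: measurable_indic (measurable_eball _ _).
have m2 : measurable_fun setT (fun x : 'rV[R]_n => (`|u x| ^+ 2)%:E).
  by apply/measurable_EFinP; apply: measurable_funX; apply: measurableT_comp.
apply: (@le_lt_trans _ _ (\int[mu]_x (K%:E * ((\1_(eball 0 Rad) x)%:E + (`|u x| ^+ 2)%:E)))%E).
  apply: ge0_le_integralT.
  - by apply: measurableT_comp => //; apply/measurable_EFinP; exact: measurable_funM.
  - apply: emeasurable_funM => //; apply: emeasurable_funD => //.
    exact/measurable_EFinP.
  - by move=> x; rewrite abse_ge0.
  move=> x; rewrite /= -EFinD -EFinM lee_fin normrM indicE.
  have [xR|xR] := boolP (x \in eball 0 Rad); last first.
    by rewrite (u0 (fun h => negP xR (mem_set h))) normr0 mulr0 mulr_ge0// addr_ge0.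
  have ex : enorm x <= `|Rad|.
    move: (set_mem xR); rewrite /eball/= subr0 => /ltW h.
    exact: le_trans h (ler_norm _).
  have px : `|dotv x a| <= K.
    by apply: (le_trans (cauchy_schwarz x a)); rewrite mulrC ler_wpM2l// enorm_ge0.
  apply: ler_pM => //; have := sqr_ge0 (`|u x| - 1); rewrite sqrrB1 => h.
  have := normr_ge0 (u x); rewrite /=; nra.
have K0' : (forall x, setT x -> 0 <= (\1_(eball 0 Rad) x : R)%:E + (`|u x| ^+ 2)%:E)%E.
  by move=> x _; rewrite -EFinD lee_fin addr_ge0// indicE.
have mm : measurable_fun setT (fun x : 'rV[R]_n => ((\1_(eball 0 Rad) x : R)%:E + (`|u x| ^+ 2)%:E)%E).
  by apply: emeasurable_funD => //; exact/measurable_EFinP.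
rewrite (ge0_integralZl_EFin mu measurableT K0' mm K0) lte_mul_pinfty ?lee_fin//.
have miE : measurable_fun setT (fun x : 'rV[R]_n => (\1_(eball 0 Rad) x : R)%:E).
  exact/measurable_EFinP.
rewrite ge0_integralD//.
rewrite lte_add_pinfty//.
rewrite (integral_indic mu measurableT (measurable_eball 0 Rad)) setIT.
exact: lebesgue_rV_eball_fin.
Qed.

(** The barycenter of [u] up to normalization. Its component along [a] is half the integral of
    [tilt a u], so it knows to which side [u] is tilted. *)
Definition first_moment : 'rV[R]_n := \row_i \int[mu]_x (dotv x (delta_mx ord0 i) * u x).

Lemma dotv_first_moment a : dotv first_moment a = \int[mu]_x (dotv x a * u x).
Proof.
have dE (x : 'rV[R]_n) (k : 'I_n) : dotv x (delta_mx ord0 k) = x ord0 k.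
  rewrite /dotv (bigD1 k)//= mxE !eqxx mulr1 big1 ?addr0// => l lk.
  by rewrite mxE (negbTE lk) andbF mulr0.
have -> : (fun x => dotv x a * u x) =
    (fun x => \sum_(i < n) (a ord0 i * (dotv x (delta_mx ord0 i) * u x))).
  apply/funext => x; rewrite {1}/dotv mulr_suml; apply: eq_bigr => i _.
  by rewrite dE mulrCA mulrA.
pose f i (x : 'rV[R]_n) := (a ord0 i * (dotv x (delta_mx ord0 i) * u x))%:E.
have fi i : mu.-integrable setT (f i).
  have := integrableZl measurableT (a ord0 i) (integrable_moment (delta_mx ord0 i)).
  by apply: eq_integrable => // x _; rewrite /f /= EFinM.
rewrite /Rintegral; under eq_integral do rewrite -sumEFin.
rewrite (integral_sum measurableT fi) -sum_fine; last first.
  by move=> i _; exact: (integrable_fin_num measurableT (fi i)).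
apply: eq_bigr => i _; rewrite mxE mulrC -RintegralZl//.
Qed.

Let tiltE a : tilt a u = (fun x => dotv x a * u x - (- (dotv (refl a x) a * u (refl a x)))).
Proof.
by apply/funext => x; rewrite /tilt mulrBr dotv_refl_normal mulNr opprK.
Qed.

Let integrable_reflected a :
  mu.-integrable setT (EFin \o (fun x => - (dotv (refl a x) a * u (refl a x)))).
Proof.
have := integrableZl measurableT (-1) (integrable_refl a (integrable_moment a)).
by apply: eq_integrable => // x _ /=; rewrite EFinN mulN1e.
Qed.

Let integrable_tilt a : mu.-integrable setT (EFin \o tilt a u).
Proof.
rewrite tiltE; have := integrableB measurableT (integrable_moment a) (integrable_reflected a).
by apply: eq_integrable.
Qed.

Lemma integral_tilt a : \int[mu]_x tilt a u x = 2 * dotv first_moment a.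
Proof.
have i1 := integrable_moment a.
have E : \int[mu]_x (- (dotv (refl a x) a * u (refl a x))) = - dotv first_moment a.
  rewrite (Rintegral_refl a (f := fun x => - (dotv x a * u x))); last first.
    by apply: measurableT_comp => //; apply: measurable_funM => //; exact: measurable_fun_dotv.
  rewrite dotv_first_moment -mulN1r -RintegralZl//.
  by apply: eq_Rintegral => x _; rewrite mulN1r.
rewrite tiltE (RintegralB measurableT i1 (integrable_reflected a)).
by rewrite -dotv_first_moment E opprK mulr_natl mulr2n.
Qed.

Lemma tilt_first_moment a : {ae mu, forall x, 0 <= tilt a u x} ->
  0 <= dotv first_moment a /\ (dotv first_moment a = 0 -> {ae mu, forall x, tilt a u x = 0}).
Proof.
move=> ta; have it := integrable_tilt a.
have ni : mu.-integrable setT (EFin \o (fun x => `|tilt a u x|)).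
  exact: (integrable_norm it).
have E : \int[mu]_x `|tilt a u x| = 2 * dotv first_moment a.
  rewrite -integral_tilt /Rintegral; congr fine; apply: ae_eq_integral => //.
  - exact: (measurable_int _ ni).
  - exact: (measurable_int _ it).
  by apply: filterS ta => x tx _; rewrite ger0_norm.
split.
  have : 0 <= 2 * dotv first_moment a by rewrite -E; apply: Rintegral_ge0.
  by rewrite pmulr_rge0.
move=> m0; have := Rintegral_eq0_ae ni (fun x => normr_ge0 _).
rewrite E m0 mulr0 => /(_ erefl); apply: filterS => x /eqP.
by rewrite normr_eq0 => /eqP.
Qed.

(** The sign of the first moment decides between the two alternatives left by polarization. *)
Lemma tilt_of_first_moment a :
  {ae mu, forall x, 0 <= tilt a u x} \/ {ae mu, forall x, tilt a u x <= 0} ->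
  0 <= dotv first_moment a -> {ae mu, forall x, 0 <= tilt a u x}.
Proof.
move=> [//|ta] ma; have ta' : {ae mu, forall x, 0 <= tilt (- a) u x}.
  by apply: filterS ta => x tx; rewrite tilt_opp oppr_ge0.
have [] := tilt_first_moment ta'; rewrite dotvNr oppr_ge0 => ma' /(_ _).
have -> : dotv first_moment a = 0 by apply/eqP; rewrite eq_le ma ma'.
rewrite oppr0 => /(_ erefl); apply: filterS => x /eqP.
by rewrite tilt_opp oppr_eq0 => /eqP ->.
Qed.

End first_moment.

(** * Passage to nonnegative representatives *)

Section representatives.
Context {R : realType} {n : nat}.
Local Notation mu := (@lebesgue_rV R n).
Variables (B : set 'rV[R]_n) (s : R) (g V : 'rV[R]_n -> R).
Hypothesis mB : measurable B.
Hypotheses (mg : measurable_fun B g) (mV : measurable_fun B V).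
Hypotheses (g0 : {ae mu, forall x, B x -> 0 <= g x}) (V0 : {ae mu, forall x, B x -> 0 <= V x}).

Let massE w : H0s s B w -> weighted_mass B g w = weighted_mass B (nneg_rep B g) w /\
  weighted_mass B V w = weighted_mass B (nneg_rep B V) w.
Proof. by move=> /H0sP[mw _ _ _]; split; apply: weighted_mass_rep. Qed.

Let admissibleE w : admissible s B g w <-> admissible s B (nneg_rep B g) w.
Proof. by rewrite /admissible/=; split=> -[wH]; have [-> _] := massE wH. Qed.

Let rayleighE w : H0s s B w ->
  rayleigh s B g V w = rayleigh s B (nneg_rep B g) (nneg_rep B V) w.
Proof. by move=> /massE[E1 E2]; rewrite /rayleigh E1 E2. Qed.

Lemma lambda1_rep : lambda1 s B g V = lambda1 s B (nneg_rep B g) (nneg_rep B V).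
Proof.
congr ereal_inf; apply/seteqP; split => _ [w wa <-]; exists w;
  [exact/admissibleE| |exact/admissibleE|]; by rewrite rayleighE//; case: wa.
Qed.

Lemma first_eigenfunction_rep u : {ae mu, forall x, B x -> 0 <= u x} ->
  first_eigenfunction s B g V u ->
  {ae mu, forall x, u x = nneg_rep B u x} /\
  first_eigenfunction s B (nneg_rep B g) (nneg_rep B V) (nneg_rep B u).
Proof.
move=> u0 [[/[dup] uH /H0sP[mu' u2 Eu uB] gu] uE].
have mU : measurable_fun B u by exact: measurable_funTS.
have [mr r0 rB] := nneg_rep_on mB mU.
have ur : {ae mu, forall x, u x = nneg_rep B u x}.
  apply: filterS2 (nneg_rep_ae u0) uB => x -> ux; rewrite patchE.
  by case: ifPn => //; rewrite notin_setE => /ux.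
split => //.
have mE (G : 'rV[R]_n -> R) : measurable_fun setT G -> (forall x, 0 <= G x) -> mass G (nneg_rep B u) = mass G u.
  move=> mG G0; apply: mass_ae_eq => //; first exact: nearW.
  by apply: filterS ur => x ->.
have EE : energy s (nneg_rep B u) = energy s u.
  by apply: energy_ae_eq => //; apply: filterS ur => x ->.
have rH : H0s s B (nneg_rep B u).
  apply/H0sP; split; [exact: mr| | |].
  - rewrite (_ : (\int[mu]_x (`|nneg_rep B u x| ^+ 2)%:E = \int[mu]_x (`|u x| ^+ 2)%:E)%E); first exact: u2.
    apply: ae_eq_integral; [exact: measurableT| | |].
    + by apply/measurable_EFinP; apply: measurable_funX; apply: measurableT_comp.
    + by apply/measurable_EFinP; apply: measurable_funX; apply: measurableT_comp.
    by apply: filterS ur => x ->.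
  - by rewrite EE.
  - exact: nearW.
have wE (h : 'rV[R]_n -> R) : measurable_fun B h -> {ae mu, forall x, B x -> 0 <= h x} ->
    weighted_mass B (nneg_rep B h) (nneg_rep B u) = weighted_mass B h u.
  move=> mh h0; rewrite (weighted_mass_rep mB mh h0 mu').
  have hB := nneg_rep_on mB mh; rewrite !weighted_mass_nneg//.
  by case: hB => *; exact: mE.
split; first by split => //; rewrite wE.
by rewrite -lambda1_rep -uE /rayleigh !gagliardo_seminorm_sqr EE (wE _ mg g0) (wE _ mV V0).
Qed.

End representatives.

(** * Perforated balls *)

Section perforated_ball.
Context {R : realType} {n : nat}.
Local Notation mu := (@lebesgue_rV R n).
Variables (Rad r t : R).
Hypothesis n_gt0 : (0 < n)%N.
Hypotheses (r_gt0 : 0 < r) (t_ge0 : 0 <= t) (tRr : t < Rad - r).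
Local Notation B := (perforated_ball Rad r t : set 'rV[R]_n).
Local Notation c := (t *: e1 : 'rV[R]_n).

Lemma perforated_ball_sub : B `<=` eball 0 Rad.
Proof. by move=> x []. Qed.

Lemma lebesgue_perforated_ball_fin : (mu B < +oo)%E.
Proof.
apply: le_lt_trans (lebesgue_rV_eball_fin 0 Rad); apply: le_measure; rewrite ?inE.
- exact: measurable_perforated_ball.
- exact: measurable_eball.
- exact: perforated_ball_sub.
Qed.

(** A point of the hole on the side of [a] comes closer to the center of the hole when it is
    reflected, because the center lies on the other side. *)
Lemma polarizable_perforated_ball a : a != 0 -> t * dotv e1 a <= 0 -> polarizable B a.
Proof.
move=> a0 ca x xa nBx [xRad xc]; apply: nBx; split.
  by move: xRad; rewrite /eball/= !subr0 enorm_refl.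
move=> xc'; apply: xc; move: xc'; rewrite /closed_eball/= => xc; apply: le_trans xc.
rewrite -(ler_pXn2r (ltn0Sn 1)) ?nnegrE ?enorm_ge0// enorm_reflB -subr_le0.
have aa : dotv a a != 0 by rewrite dotvv_eq0.
rewrite enorm_reflB_diff// dotvZl; apply: mulr_le0_ge0; last by rewrite invr_ge0 dotvv_ge0.
by apply: mulr_ge0_le0 => //; apply: mulr_ge0_le0 => //; exact: ltW.
Qed.

(** The mirror image of the hole sticks out of the hole on the side of [a]: there a function
    positive on [B] and zero off [B] cannot be tilted away from [a]. *)
Lemma tilt_le0_absurd a (u : 'rV[R]_n -> R) : t * dotv e1 a < 0 ->
  (forall x, ~ B x -> u x = 0) -> {ae mu, forall x, B x -> 0 < u x} ->
  ~ {ae mu, forall x, tilt a u x <= 0}.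
Proof.
move=> ca u0 u_gt0 tu.
have cA : dotv c a < 0 by rewrite dotvZl.
have a0 : a != 0 by apply: contraTneq cA => ->; rewrite dotv0 ltxx.
have aa : dotv a a != 0 by rewrite dotvv_eq0.
have ea : 0 < enorm a by rewrite enorm_gt0.
pose k : R := - (2 * (dotv c a / dotv a a)).
have k0 : 0 < k by rewrite /k -mulrN -mulNr mulr_gt0// divr_gt0 ?oppr_gt0// dotvv_gt0.
pose d := Num.min (k * enorm a) r / 4.
have d0 : 0 < d by rewrite divr_gt0// lt_min r_gt0 andbT mulr_gt0.
have dr : 4 * d <= r by rewrite /d mulrC divfK// ge_min lexx orbT.
have dk : 4 * d <= k * enorm a by rewrite /d mulrC divfK// ge_min lexx.
pose w := ((r - 2 * d) / enorm a) *: a.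
have ew : enorm w = r - 2 * d.
  rewrite enormZ ger0_norm ?divfK ?gt_eqF// divr_ge0 ?enorm_ge0//; lra.
have raa : refl a a = - a.
  by rewrite /refl divff// mulr1 scaler_nat mulr2n opprD addrA subrr add0r.
have rc : refl a c = c + k *: a by rewrite /refl scaleNr.
have rw : refl a w = - w by rewrite /w reflZ raa scalerN.
(* [x] is the mirror image of the point [c - w] of the hole, at depth [2 * d]; the bound on [d] keeps
   the ball of radius [d] about [x] away from the hole. *)
pose x := refl a c + w.
have rx : refl a x = c - w by rewrite /x reflD reflK rw.
have exc : enorm (x - c) = k * enorm a + (r - 2 * d).
  rewrite /x rc addrAC (addrC c) addrK /w -scalerDl enormZ ger0_norm.
    by rewrite mulrDl divfK// gt_eqF.
  by rewrite addr_ge0 ?(ltW k0)// divr_ge0 ?enorm_ge0//; lra.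
have near_ y : eball x d y ->
    [/\ B y, ~ B (refl a y) & 0 < dotv y a].
  rewrite /eball/= => yx.
  have yc : r < enorm (y - c).
    have := enorm_triangleB x y c; rewrite exc (enormBC x y); lra.
  have ryc : enorm (refl a y - c) < r - d.
    have := enorm_triangleB (refl a y) (refl a x) c.
    rewrite -reflB enorm_refl rx (_ : c - w - c = - w) ?enormN ?ew; first lra.
    by rewrite addrAC subrr add0r.
  split.
  - split; last by move=> /=; apply/negP; rewrite -ltNge.
    rewrite /eball/= subr0 -(enorm_refl a).
    have := enorm_triangleB (refl a y) c 0; rewrite !subr0 enormZ enorm_e1// mulr1 ger0_norm// => h.
    apply: (le_lt_trans h); apply: (lt_trans (ltr_leD ryc (lexx t))); move: d0 tRr; clear; lra.
  - by move=> [_]; apply; rewrite /closed_eball/=; lra.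
  - rewrite ltNge; apply/negP => ya.
    have := enorm_reflB_diff y c aa; rewrite -enorm_reflB => E.
    have : enorm (refl a y - c) ^+ 2 < enorm (y - c) ^+ 2.
      by rewrite ltr_pXn2r// ?nnegrE ?enorm_ge0//; lra.
    rewrite -subr_lt0 E ltNge; apply/negP/negPn.
    by rewrite divr_ge0 ?dotvv_ge0// mulr_ge0// mulr_le0// ltW.
have [y yx [tuy uy]] : exists2 y, eball x d y & tilt a u y <= 0 /\ (B y -> 0 < u y).
  apply: (ae_exists (measurable_eball x d) (lebesgue_rV_eball_gt0 x d0)).
  by apply: filterS2 tu u_gt0.
have [By nBy ya] := near_ y yx.
by move: tuy; rewrite /tilt (u0 _ nBy) subr0 leNgt mulr_gt0// uy.
Qed.

End perforated_ball.

(** * The minimizing configuration *)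

Section minimizing_configuration.
Context {R : realType} {N : nat}.
Local Notation mu := (@lebesgue_rV R N).
Variables (s q r Rad t : R) (g0 V0 g V u : 'rV[R]_N -> R).
Hypotheses (N2 : (2 <= N)%N) (s01 : 0 < s < 1) (Nsq : N%:R / (2 * s) < q).
Hypotheses (r0 : 0 < r) (t0 : 0 <= t) (tRr : t < Rad - r).
Local Notation B := (perforated_ball Rad r t : set 'rV[R]_N).
Hypotheses (g0q : in_Lq q B g0) (V0q : in_Lq q B V0).
Hypotheses (g0_ge0 : {ae mu, forall x, B x -> 0 <= g0 x})
  (V0_ge0 : {ae mu, forall x, B x -> 0 <= V0 x}).
Hypothesis gVmin : minimizing_weights s B g0 V0 g V.
Hypotheses (eig : first_eigenfunction s B g V u) (u_gt0 : {ae mu, forall x, B x -> 0 < u x}).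

Let mB : measurable B. Proof. exact: measurable_perforated_ball. Qed.

Let Boo : (mu B < +oo)%E. Proof. exact: lebesgue_perforated_ball_fin. Qed.

Let N0 : (0 < N)%N. Proof. exact: ltnW. Qed.

Let q0 : 0 < q.
Proof.
have /andP[s0 _] := s01; apply: lt_trans Nsq.
by rewrite divr_gt0 ?ltr0n// mulr_gt0.
Qed.

Let measurable_Lq (phi : 'rV[R]_N -> R) : in_Lq q B phi -> measurable_fun B phi.
Proof.
move=> /(Lfun_powerP _ q0)[mphi _]; exact/(measurable_restrictT phi mB).
Qed.

Let equimeasurable_ge0 (phi psi : 'rV[R]_N -> R) : in_Lq q B phi -> {ae mu, forall x, B x -> 0 <= phi x} ->
  equimeasurable B phi psi -> {ae mu, forall x, B x -> 0 <= psi x}.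
Proof.
move=> phiq phi0 E.
have mX : measurable [set x : R | 0 <= x] by rewrite -set_itvcy.
exact: (equimeasurable_ae mB Boo (measurable_Lq phiq) E mX phi0).
Qed.

Let g_ge0 : {ae mu, forall x, B x -> 0 <= g x}.
Proof. by case: gVmin => gE _ _; exact: equimeasurable_ge0 g0q g0_ge0 gE. Qed.

Let V_ge0 : {ae mu, forall x, B x -> 0 <= V x}.
Proof. by case: gVmin => _ VE _; exact: equimeasurable_ge0 V0q V0_ge0 VE. Qed.

Let u_ge0 : {ae mu, forall x, B x -> 0 <= u x}.
Proof. by apply: filterS u_gt0 => x H /H /ltW. Qed.

Let mg : measurable_fun B g. Proof. by case: gVmin => -[]. Qed.
Let mV : measurable_fun B V. Proof. by case: gVmin => _ []. Qed.

Local Notation G := (nneg_rep B g).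
Local Notation W := (nneg_rep B V).
Local Notation U := (nneg_rep B u).

Let uU : {ae mu, forall x, u x = U x}.
Proof. by have [] := first_eigenfunction_rep mB mg mV g_ge0 V_ge0 u_ge0 eig. Qed.

Let eigU : first_eigenfunction s B G W U.
Proof. by have [] := first_eigenfunction_rep mB mg mV g_ge0 V_ge0 u_ge0 eig. Qed.

Let mu' : measurable_fun B u.
Proof. by case: eig => -[/H0sP[mu' _ _ _] _] _; exact: measurable_funTS. Qed.

Let UB : nneg_on B U. Proof. exact: nneg_rep_on. Qed.
Let GB : nneg_on B G. Proof. exact: nneg_rep_on. Qed.
Let WB : nneg_on B W. Proof. exact: nneg_rep_on. Qed.

Let Gc : competitor B g0 G.
Proof. by split => //; apply: equimeasurable_rep => //; case: gVmin. Qed.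

Let Wc : competitor B V0 W.
Proof. by split => //; apply: equimeasurable_rep => //; case: gVmin. Qed.

Let U_gt0 : {ae mu, forall x, B x -> 0 < U x}.
Proof. by apply: filterS2 uU u_gt0 => x <-. Qed.

Let minimal G' V' : competitor B g0 G' -> competitor B V0 V' ->
  (lambda1 s B G W <= lambda1 s B G' V')%E.
Proof.
move=> [_ G'E] [_ V'E]; rewrite -lambda1_rep//.
by case: gVmin => _ _; apply.
Qed.

Let sN : 2 * s < N%:R.
Proof.
have /andP[_ s1] := s01; apply: (@lt_le_trans _ _ 2); first lra.
by rewrite ler_nat.
Qed.

Let polarized (V' : 'rV[R]_N -> R) (a : 'rV[R]_N) : competitor B V0 V' -> a != 0 ->
  t * dotv e1 a <= 0 ->
  (mass V' (polarize a U) <= mass W U)%E -> (forall x, 0 <= (W x - V' x) * dotv x a) ->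
  ({ae mu, forall x, 0 <= tilt a U x} \/ {ae mu, forall x, tilt a U x <= 0}) /\
  ({ae mu, forall x, 0 <= tilt a U x} ->
    {ae mu, forall x, 0 <= tilt a G x} /\ {ae mu, forall x, W x = V' x}).
Proof.
move=> V'c a0 ea Hm HV.
exact: (minimizer_tilt mB Boo N0 s01 sN Nsq g0q V0q
  (@perforated_ball_sub R N Rad r t) Gc Wc V'c UB eigU U_gt0 a0
  (polarizable_perforated_ball a0 ea) minimal Hm HV).
Qed.

Let mU : measurable_fun setT U. Proof. by case: UB. Qed.
Let mG : measurable_fun setT G. Proof. by case: GB. Qed.
Let mW : measurable_fun setT W. Proof. by case: WB. Qed.
Let U0 x : 0 <= U x. Proof. by case: UB. Qed.
Let G0 x : 0 <= G x. Proof. by case: GB. Qed.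
Let W0 x : 0 <= W x. Proof. by case: WB. Qed.

Let U_off x : ~ eball 0 Rad x -> U x = 0.
Proof. by case: UB => _ _ UB0 xR; apply: UB0 => /perforated_ball_sub. Qed.

Let U2 : (\int[mu]_x (`|U x| ^+ 2)%:E < +oo)%E.
Proof. by case: eigU => -[/H0sP[]]. Qed.

Local Notation m := (first_moment U).

Let decide a : ({ae mu, forall x, 0 <= tilt a U x} \/ {ae mu, forall x, tilt a U x <= 0}) ->
  0 <= dotv m a -> {ae mu, forall x, 0 <= tilt a U x}.
Proof. exact: (tilt_of_first_moment mU U_off U2). Qed.

Let symmetric_on (D : set 'rV[R]_N) (beta : 'rV[R]_N) (f : 'rV[R]_N -> R) :
  measurable D -> D `<=` eball 0 Rad -> enorm beta = 1 ->
  measurable_fun B f -> {ae mu, forall x, B x -> 0 <= f x} ->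
  (forall a, a != 0 -> 0 <= dotv a beta -> {ae mu, forall x, 0 <= tilt a (nneg_rep B f) x}) ->
  foliated_schwarz_symmetric D beta (f \_ B).
Proof.
move=> mD DR b1 mf f0 Hf; have [mr r0' _] := nneg_rep_on mB mf.
apply: (@foliated_ae_eq _ _ _ _ (nneg_rep B f)).
  by apply: filterS (nneg_rep_ae f0) => x.
exact: (foliated_of_tilt N2 b1 mD DR mr r0' Hf).
Qed.

(** All reflections map the annulus to itself, so every direction is available, and the axis is the
    direction of the first moment. If the first moment is zero, [tilt a U] vanishes for all [a] and
    any axis will do. The potential is polarized towards [- a] for each [a] in the half-space of
    [beta], hence it is symmetric with respect to [- beta]. *)
Lemma symmetric_annulus : t = 0 -> exists beta : 'rV[R]_N,
  [/\ enorm beta = 1, foliated_schwarz_in Rad r t beta u,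
      foliated_schwarz_in Rad r t beta g & foliated_schwarz_in Rad r t (- beta) V].
Proof.
move=> tE.
have [beta [b1 mb]] : exists beta, enorm beta = 1 /\ m = enorm m *: beta.
  have [->|m0] := eqVneq m 0.
    by exists e1; rewrite enorm_e1// enorm0 scale0r.
  exists ((enorm m)^-1 *: m); rewrite enormZ scalerA divff ?enorm_eq0// scale1r.
  by rewrite ger0_norm ?invr_ge0 ?enorm_ge0// mulVf// enorm_eq0.
have anyside (a : 'rV[R]_N) : t * dotv e1 a <= 0 by rewrite tE mul0r.
have key a : a != 0 -> 0 <= dotv a beta -> [/\ {ae mu, forall x, 0 <= tilt a U x},
    {ae mu, forall x, 0 <= tilt a G x} & {ae mu, forall x, W x = polarize (- a) W x}].
  move=> a0 ab; have na0 : - a != 0 by rewrite oppr_eq0.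
  have Vc' : competitor B V0 (polarize (- a) W).
    have pB : polarizable B (- a) := polarizable_perforated_ball na0 (anyside (- a)).
    by split; [exact: nneg_on_polarize|apply: equimeasurable_polarize => //; case: Wc].
  have [] := polarized Vc' a0 (anyside a).
  - exact: mass_polarize_le.
  - move=> x; rewrite /polarize tilt_opp refl_opp oppr_lt0; case: ltP => [|_].
      by rewrite /tilt mulrC => /ltW.
    by rewrite subrr mul0r.
  move=> /decide dU H.
  have tU : {ae mu, forall x, 0 <= tilt a U x}.
    by apply: dU; rewrite mb dotvZl mulr_ge0 ?enorm_ge0// dotvC.
  by have [tG WE] := H tU.
exists beta; rewrite /foliated_schwarz_in tE eqxx -tE.
have onB f beta' : foliated_schwarz_symmetric B beta' (f \_ B) ->
    foliated_schwarz_symmetric B beta' f.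
  by apply: foliated_ae_eq; apply: nearW => x Bx; rewrite patchE mem_set.
split => //; apply: onB.
- by apply: symmetric_on => //; [exact: perforated_ball_sub|move=> a a0 /(key a a0)[]].
- by apply: symmetric_on => //; [exact: perforated_ball_sub|move=> a a0 /(key a a0)[]].
- apply: symmetric_on; rewrite ?enormN//; first exact: perforated_ball_sub.
  move=> a a0; rewrite dotvNr => ab; have na0 : - a != 0 by rewrite oppr_eq0.
  have [|_ _ WE] := key (- a) na0; first by rewrite dotvNl.
  have tp := tilt_polarize_ge0 a W.
  have WE' := ae_refl a WE; rewrite opprK in WE WE'.
  apply: filterS2 WE WE' => x Wx Wsx.
  by have := tp x; rewrite /tilt -Wx -Wsx.
Qed.

(** Only directions [a] on the side of [- e1] are available, and for these the hole decides to which
    side [u] is tilted. The directions orthogonal to [e1] are limits of such directions, so the first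
    moment has a nonnegative component along them, which decides there as well. *)
Lemma symmetric_eccentric : 0 < t -> {ae mu, forall x, B x -> V0 x = 0} ->
  foliated_schwarz_in Rad r t (- e1) u /\ foliated_schwarz_in Rad r t (- e1) g.
Proof.
move=> tp V00.
have W00 : {ae mu, forall x, W x = 0}.
  have VE : equimeasurable B V0 V by case: gVmin.
  have V0' : {ae mu, forall x, B x -> V x = 0}.
    by apply: (equimeasurable_ae mB Boo (measurable_Lq V0q) VE (measurable_set1 0)).
  apply: filterS2 V0' (nneg_rep_ae V_ge0) => x Vx ->; rewrite patchE; case: ifPn => // xB.
  by apply: Vx; exact: set_mem.
have mass0 w : measurable_fun setT w -> mass W w = 0%E.
  move=> mw; rewrite (@mass_ae_eq _ _ W (cst 0) w w)//; last exact: nearW.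
  by rewrite /mass; under eq_integral do rewrite mul0r; rewrite integral0.
have dich a : a != 0 -> dotv e1 a <= 0 ->
    ({ae mu, forall x, 0 <= tilt a U x} \/ {ae mu, forall x, tilt a U x <= 0}) /\
    ({ae mu, forall x, 0 <= tilt a U x} -> {ae mu, forall x, 0 <= tilt a G x}).
  move=> a0 ea; have [] := polarized Wc a0.
  - by rewrite mulr_ge0_le0.
  - by rewrite !mass0//; exact: measurable_polarize.
  - by move=> x; rewrite subrr mul0r.
  by move=> H1 H2; split => // /H2[].
have strict a : dotv e1 a < 0 -> 0 <= dotv m a.
  move=> ea; have a0 : a != 0 by apply: contraTneq ea => ->; rewrite dotv0 ltxx.
  have [[tU|tU] _] := dich a a0 (ltW ea).
    by have [] := tilt_first_moment mU U_off U2 tU.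
  exfalso; apply: (tilt_le0_absurd N0 r0 t0 tRr _ _ U_gt0 tU).
    by rewrite pmulr_rlt0.
  by case: UB.
have weak a : dotv e1 a <= 0 -> 0 <= dotv m a.
  move=> ea; rewrite leNgt; apply/negP => ma.
  pose e := - dotv m a / (`|dotv m e1| + 1).
  have k0 : 0 < `|dotv m e1| + 1 by rewrite ltr_wpDl.
  have e0 : 0 < e by rewrite divr_gt0// oppr_gt0.
  have : 0 <= dotv m (a - e *: e1).
    apply: strict; rewrite dotvDr dotvNr dotvZr -sqr_enorm enorm_e1// expr1n mulr1.
    by rewrite subr_lt0 (le_lt_trans ea).
  rewrite dotvDr dotvNr dotvZr.
  have : e * - dotv m e1 < - dotv m a.
    apply: (@le_lt_trans _ _ (e * `|dotv m e1|)).
      by rewrite ler_wpM2l ?(ltW e0)// -normrN ler_norm.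
    rewrite /e mulrAC ltr_pdivrMr// ltr_pM2l ?oppr_gt0// ltrDl; exact: ltr01.
  rewrite mulrN; lra.
have key a : a != 0 -> 0 <= dotv a (- e1) -> {ae mu, forall x, 0 <= tilt a U x} /\
    {ae mu, forall x, 0 <= tilt a G x}.
  rewrite dotvNr oppr_ge0 dotvC => a0 ea; have [H1 H2] := dich a a0 ea.
  have tU := decide H1 (weak a ea).
  by split => //; exact: H2.
have mR : measurable (eball 0 Rad : set 'rV[R]_N) by exact: measurable_eball.
rewrite /foliated_schwarz_in (gt_eqF tp).
by split; apply: symmetric_on => //; rewrite ?enormN ?enorm_e1// => a a0 /(key a a0)[].
Qed.

End minimizing_configuration.

Theorem theorem1p4 (R : realType) (N : nat) (s q r Rad t : R)
    (g0 V0 g V u : 'rV[R]_N -> R) :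
  (2 <= N)%N -> 0 < s < 1 -> N%:R / (2 * s) < q ->
  0 < r < Rad -> 0 <= t < Rad - r ->
  let B : set 'rV[R]_N := perforated_ball Rad r t in
  let mu := @lebesgue_rV R N in
  in_Lq q B g0 -> in_Lq q B V0 ->
  {ae mu, forall x, B x -> 0 <= g0 x} -> {ae mu, forall x, B x -> 0 <= V0 x} ->
  ~ {ae mu, forall x, B x -> g0 x = 0} ->
  minimizing_weights s B g0 V0 g V ->
  first_eigenfunction s B g V u -> {ae mu, forall x, B x -> 0 < u x} ->
  (t = 0 ->
     exists beta : 'rV[R]_N,
       [/\ enorm beta = 1,
           foliated_schwarz_in Rad r t beta u,
           foliated_schwarz_in Rad r t beta g &
           foliated_schwarz_in Rad r t (- beta) V]) /\
  (0 < t -> {ae mu, forall x, B x -> V0 x = 0} ->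
     foliated_schwarz_in Rad r t (- e1) u /\
     foliated_schwarz_in Rad r t (- e1) g).
Proof.
move=> N2 s01 Nsq /andP[r0 rR] /andP[t0 tR] B mu g0q V0q g00 V00 _ minw eig u0; split.
  exact: (symmetric_annulus N2 s01 Nsq g0q V0q g00 V00 minw eig u0).
exact: (symmetric_eccentric N2 s01 Nsq r0 t0 tR g0q V0q g00 V00 minw eig u0).
Qed.
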